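(* Let $\sigma\colon(\mathcal M,L)\to(\mathcal B,\tilde L)$ be a pseudo-Finsler submersion such that for every $v\in\mathcal A$ the vertical space at $\pi(v)$ is $g_v$-non-degenerate. For each horizontal $v$ at $p$ with a local horizontal projectable extension $V$ whose projection $\tilde V$ satisfies $\tilde\nabla^{\tilde v}\tilde V=0$ (where $\tilde v=d\sigma(v)$ and $\tilde\nabla$ is the Levi-Civita–Chern connection of $(\mathcal B,\tilde L)$), and $g_v$-horizontal vectors $x,y$ at $p$ with $g_V$-horizontal extensions $X$ and $Y$, \begin{align*} \mathbf A^v_xy&=\tfrac12[X,Y]^\top_v+(\mathbf T+\mathbf A)^v_{C^\sharp_v(x,y)}v+C^\sharp_v(\mathbf A^v_xv,y)^\top_v-C^\sharp_v(x,\mathbf A^v_yv)^\top_v,\\ \mathbf A^v_xv&=\tfrac12[X,V]^\top_v, \end{align*} and $\mathbf A^v$ satisfies the almost-antisymmetry $\mathbf A^v_xy+\mathbf A^v_yx=2(\mathbf T+\mathbf A)^v_{C^\sharp_v(x,y)}v$.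
   Context: **Metrics.** A pseudo-Finsler metric on $\mathcal M$ (with projection $\pi\colon T\mathcal M\to\mathcal M$) is a smooth $L\colon\mathcal A\to\mathbb R$, $\mathcal A\subset T\mathcal M\setminus\mathbf 0$ open and invariant under positive scalar multiplication, with $L(\lambda v)=\lambda^2L(v)$ for $\lambda>0$ and with non-degenerate fundamental tensor $g_v(e,h)=\frac12\frac{\partial^2}{\partial s\partial t}L(v+se+th)|_{s=t=0}$. Elements of $\mathcal A$ are admissible. Cartan tensor: $C_v(b,e,h)=\frac14\frac{\partial^3}{\partial r\partial s\partial t}L(v+rb+se+th)|_{r=s=t=0}$; $C^\sharp_v$ is defined by $g_v(b,C^\sharp_v(e,h))=C_v(b,e,h)$. **Anisotropic calculus.** An anisotropic vector field $\mathcal X$ assigns smoothly to $v\in\mathcal A$ a vector $\mathcal X_v\in T_{\pi(v)}\mathcal M$; $(\mathcal X_V)_q=\mathcal X_{V_q}$ for an admissible local vector field $V$. An anisotropic connection assigns to vector fields $E,H$ an anisotropic vector field $v\mapsto\nabla^v_EH$, $C^\infty$-linear in $E$, additive and Leibniz in $H$. For anisotropic vector fields $\nabla^v_e\mathcal X=\nabla^v_e(\mathcal X_V)-\frac{d}{dt}\mathcal X_{v+t\nabla^v_eV}|_{t=0}$ for any admissible local extension $V$ of $v$. The Levi-Civita–Chern connection is the unique anisotropic connection with $\nabla^v_EH-\nabla^v_HE=[E,H]_{\pi(v)}$ and $e(g_V(H,B))=g_v(\nabla^v_eH,B)+g_v(H,\nabla^v_eB)+2C_v(H,B,\nabla^v_eV)$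 for all $v$, $e$ and local admissible extensions $V$ of $v$. **Submersions.** Let $\sigma\colon\mathcal M\to\mathcal B$ be a surjective map with surjective differential, $\mathcal V_p=\ker d\sigma_p$ (vertical vectors). An admissible $v\in T_p\mathcal M$ is horizontal if $g_v(v,w)=0$ for all $w\in\mathcal V_p$; a vector is $g_v$-horizontal if it is $g_v$-orthogonal to $\mathcal V_p$. A vector field $V$ is horizontal if all its values are horizontal; $X$ is $g_V$-horizontal if $X_q$ is $g_{V_q}$-horizontal for all $q$; a vector field $V$ is projectable if $d\sigma\circ V=\tilde V\circ\sigma$ for some vector field $\tilde V$ on $\mathcal B$. $\sigma\colon(\mathcal M,L)\to(\mathcal B,\tilde L)$ is a pseudo-Finsler submersion if the restriction of $L$ to the tangent spaces of the fibers is a pseudo-Finsler metric on each fiber, and $L(v)=\tilde L(d\sigma(v))$ for every horizontal $v$ (in particular $d\sigma(v)$ is admissible). **O'Neill tensors.** For admissible $v\in T_p\mathcal M$, write $e=e^\top_v+e^\bot_v$ with $e^\top_v\in\mathcal V_p$ and $e^\bot_v$ $g_v$-horizontal; $E^\top,E^\bot$ are the anisotropic vector fields $v\mapsto(E_{\pi(v)})^\top_v$, $v\mapsto(E_{\pi(v)})^\bot_v$. With $\nabla$ the Levi-Civita–Chern connection of $(\mathcal M,L)$, put $\chi^v_he=(\nabla^v_hE^\bot)^\top_v+(\nabla^v_hE^\top)^\bot_v$ for any extension $E$ of $e$ (tensorial), and $\mathbf T^v_be=\chi^v_{b^\top_v}e$, $\mathbf A^v_be=\chi^v_{b^\bot_v}e$.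 *)

(* Defs.v *)
From HB Require Import structures.
From mathcomp Require Import all_boot all_order all_algebra.
From mathcomp Require Import all_classical all_reals all_analysis.
Set Implicit Arguments.
Unset Strict Implicit.
Unset Printing Implicit Defensive.
Import Order.TTheory GRing.Theory Num.Theory.
Import numFieldNormedType.Exports.
Local Open Scope classical_set_scope.
Local Open Scope ring_scope.

(* C^infinity on an open set U: every iterated directional derivative of f is
   (Frechet) differentiable, hence continuous, at every point of U. *)
Definition smooth_on (R : realType) (V W : normedModType R) (U : set V)
    (f : V -> W) : Prop :=
  forall (us : seq V) (x : V), U x ->
    differentiable (foldr (fun u (g : V -> W) => fun y => 'D_u g y) f us) x.

(* Smooth n-manifolds (without boundary), given by an atlas indexed by the
   points: [coord p] is a chart around p, with domain [dom p] and inverse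
   [coordV p]; values outside of the domains are irrelevant.  Choosing a chart
   around each point in a maximal atlas presents every smooth n-manifold in
   this way, and smoothness can be tested on the chosen charts. *)
Record manifold (R : realType) (n : nat) := Manifold {
  point :> topologicalType;
  dom : point -> set point;
  coord : point -> point -> 'rV[R]_n;
  coordV : point -> 'rV[R]_n -> point;
  manifold_hausdorff : hausdorff_space point;
  manifold_second_countable : @second_countable point;
  dom_center : forall p, dom p p;
  dom_open : forall p, open (dom p);
  coord_open : forall p, open (coord p @` dom p);
  coordK : forall p q, dom p q -> coordV p (coord p q) = q;
  coord_continuous : forall p, {within dom p, continuous (coord p)};
  coordV_continuous :
    forall p, {within coord p @` dom p, continuous (coordV p)};
  coord_change_smooth : forall p q,
    smooth_on (coord p @` (dom p `&` dom q)) (coord q \o coordV p) }.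

(* T_p M is 'rV_n: a tangent vector at p is represented by its components in
   the preferred chart [coord p].  Hence a vector field is a map M -> 'rV_n, a
   subset of TM is a map M -> set 'rV_n, and passing to another chart uses
   [comp_change a b q], which maps the components in the chart [coord a] of a
   vector at q to its components in the chart [coord b]. *)
Section Tangent.
Context {R : realType} {n : nat} {M : manifold R n}.
Local Notation V := 'rV[R]_n.

Definition comp_change (a b q : M) (v : V) : V :=
  'd (@coord R n M b \o @coordV R n M a) (coord a q) v.

Definition smooth_fun (U : set M) (f : M -> R) : Prop :=
  forall p : M, smooth_on (coord p @` (dom p `&` U)) (f \o @coordV R n M p).

Definition vf_in_chart (p : M) (X : M -> V) (x : V) : V :=
  comp_change (coordV p x) p (coordV p x) (X (coordV p x)).

Definition smooth_vf (U : set M) (X : M -> V) : Prop :=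
  forall p : M, smooth_on (coord p @` (dom p `&` U)) (vf_in_chart p X).

(* The vector field near p with constant components e in the chart at p; its
   value at p is e. *)
Definition const_ext (p : M) (e : V) (q : M) : V := comp_change p q q e.

(* e(f), for e tangent at p *)
Definition dfun (f : M -> R) (p : M) (e : V) : R :=
  'D_e (f \o @coordV R n M p) (coord p p).

Definition bracket (X Y : M -> V) (p : M) : V :=
  'D_(X p) (vf_in_chart p Y) (coord p p)
  - 'D_(Y p) (vf_in_chart p X) (coord p p).

(* The vector of TM with coordinates z = (position, components) in the chart
   of TM induced by [coord p]. *)
Definition tvec (p : M) (z : V * V) : V := const_ext p z.2 (coordV p z.1).

(* S, in the chart of TM induced by [coord p] *)
Definition tset_in_chart (p : M) (S : M -> set V) : set (V * V) :=
  [set z | (coord p @` dom p) z.1 /\ S (coordV p z.1) (tvec p z)].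

(* Anisotropic vector fields are maps M -> 'rV_n -> 'rV_n, where X q v is the
   vector assigned to v tangent at q. *)
Definition avf_in_chart (p : M) (X : M -> V -> V) (z : V * V) : V :=
  comp_change (coordV p z.1) p (coordV p z.1) (X (coordV p z.1) (tvec p z)).

Definition smooth_avf (S : M -> set V) (X : M -> V -> V) : Prop :=
  forall p : M, smooth_on (tset_in_chart p S) (avf_in_chart p X).

End Tangent.

Definition nondegenerate_on (R : realType) (n : nat)
    (b : 'rV[R]_n -> 'rV[R]_n -> R) (W : set 'rV[R]_n) : Prop :=
  forall e, W e -> (forall h, W h -> b e h = 0) -> e = 0.

(* (1/2) d^2/dsdt f(v + s e + t h) at s = t = 0 *)
Definition fundamental_form (R : realType) (n : nat) (f : 'rV[R]_n -> R)
    (v e h : 'rV[R]_n) : R :=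
  2^-1 * 'D_e (fun w => 'D_h f w) v.

Record pseudo_finsler (R : realType) (n : nat) (M : manifold R n) :=
  PseudoFinsler {
  adm : M -> set 'rV[R]_n;
  lag :> M -> 'rV[R]_n -> R;
  adm_open : forall p : M, open (tset_in_chart p adm);
  adm_neq0 : forall p v, adm p v -> v != 0;
  adm_conic : forall p v (l : R), adm p v -> 0 < l -> adm p (l *: v);
  lag_smooth : forall p : M, smooth_on (tset_in_chart p adm)
    (fun z => lag (coordV p z.1) (tvec p z));
  lag_homogeneous : forall p v (l : R), adm p v -> 0 < l ->
    lag p (l *: v) = l ^+ 2 * lag p v;
  lag_nondegenerate : forall p v, adm p v ->
    nondegenerate_on (fundamental_form (lag p) v) setT }.

Section Anisotropic.
Context {R : realType} {n : nat} {M : manifold R n} (L : pseudo_finsler M).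
Local Notation V := 'rV[R]_n.

Definition fund (p : M) (v e h : V) : R := fundamental_form (L p) v e h.

Definition cartan (p : M) (v b e h : V) : R :=
  4^-1 * 'D_b (fun w => 'D_e (fun u => 'D_h (L p) u) w) v.

Definition cartan_sharp (p : M) (v e h : V) : V :=
  xget 0 [set c | forall b, fund p v b c = cartan p v b e h].

(* Local vector fields on an open set U are maps M -> 'rV_n of which only the
   values on U matter. *)
Record anisotropic_connection (nabla : (M -> V) -> (M -> V) -> (M -> V -> V)) :
    Prop := {
  conn_smooth : forall (U : set M) (E H : M -> V), open U ->
    smooth_vf U E -> smooth_vf U H ->
    smooth_avf (fun q v => U q /\ adm L q v) (nabla E H);
  conn_linear : forall (U : set M) (f : M -> R) (E E' H : M -> V), open U ->
    smooth_fun U f -> smooth_vf U E -> smooth_vf U E' -> smooth_vf U H ->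
    forall p v, U p -> adm L p v ->
    nabla (fun q => f q *: E q + E' q) H p v =
    f p *: nabla E H p v + nabla E' H p v;
  conn_additive : forall (U : set M) (E H H' : M -> V), open U ->
    smooth_vf U E -> smooth_vf U H -> smooth_vf U H' ->
    forall p v, U p -> adm L p v ->
    nabla E (fun q => H q + H' q) p v = nabla E H p v + nabla E H' p v;
  conn_leibniz : forall (U : set M) (f : M -> R) (E H : M -> V), open U ->
    smooth_fun U f -> smooth_vf U E -> smooth_vf U H ->
    forall p v, U p -> adm L p v ->
    nabla E (fun q => f q *: H q) p v =
    dfun f p (E p) *: H p + f p *: nabla E H p v }.

Variable nabla : (M -> V) -> (M -> V) -> (M -> V -> V).

(* nabla^v_e H for a vector e at p.  By C^infinity-linearity, any extension of
   e may be used; we take the constant one. *)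
Definition nabla_at (p : M) (v e : V) (H : M -> V) : V :=
  nabla (const_ext p e) H p v.

(* nabla^v_e X for an anisotropic vector field X, through the extension Z of
   v = Z p *)
Definition nabla_avf (Z : M -> V) (p : M) (e : V) (X : M -> V -> V) : V :=
  nabla_at p (Z p) e (fun q => X q (Z q))
  - 'D_(nabla_at p (Z p) e Z) (X p) (Z p).

Record levi_civita_chern : Prop := {
  chern_connection : anisotropic_connection nabla;
  chern_torsion_free : forall (U : set M) (E H : M -> V), open U ->
    smooth_vf U E -> smooth_vf U H ->
    forall p v, U p -> adm L p v ->
    nabla E H p v - nabla H E p v = bracket E H p;
  chern_almost_metric : forall (U : set M) (Z H B : M -> V), open U ->
    smooth_vf U Z -> (forall q, U q -> adm L q (Z q)) ->
    smooth_vf U H -> smooth_vf U B ->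
    forall p e, U p ->
    dfun (fun q => fund q (Z q) (H q) (B q)) p e =
    fund p (Z p) (nabla_at p (Z p) e H) (B p)
    + fund p (Z p) (H p) (nabla_at p (Z p) e B)
    + 2 * cartan p (Z p) (H p) (B p) (nabla_at p (Z p) e Z) }.

End Anisotropic.

Section Submersion.
Context {R : realType} {n m : nat} {M : manifold R n} {B : manifold R m}.
Variable sigma : M -> B.

Definition dmap (p : M) (v : 'rV[R]_n) : 'rV[R]_m :=
  'd (@coord R m B (sigma p) \o sigma \o @coordV R n M p) (coord p p) v.

Definition smooth_map : Prop :=
  continuous sigma /\
  forall (p : M) (b : B),
    smooth_on (coord p @` (dom p `&` sigma @^-1` dom b))
      (@coord R m B b \o sigma \o @coordV R n M p).

Definition submersion : Prop :=
  [/\ smooth_map, (forall b, exists p, sigma p = b)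
    & forall p w, exists v, dmap p v = w].

Definition vertical (p : M) : set 'rV[R]_n := [set w | dmap p w = 0].

(* x is g_v-horizontal *)
Definition ghorizontal (L : pseudo_finsler M) (p : M) (v x : 'rV[R]_n) : Prop :=
  forall w, vertical p w -> fund L p v x w = 0.

(* The tangent space at p of the fibre through p is [vertical p].  On it, the
   restriction of L is automatically smooth and homogeneous, with open conic
   domain, and the fundamental tensor of the restriction is the restriction of
   the fundamental tensor; only the non-degeneracy of the latter is required
   for the fibres to be pseudo-Finsler. *)
Definition pseudo_finsler_submersion (L : pseudo_finsler M)
    (L' : pseudo_finsler B) : Prop :=
  [/\ submersion,
      (forall p v, adm L p v -> vertical p v ->
         nondegenerate_on (fund L p v) (vertical p))
    & forall p v, adm L p v -> ghorizontal L p v v ->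
        adm L' (sigma p) (dmap p v) /\ L p v = L' (sigma p) (dmap p v)].

(* Z projects onto Z', as vector fields on U and on the set sigma(U), which is
   open when U is open and sigma is a submersion. *)
Definition projects_to (U : set M) (Z : M -> 'rV[R]_n) (Z' : B -> 'rV[R]_m) :
    Prop :=
  smooth_vf (sigma @` U) Z' /\ forall q, U q -> dmap q (Z q) = Z' (sigma q).

Variable L : pseudo_finsler M.
Local Notation V := 'rV[R]_n.

(* e^top_v, unique when [vertical p] is g_v-non-degenerate *)
Definition vpart (p : M) (v e : V) : V :=
  xget 0 [set w | vertical p w /\ ghorizontal L p v (e - w)].

Definition hpart (p : M) (v e : V) : V := e - vpart p v e.

Variable nabla : (M -> V) -> (M -> V) -> (M -> V -> V).

(* The result does not depend on the local extensions of v and e; we use the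
   constant ones in the chart at p.  The former is admissible near p. *)
Definition oneill_chi (p : M) (v h e : V) : V :=
  let E := const_ext p e in
  let Z := const_ext p v in
  vpart p v (nabla_avf nabla Z p h (fun q w => hpart q w (E q)))
  + hpart p v (nabla_avf nabla Z p h (fun q w => vpart q w (E q))).

Definition oneillT (p : M) (v b e : V) : V := oneill_chi p v (vpart p v b) e.

Definition oneillA (p : M) (v b e : V) : V := oneill_chi p v (hpart p v b) e.

End Submersion.

(* Main.v *)
(** Fix p and a chart at p.  Write S for the differential of sigma at p, N c
   for the covariant derivative of V along c, and
   Q(c,e) = D^2 sigma(c,e) + Gamma'(Sc,Se) - S Gamma(c,e) for the second
   fundamental form of sigma; it is symmetric because both connections are
   torsion-free.  A horizontal vector is a critical point of L along the
   directions of ker S.  As g_v is non-degenerate there, every g_v-horizontal e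
   is tangent to horizontal vectors v + te + o(t), and comparing L and its first
   derivatives with those of L' along these vectors shows
   g_v(e,h) = g'_{Sv}(Se,Sh) for every h.  Differentiating this identity along
   a g_V-horizontal field H with the two almost-metricity rules gives
     g(D_c H,h) + 2 C(H,h,N c) = g'(Q(c,H) + S D_c H,Sh) + g'(SH,Q(c,h)),
   while the geodesic-type hypothesis on the projected field says
   Q(c,v) + S N c = 0.  Taking H = V, g(N c,h) = g'(Q(c,h),Sv), which is
   symmetric in c and h; hence N v = 0 and, by a Koszul cyclic-sum argument,
   N x is vertical for horizontal x.  The vertical part of the identity for
   H = Y then reads g(A_x y,w) = g'(Q(x,w),Sy), for vertical w, and the formulas
   follow from the symmetries of Q and C and from torsion-freeness. *)
Require Import Defs.
From HB Require Import structures.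
From mathcomp Require Import all_boot all_order all_algebra.
From mathcomp Require Import all_classical all_reals all_analysis.
From mathcomp Require Import ring lra.
Import Defs Order.TTheory GRing.Theory Num.Theory.
Import numFieldNormedType.Exports.
Local Open Scope classical_set_scope.
Local Open Scope ring_scope.
Set Implicit Arguments.
Unset Strict Implicit.
Unset Printing Implicit Defensive.

(** * Smooth maps *)

Section DifferentialCalculus.
Context {R : realType}.
Implicit Types V W : normedModType R.

(** The identity L = L' o S holds only on horizontal vectors, which form a nonlinear cone in each
    tangent space, so it cannot simply be differentiated. Derivatives are taken along one-sided
    families of critical vectors v + te + o(t), found by a minimisation argument; the resulting
    first-order comparison, used for L and then for its first derivatives, reaches the fundamental
    tensor.

    T and A are defined with extensions of v and e that are constant in a chart and need not be
    horizontal. Passing to the horizontal fields of the statement costs the derivative of u |->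
    e^top_u, which for horizontal e is the vertical part of 2 C^sharp(., e). This is the origin of
    the terms C^sharp(A_x v, y) and C^sharp(x, A_y v), which together with the bracket make up A_x y
    - A_y x. The term in T + A has another origin, the Cartan tensor in the metric rule: 2 C(x, y, N
    w) = 2 g(N C^sharp(x,y), w). It makes up A_x y + A_y x, and the stated formula is half of the
    total. *)

Lemma differentiable_eps V W (f : V -> W) x : differentiable f x ->
  forall e, 0 < e ->
  \forall h \near 0, `|f (h + x) - f x - 'd f x h| <= e * `|h|.
Proof.
move=> /diff_locally /eqaddoP df e e0; have := df e e0.
by apply: filterS => h; rewrite /= opprD addrA.
Qed.

Lemma differentiable_of_eps V W (f : V -> W) x (df : {linear V -> W}) :
  continuous df ->
  (forall e, 0 < e -> \forall h \near 0, `|f (h + x) - f x - df h| <= e * `|h|) ->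
  differentiable f x /\ 'd f x = df :> (V -> W).
Proof.
move=> cdf H.
have E : f \o shift x = cst (f x) + df +o_ 0 id.
  apply/eqaddoP => e e0; have := H e e0.
  by apply: filterS => h; rewrite /= opprD addrA.
have dE := diff_unique cdf E.
by split=> //; apply/diff_locallyP; rewrite dE.
Qed.

Lemma near_eq_diff V W (f g : V -> W) x : (\near x, f x = g x) ->
  differentiable f x -> differentiable g x /\ 'd g x = 'd f x :> (V -> W).
Proof.
move=> fg df; apply: differentiable_of_eps; first exact: diff_continuous.
move=> e e0; have H := differentiable_eps df e0.
have fg' : \forall h \near 0, f (h + x) = g (h + x).
  move: fg; rewrite (near_shift 0 x) subr0.
  by apply: filterS => h /=.
have fgx : f x = g x by exact: nbhs_singleton fg.
by move: H fg'; apply: filterS2 => h; rewrite fgx => H <-.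
Qed.

Lemma diff_derive V W (f : V -> W) x v : differentiable f x -> 'd f x v = 'D_v f x.
Proof. by move=> /deriveE ->. Qed.

Lemma deriveDr V W (f : V -> W) x u v : differentiable f x ->
  'D_(u + v) f x = 'D_u f x + 'D_v f x.
Proof. by move=> df; rewrite !deriveE// linearD. Qed.

Lemma deriveZr V W (f : V -> W) x (a : R) v : differentiable f x ->
  'D_(a *: v) f x = a *: 'D_v f x.
Proof. by move=> df; rewrite !deriveE// linearZ. Qed.

Lemma derive_comp V W W' (f : V -> W) (g : W -> W') x v :
  differentiable f x -> differentiable g (f x) ->
  'D_v (g \o f) x = 'D_('D_v f x) g (f x).
Proof.
move=> df dg; rewrite !deriveE//; last exact: differentiable_comp.
by rewrite diff_comp.
Qed.

Lemma derive_linear_comp V W W' (l : {linear W -> W'}) (f : V -> W) x v :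
  continuous l -> differentiable f x -> 'D_v (l \o f) x = l ('D_v f x).
Proof.
move=> cl df; have dl : forall y, differentiable l y.
  by move=> y; exact: linear_differentiable.
by rewrite derive_comp// [LHS]deriveE// diff_lin.
Qed.

Lemma differentiable_linear_comp V W W' (l : {linear W -> W'}) (f : V -> W) x :
  continuous l -> differentiable f x -> differentiable (l \o f) x.
Proof.
by move=> cl df; apply: differentiable_comp => //; exact: linear_differentiable.
Qed.

End DifferentialCalculus.

Section Smooth.
Context {R : realType}.
Implicit Types V W : normedModType R.

Lemma smooth_differentiable V W (U : set V) (f : V -> W) x :
  smooth_on U f -> U x -> differentiable f x.
Proof. by move=> sf Ux; exact: (sf [::] x Ux). Qed.

Lemma smooth_derive V W (U : set V) (f : V -> W) u :
  smooth_on U f -> smooth_on U (fun y => 'D_u f y).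
Proof. by move=> sf us x Ux; have := sf (rcons us u) x Ux; rewrite foldr_rcons. Qed.

Lemma smooth_subset V W (U U' : set V) (f : V -> W) :
  U' `<=` U -> smooth_on U f -> smooth_on U' f.
Proof. by move=> UU' sf us x U'x; exact: (sf us x (UU' x U'x)). Qed.

(** [smooth_on] quantifies over lists of directions, which suits neither the product rule nor the
    chain rule. Bounding the number of derivatives and peeling off the innermost one gives a
    filtration on which closure properties go by induction on [k]. *)
Fixpoint smooth_upto V W (U : set V) (k : nat) (f : V -> W) : Prop :=
  (forall x, U x -> differentiable f x) /\
  if k is k'.+1 then forall u, smooth_upto U k' (fun y => 'D_u f y) else True.

Lemma smooth_upto_differentiable V W (U : set V) k (f : V -> W) x :
  smooth_upto U k f -> U x -> differentiable f x.
Proof. by case: k => [|k] [+ _]; exact. Qed.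

Lemma smooth_onP V W (U : set V) (f : V -> W) :
  smooth_on U f <-> forall k, smooth_upto U k f.
Proof.
split=> [sf k|].
  elim: k f sf => [|k IH] f sf; split=> //.
  - by move=> x; exact: smooth_differentiable.
  - by move=> x; exact: smooth_differentiable.
  - by move=> u; apply: IH; exact: smooth_derive.
move=> Cf us x Ux; move: (Cf (size us)) => {Cf}.
elim/last_ind: us f => [|us u IH] f; first by case=> + _; exact.
by rewrite size_rcons foldr_rcons => -[_ /(_ u) /IH].
Qed.

Lemma smooth_uptoW V W (U : set V) k (f : V -> W) : smooth_upto U k.+1 f -> smooth_upto U k f.
Proof.
elim: k f => [|k IH] f; first by case.
by case=> df Df; split=> // u; exact/IH/Df.
Qed.

Variables (V : normedModType R) (U : set V).
Hypothesis oU : open U.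

Lemma near_on (P : V -> Prop) x : (forall y, U y -> P y) -> U x ->
  \forall y \near x, P y.
Proof. by move=> UP Ux; apply: filterS UP _; exact: open_nbhs_nbhs. Qed.

Lemma derive_eq_on W (f g : V -> W) u x : (forall y, U y -> f y = g y) -> U x ->
  'D_u f x = 'D_u g x.
Proof. by move=> fg Ux; apply: near_eq_derive; exact: near_on. Qed.

Lemma differentiable_eq_on W (f g : V -> W) x : (forall y, U y -> f y = g y) ->
  U x -> differentiable f x -> differentiable g x.
Proof.
move=> fg Ux df; have fgx : \near x, f x = g x by exact: (near_on fg).
by case: (near_eq_diff fgx df).
Qed.

Lemma smooth_upto_eq W k (f g : V -> W) : (forall x, U x -> f x = g x) ->
  smooth_upto U k f -> smooth_upto U k g.
Proof.
elim: k f g => [|k IH] f g fg [df Df]; split=> //.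
- by move=> x Ux; apply: differentiable_eq_on (df x Ux).
- by move=> x Ux; apply: differentiable_eq_on (df x Ux).
- by move=> u; apply: IH (Df u) => x Ux; exact: derive_eq_on.
Qed.

Lemma smooth_eq W (f g : V -> W) : (forall x, U x -> f x = g x) ->
  smooth_on U f -> smooth_on U g.
Proof. by move=> fg /smooth_onP sf; apply/smooth_onP => k; exact: smooth_upto_eq (sf k). Qed.

Lemma smooth_upto_cst W k (a : W) : smooth_upto U k (fun=> a).
Proof.
elim: k a => [|k IH] a; split=> //; do ?by move=> x _; exact: differentiable_cst.
move=> u; apply: smooth_upto_eq (IH 0) => x _.
by rewrite -[RHS]/('D_u (cst a) x) derive_cst.
Qed.

Lemma smooth_cst W (a : W) : smooth_on U (fun=> a).
Proof. by apply/smooth_onP => k; exact: smooth_upto_cst. Qed.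

Lemma smooth_upto_add W k (f g : V -> W) : smooth_upto U k f -> smooth_upto U k g ->
  smooth_upto U k (fun x => f x + g x).
Proof.
elim: k f g => [|k IH] f g [df Df] [dg Dg]; split=> //;
  do ?by move=> x Ux; apply: differentiableD; [exact: df|exact: dg].
move=> u; apply: smooth_upto_eq (IH _ _ (Df u) (Dg u)) => x Ux.
by rewrite -[RHS]/('D_u (f + g) x) deriveD//; apply: diff_derivable;
  [exact: df|exact: dg].
Qed.

Lemma smooth_add W (f g : V -> W) : smooth_on U f -> smooth_on U g ->
  smooth_on U (fun x => f x + g x).
Proof. by move=> /smooth_onP sf /smooth_onP sg; apply/smooth_onP => k; exact: smooth_upto_add. Qed.

Lemma smooth_sum W (I : Type) (r : seq I) (f : I -> V -> W) :
  (forall i, smooth_on U (f i)) -> smooth_on U (fun x => \sum_(i <- r) f i x).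
Proof.
move=> sf; elim: r => [|i r IH].
  by apply: smooth_eq (smooth_cst 0) => x _; rewrite big_nil.
by apply: smooth_eq (smooth_add (sf i) IH) => x _; rewrite big_cons.
Qed.

Lemma smooth_upto_linear W W' (l : {linear W -> W'}) k (f : V -> W) : continuous l ->
  smooth_upto U k f -> smooth_upto U k (fun x => l (f x)).
Proof.
move=> cl; elim: k f => [|k IH] f [df Df]; split=> //;
  do ?by move=> x Ux; apply: (differentiable_linear_comp cl); exact: df.
move=> u; apply: smooth_upto_eq (IH _ (Df u)) => x Ux.
by rewrite -[RHS]/('D_u (l \o f) x) derive_linear_comp//; exact: df.
Qed.

Lemma smooth_linear W W' (l : {linear W -> W'}) (f : V -> W) : continuous l ->
  smooth_on U f -> smooth_on U (fun x => l (f x)).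
Proof. by move=> cl /smooth_onP sf; apply/smooth_onP => k; exact: smooth_upto_linear. Qed.

Lemma smooth_opp W (f : V -> W) : smooth_on U f -> smooth_on U (fun x => - f x).
Proof.
have cN : continuous (-%R : {linear W -> W}) by move=> x; exact: opp_continuous.
exact: smooth_linear.
Qed.

Lemma smooth_sub W (f g : V -> W) : smooth_on U f -> smooth_on U g ->
  smooth_on U (fun x => f x - g x).
Proof. by move=> sf sg; apply: smooth_add => //; exact: smooth_opp. Qed.

(** The product rule keeps each factor next to the derivative of the other, so the induction also
    uses the factors at one order less, by [smooth_uptoW]. *)
Lemma smooth_upto_mul k (f g : V -> R) : smooth_upto U k f -> smooth_upto U k g ->
  smooth_upto U k (fun x => f x * g x).
Proof.
elim: k f g => [|k IH] f g Cf Cg.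
  by split=> // x Ux; apply: differentiableM;
    [exact: (smooth_upto_differentiable Cf Ux)|exact: (smooth_upto_differentiable Cg Ux)].
split.
  by move=> x Ux; apply: differentiableM;
    [exact: (smooth_upto_differentiable Cf Ux)|exact: (smooth_upto_differentiable Cg Ux)].
move=> u; have [_ /(_ u) Df] := Cf; have [_ /(_ u) Dg] := Cg.
apply: smooth_upto_eq (smooth_upto_add (IH _ _ (smooth_uptoW Cf) Dg)
  (IH _ _ (smooth_uptoW Cg) Df)) => x Ux.
rewrite -[RHS]/('D_u (f * g) x) deriveM//; apply: diff_derivable;
  [exact: (smooth_upto_differentiable Cf Ux)|exact: (smooth_upto_differentiable Cg Ux)].
Qed.

Lemma smooth_mul (f g : V -> R) : smooth_on U f -> smooth_on U g ->
  smooth_on U (fun x => f x * g x).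
Proof. by move=> /smooth_onP sf /smooth_onP sg; apply/smooth_onP => k; exact: smooth_upto_mul. Qed.

Lemma smooth_prod (I : Type) (r : seq I) (f : I -> V -> R) :
  (forall i, smooth_on U (f i)) -> smooth_on U (fun x => \prod_(i <- r) f i x).
Proof.
move=> sf; elim: r => [|i r IH].
  by apply: smooth_eq (smooth_cst (1 : R)) => x _; rewrite big_nil.
by apply: smooth_eq (smooth_mul (sf i) IH) => x _; rewrite big_cons.
Qed.

(** The derivative -(1/f)(1/f) D_u f involves only 1/f and D_u f, so the induction runs with [f]
    fixed. *)
Lemma smooth_upto_inv k (f : V -> R) : (forall x, U x -> f x != 0) -> smooth_upto U k f ->
  smooth_upto U k (fun x => (f x)^-1).
Proof.
move=> f0; elim: k => [|k IH] Cf.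
  by split=> // x Ux; apply: differentiableV;
    [exact: (smooth_upto_differentiable Cf Ux)|exact: f0].
split.
  by move=> x Ux; apply: differentiableV;
    [exact: (smooth_upto_differentiable Cf Ux)|exact: f0].
move=> u; have [_ /(_ u) Df] := Cf.
have Ci := IH (smooth_uptoW Cf).
apply: smooth_upto_eq (smooth_upto_mul (smooth_upto_cst k (-1 : R))
  (smooth_upto_mul (smooth_upto_mul Ci Ci) Df)) => x Ux.
rewrite deriveV ?f0//; last by apply: diff_derivable; exact: (smooth_upto_differentiable Cf Ux).
by rewrite expr2 invfM [RHS]/GRing.scale/= mulN1r mulNr.
Qed.

Lemma smooth_inv (f : V -> R) : (forall x, U x -> f x != 0) -> smooth_on U f ->
  smooth_on U (fun x => (f x)^-1).
Proof. by move=> f0 /smooth_onP sf; apply/smooth_onP => k; exact: smooth_upto_inv. Qed.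

(** A finite frame with continuous coefficient functionals. It replaces a derivative in a varying
    direction by a combination of derivatives in fixed ones, for row vectors and for pairs of them
    alike. *)
Definition coordinates W (I : finType) (b : I -> W) (c : I -> {linear W -> R}) :=
  (forall i, continuous (c i)) /\ forall w, w = \sum_i c i w *: b i.

Lemma derive_coordinates W W' (I : finType) (b : I -> W) c (f : W -> W') w u :
  coordinates b c -> differentiable f w ->
  'D_u f w = \sum_i c i u *: 'D_(b i) f w.
Proof.
move=> [_ bc] df; rewrite deriveE// {1}(bc u) raddf_sum/=.
by apply: eq_bigr => i _; rewrite linearZ/= deriveE.
Qed.

(** D_u (f o g) is a derivative of [f] in the varying direction D_u g. Expanded on the frame, it is
    a sum of products of coefficients of D_u g with the functions (D_(b i) f) o g, to which the
    induction applies. *)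
Lemma smooth_upto_comp W (I : finType) (b : I -> W) c (U' : set W) k (f : W -> R) (g : V -> W) :
  coordinates b c -> (forall x, U x -> U' (g x)) -> smooth_upto U k g -> smooth_upto U' k f ->
  smooth_upto U k (fun x => f (g x)).
Proof.
move=> bc gU; have [cc _] := bc.
have Cc k' h i : smooth_upto U k' h -> smooth_upto U k' (fun x => c i (h x)).
  by exact: smooth_upto_linear.
have Csum k' (h : I -> V -> R) : (forall i, smooth_upto U k' (h i)) ->
    smooth_upto U k' (fun x => \sum_i h i x).
  move=> Ch; elim: (index_enum I) => [|i r IH].
    by apply: smooth_upto_eq (smooth_upto_cst k' 0) => x _; rewrite big_nil.
  by apply: smooth_upto_eq (smooth_upto_add (Ch i) IH) => x _; rewrite big_cons.
elim: k f => [|k IH] f Cg Cf.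
  by split=> // x Ux; apply: differentiable_comp;
    [exact: (smooth_upto_differentiable Cg Ux)|exact: (smooth_upto_differentiable Cf (gU _ Ux))].
split.
  by move=> x Ux; apply: differentiable_comp;
    [exact: (smooth_upto_differentiable Cg Ux)|exact: (smooth_upto_differentiable Cf (gU _ Ux))].
move=> u; have [_ /(_ u) Dg] := Cg; have [_ Df] := Cf.
apply: (smooth_upto_eq _ (Csum _ _ (fun i => smooth_upto_mul (Cc _ _ i Dg)
  (IH _ (smooth_uptoW Cg) (Df (b i)))))) => x Ux.
have dfx : differentiable f (g x) by exact: (smooth_upto_differentiable Cf (gU _ Ux)).
rewrite -[RHS]/('D_u (f \o g) x) [RHS]derive_comp//.
  by rewrite (derive_coordinates _ bc).
exact: (smooth_upto_differentiable Cg Ux).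
Qed.

Lemma smooth_comp W (I : finType) (b : I -> W) c (U' : set W) (f : W -> R) (g : V -> W) :
  coordinates b c -> (forall x, U x -> U' (g x)) -> smooth_on U g ->
  smooth_on U' f -> smooth_on U (fun x => f (g x)).
Proof.
move=> bc gU /smooth_onP sg /smooth_onP sf; apply/smooth_onP => k.
exact: (smooth_upto_comp bc gU).
Qed.

End Smooth.

Section MatrixSmooth.
Context {R : realType}.
Implicit Types V W : normedModType R.

(** The two difference quotients are the same function of [t], whether or not they converge. This is
    the tool for passing between lines, fibres and charts. *)
Lemma derive_affine V W W' (A : V -> W) (f : W -> W') v e e' :
  (forall t : R, A (t *: e + v) = t *: e' + A v) ->
  'D_e (f \o A) v = 'D_e' f (A v).
Proof.
move=> HA; rewrite /derive; set F := (fun _ : R => _); set G := (fun _ : R => _).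
suff -> : F = G by [].
by apply/funext => t; rewrite /F /G /= HA.
Qed.

Definition row_coord {n} (i : 'I_n) (v : 'rV[R]_n) : R := v 0 i.

Fact row_coord_is_linear n (i : 'I_n) : linear (row_coord i).
Proof. by move=> a u v; rewrite /row_coord !mxE. Qed.

HB.instance Definition _ n (i : 'I_n) :=
  GRing.isLinear.Build R 'rV[R]_n R _ (row_coord i) (row_coord_is_linear i).

Lemma row_coord_continuous n (i : 'I_n) : continuous (row_coord i).
Proof. by move=> v; exact: (differentiable_continuous (differentiable_coord v 0 i)). Qed.

Definition row_basis {n} (i : 'I_n) : 'rV[R]_n := delta_mx 0 i.

Lemma coordinates_row n : coordinates (@row_basis n) (fun i => row_coord i).
Proof.
split; first by move=> i; exact: row_coord_continuous.
by move=> w; rewrite {1}(row_sum_delta w).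
Qed.

Definition pair_basis {n m} (i : 'I_n + 'I_m) : ('rV[R]_n * 'rV[R]_m)%type :=
  match i with inl j => (row_basis j, 0) | inr j => (0, row_basis j) end.

Definition pair_coord {n m} (i : 'I_n + 'I_m) : {linear ('rV[R]_n * 'rV[R]_m)%type -> R} :=
  match i with
  | inl j => (row_coord j \o fst : {linear _ -> _})
  | inr j => (row_coord j \o snd : {linear _ -> _})
  end.

Lemma coordinates_pair n m : coordinates (@pair_basis n m) pair_coord.
Proof.
split.
  case=> j w /=.
    by apply: continuous_comp; [exact: cvg_fst|exact: row_coord_continuous].
  by apply: continuous_comp; [exact: cvg_snd|exact: row_coord_continuous].
move=> [a b]; rewrite big_sumType/=.
have -> : \sum_i row_coord i a *: (row_basis i, 0) = (a, 0) :> ('rV[R]_n * 'rV[R]_m)%type.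
  rewrite (_ : \sum_i _ = (\sum_i row_coord i a *: row_basis i, 0)).
    by rewrite -(proj2 (coordinates_row n) a).
  elim/big_rec2: _ => // i y1 _ _ ->; rewrite /GRing.add/= /add_pair/=.
  by rewrite scaler0 addr0.
have -> : \sum_i row_coord i b *: (0, row_basis i) = (0, b) :> ('rV[R]_n * 'rV[R]_m)%type.
  rewrite (_ : \sum_i _ = (0, \sum_i row_coord i b *: row_basis i)).
    by rewrite -(proj2 (coordinates_row m) b).
  elim/big_rec2: _ => // i y1 _ _ ->; rewrite /GRing.add/= /add_pair/=.
  by rewrite scaler0 addr0.
by rewrite /GRing.add/= /add_pair/= addr0 add0r.
Qed.

Variables (V : normedModType R) (U : set V).
Hypothesis oU : open U.

Lemma smooth_rowP n (f : V -> 'rV[R]_n) :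
  smooth_on U f <-> forall j, smooth_on U (fun x => f x 0 j).
Proof.
split=> [sf j|sf].
  have := @smooth_linear _ _ _ oU _ _ (row_coord j : {linear _ -> _}) f.
  by apply => //; exact: row_coord_continuous.
pose l j : R -> 'rV[R]_n := fun a => a *: row_basis j.
have ll j : linear (l j) by move=> a u v; rewrite /l scalerDl scalerA.
pose L j : {linear R -> 'rV[R]_n} := HB.pack (l j) (GRing.isLinear.Build _ _ _ _ _ (ll j)).
have cL j : continuous (L j) by exact: scalel_continuous.
have /= := smooth_sum oU (index_enum 'I_n) (fun j => smooth_linear oU (cL j) (sf j)).
by apply: (smooth_eq oU) => x _; rewrite [RHS]row_sum_delta.
Qed.

Definition smooth_mx a b (A : V -> 'M[R]_(a, b)) : Prop :=
  forall i j, smooth_on U (fun x => A x i j).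

Lemma smooth_mx_tr a b (A : V -> 'M[R]_(a, b)) :
  smooth_mx A -> smooth_mx (fun x => (A x)^T).
Proof. by move=> sA i j; apply: (smooth_eq oU) (sA j i) => x _; rewrite mxE. Qed.

Lemma smooth_mx_mul a b c (A : V -> 'M[R]_(a, b)) (B : V -> 'M[R]_(b, c)) :
  smooth_mx A -> smooth_mx B -> smooth_mx (fun x => A x *m B x).
Proof.
move=> sA sB i j.
have := smooth_sum oU (index_enum 'I_b) (fun k => smooth_mul oU (sA i k) (sB k j)).
by apply: (smooth_eq oU) => x _; rewrite mxE.
Qed.

Lemma smooth_mx_det a (A : V -> 'M[R]_a) :
  smooth_mx A -> smooth_on U (fun x => \det (A x)).
Proof.
move=> sA.
apply: smooth_sum => // s; apply: smooth_mul => //; first exact: smooth_cst.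
by apply: smooth_prod => // i; exact: sA.
Qed.

(** Cramer's rule: the entries are cofactors divided by a determinant without zeros on [U]. *)
Lemma smooth_mx_inv a (A : V -> 'M[R]_a) :
  (forall x, U x -> A x \in unitmx) -> smooth_mx A ->
  smooth_mx (fun x => invmx (A x)).
Proof.
move=> uA sA i j.
have sd : smooth_on U (fun x => (\det (A x))^-1).
  apply: smooth_inv => //; last exact: smooth_mx_det.
  by move=> x /uA; rewrite unitmxE unitfE.
have sc : smooth_on U (fun x => cofactor (A x) j i).
  apply: smooth_mul => //; first exact: smooth_cst.
  by apply: smooth_mx_det => k l;
    apply: (smooth_eq oU) (sA (lift j k) (lift i l)) => x _; rewrite !mxE.
apply: (smooth_eq oU) (smooth_mul oU sd sc) => x Ux.
by rewrite /invmx (uA _ Ux) !mxE.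
Qed.

End MatrixSmooth.

(** * Symmetry of mixed second derivatives *)

Section Schwarz.
Context {R : realType} {V : normedModType R}.
Implicit Types f : V -> R.

Let line (e x : V) (t : R) : V := t *: e + x.

Let is_derive_line f e x t : differentiable f (line e x t) ->
  is_derive t 1 (fun s => f (line e x s)) ('D_e f (line e x t)).
Proof.
move=> df; have dl : differentiable (line e x) t.
  by apply: differentiableD.
apply: DeriveDef; first exact/diff_derivable/differentiable_comp.
rewrite -[LHS]/('D_1 (f \o line e x) t); apply: derive_affine => s.
by rewrite /line [s%:A]mulr1 scalerDl addrA.
Qed.

(** Young's argument: the mean value theorem in the direction [e] turns the second difference into
    [t] times an increment of D_e f between two points at distance O(t) from [x]. Differentiability
    of D_e f at [x] evaluates that increment up to o(t). *)
Lemma second_difference f e h x :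
  (\forall y \near x, differentiable f y) -> differentiable ('D_e f) x ->
  forall eps, 0 < eps -> \forall t \near 0^'+,
  `|f (t *: e + (t *: h + x)) - f (t *: e + x) - f (t *: h + x) + f x
    - t ^+ 2 * 'D_h ('D_e f) x| <= eps * t ^+ 2.
Proof.
move=> dfx dg eps eps0; set g := 'D_e f.
(* For a, b in [0, t] the vector ae + bh has norm at most tC, the summand 1 making [C] positive. The
   factor 2 in [eps'] accounts for the two remainders that are added at the end. *)
pose C := `|e| + `|h| + 1.
have C0 : 0 < C by rewrite /C; have := normr_ge0 e; have := normr_ge0 h; lra.
pose eps' := eps / (2 * C).
have eps'0 : 0 < eps' by rewrite divr_gt0// mulr_gt0.
have := differentiable_eps dg eps'0.
have dfx0 : \forall k \near 0, differentiable f (k + x).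
  by move: dfx; rewrite (near_shift 0 x) subr0; apply: filterS.
move=> /(filterI dfx0) /nbhs_ballP[d d0 Hd].
have {}Hd k : `|k| < d -> differentiable f (k + x) /\
    `|g (k + x) - g x - 'd g x k| <= eps' * `|k|.
  by move=> kd; apply: Hd; rewrite -ball_normE/= sub0r normrN.
near=> t; have t0 : 0 < t by [].
have tC : t * C < d.
  rewrite -ltr_pdivlMr//; near: t; apply: nbhs_right_lt; exact: divr_gt0.
have small a b : 0 <= a <= t -> 0 <= b <= t ->
    `|a *: e + b *: h| <= t * C /\ `|a *: e + b *: h| < d.
  move=> /andP[a0 at_] /andP[b0 bt].
  suff H : `|a *: e + b *: h| <= t * C by split=> //; exact: le_lt_trans H tC.
  apply: (le_trans (ler_normD _ _)); rewrite !normrZ !ger0_norm// /C !mulrDr mulr1.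
  rewrite -[leLHS]addr0; apply: lerD; last exact: ltW.
  by apply: lerD; exact: ler_wpM2r.
pose psi s := f (line e (t *: h + x) s) - f (line e x s).
have lineE s : line e (t *: h + x) s = s *: e + t *: h + x by rewrite /line addrA.
have lineE0 s : line e x s = s *: e + 0 *: h + x by rewrite /line scale0r addr0.
have dpsi s : 0 <= s <= t -> is_derive s 1 psi
    (g (line e (t *: h + x) s) - g (line e x s)).
  move=> st; apply: is_deriveB; apply: is_derive_line.
    by rewrite lineE; apply (Hd _); apply small; rewrite // lexx ltW.
  by rewrite lineE0; apply (Hd _); apply small; rewrite // lexx ltW.
have [s st Es] : exists2 s, s \in `]0, t[ &
    psi t - psi 0 = (g (line e (t *: h + x) s) - g (line e x s)) * (t - 0).
  apply: (@MVT _ psi (fun s => g (line e (t *: h + x) s) - g (line e x s))) => //.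
    by move=> s; rewrite in_itv/= => /andP[s0 st]; apply: dpsi; rewrite !ltW.
  apply: continuous_in_subspaceT => s; rewrite inE/= in_itv/= => /andP[s0 st].
  apply: differentiable_continuous; apply/derivable1_diffP.
  by have [] := dpsi s; first by rewrite s0 st.
move: st; rewrite in_itv/= => /andP[s0 st].
have st0 : 0 <= s <= t by rewrite !ltW.
have tt : 0 <= t <= t by rewrite ltW ?lexx.
have z0 : (0 : R) <= 0 <= t by apply/andP; split=> //; exact: ltW.
have [N1 /Hd[_ H1]] := small s t st0 tt; have [N2 /Hd[_ H2]] := small s 0 st0 z0.
set D := (X in `|X - _|).
have -> : D = psi t - psi 0.
  by rewrite /D /psi /line !scale0r !add0r; ring.
rewrite Es subr0 lineE lineE0.
have dgh : 'D_h g x = 'd g x h by rewrite deriveE.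
rewrite dgh; set dh := 'd g x h.
set G1 := g _ in H1 *; set G2 := g _ in H2 *.
have E1 : 'd g x (s *: e + t *: h) = s * 'd g x e + t * dh.
  by rewrite linearD !linearZ.
have E2 : 'd g x (s *: e + 0 *: h) = s * 'd g x e.
  by rewrite linearD !linearZ/= scale0r addr0.
rewrite E1 in H1; rewrite E2 in H2.
have B1 : eps' * `|s *: e + t *: h| <= eps' * (t * C).
  by rewrite ler_pM2l.
have B2 : eps' * `|s *: e + 0 *: h| <= eps' * (t * C).
  by rewrite ler_pM2l.
have -> : (G1 - G2) * t - t ^+ 2 * dh = t * ((G1 - g x - (s * 'd g x e + t * dh))
   - (G2 - g x - s * 'd g x e)) by ring.
rewrite normrM (gtr0_norm t0) expr2 mulrCA ler_pM2l//.
apply: (le_trans (ler_normB _ _)).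
have -> : eps * t = eps' * (t * C) + eps' * (t * C).
  by rewrite /eps'; field; rewrite gt_eqF.
by apply: lerD; [exact: le_trans H1 B1|exact: le_trans H2 B2].
Unshelve. all: by end_near. Qed.

(** The second difference is symmetric in [e] and [h], so both mixed derivatives approximate the
    same quotient by t^2. *)
Lemma derive_comm f e h x :
  (\forall y \near x, differentiable f y) ->
  differentiable ('D_e f) x -> differentiable ('D_h f) x ->
  'D_e ('D_h f) x = 'D_h ('D_e f) x.
Proof.
move=> dfx de dh; apply/eqP; rewrite -subr_eq0 -normr_le0.
apply/ler_addgt0Pr => eps eps0; rewrite add0r.
have eps20 : 0 < eps / 2 by rewrite divr_gt0.
have S1 := @second_difference f e h x dfx de _ eps20.
have S2 := @second_difference f h e x dfx dh _ eps20.
have [t [/= [H1 H2] t0]] := filter_ex (filterI (filterI S1 S2) (nbhs_right_gt 0)).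
rewrite [t *: h + (t *: e + x)]addrCA in H2.
have t20 : 0 < t ^+ 2 by rewrite exprn_gt0.
rewrite -(ler_pM2l t20) -{1}(gtr0_norm t20) -normrM.
move: ('D_e ('D_h f) x) ('D_h ('D_e f) x) H1 H2 => Deh Dhe.
move: (f (t *: e + (t *: h + x))) (f (t *: e + x)) (f (t *: h + x)) (f x).
move=> a b c d H1 H2.
have -> : t ^+ 2 * (Deh - Dhe) =
  (a - b - c + d - t ^+ 2 * Dhe) - (a - c - b + d - t ^+ 2 * Deh) by ring.
apply: (le_trans (ler_normB _ _)).
have -> : t ^+ 2 * eps = eps / 2 * t ^+ 2 + eps / 2 * t ^+ 2 by field.
exact: lerD.
Qed.

Lemma smooth_derive_comm (U : set V) f e h x : open U -> smooth_on U f -> U x ->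
  'D_e ('D_h f) x = 'D_h ('D_e f) x.
Proof.
move=> oU sf Ux; apply: derive_comm.
- by apply: (near_on oU _ Ux) => y Uy; exact: smooth_differentiable sf Uy.
- exact: smooth_differentiable (smooth_derive e sf) Ux.
- exact: smooth_differentiable (smooth_derive h sf) Ux.
Qed.

End Schwarz.

(** * Zeros of maps and horizontal curves in a fibre *)

Section Zeros.
Context {R : realType}.

Lemma row_norm_ge n (w : 'rV[R]_n) j : `|w 0 j| <= `|w|.
Proof.
rewrite [leRHS]/Num.Def.normr/= mx_normrE.
exact: (le_bigmax _ (fun i : 'I_1 * 'I_n => `|w i.1 i.2|) (0, j)).
Qed.

Lemma row_norm_le n (w : 'rV[R]_n) a : 0 <= a -> (forall j, `|w 0 j| <= a) ->
  `|w| <= a.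
Proof.
move=> a0 H; rewrite [leLHS]/Num.Def.normr/= mx_normrE bigmax_le// => -[i j] _ /=.
by rewrite (ord1 i).
Qed.

Lemma row_linear_continuous n (W : normedModType R) (f : {linear 'rV[R]_n -> W}) :
  continuous f.
Proof.
have -> : (f : _ -> _) = \sum_(i < n) (fun v : 'rV[R]_n => row_coord i v *: f (row_basis i)).
  apply/funext => v; rewrite {1}(proj2 (coordinates_row n) v) raddf_sum fct_sumE/=.
  by apply: eq_bigr => i _; rewrite linearZ.
move=> v; apply: differentiable_continuous; apply: differentiable_sum => i.
by apply: differentiableZl; exact: differentiable_coord.
Qed.

(** The norm of row vectors is the maximum norm, which is not differentiable; the Euclidean square
    is, and can be minimised by means of its derivative. *)
Definition normsq n (w : 'rV[R]_n) : R := \sum_j (w 0 j) ^+ 2.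

Lemma normsq_ge n (w : 'rV[R]_n) : `|w| ^+ 2 <= normsq w.
Proof.
case: n w => [w|n w].
  rewrite (_ : w = 0) ?normr0 ?expr0n//= ?/normsq ?big_ord0//.
  by apply/rowP => -[].
rewrite -[leRHS]sqr_sqrtr; last by apply: sumr_ge0 => j _; exact: sqr_ge0.
rewrite ler_sqr ?nnegrE ?sqrtr_ge0//; apply: row_norm_le; first exact: sqrtr_ge0.
move=> j; rewrite -sqrtr_sqr ler_sqrt; last first.
  by apply: sumr_ge0 => k _; exact: sqr_ge0.
by rewrite /normsq (bigD1 j)//= lerDl; apply: sumr_ge0 => k _; exact: sqr_ge0.
Qed.

Lemma normsq_le n (w : 'rV[R]_n) : normsq w <= n%:R * `|w| ^+ 2.
Proof.
have -> : n%:R * `|w| ^+ 2 = \sum_(j < n) `|w| ^+ 2 by rewrite sumr_const card_ord mulr_natl.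
apply: ler_sum => j _; rewrite -[leLHS]ger0_norm ?sqr_ge0// normrX.
by rewrite lerXn2r ?nnegrE// row_norm_ge.
Qed.

Lemma normsq_eq0 n (w : 'rV[R]_n) : normsq w = 0 -> w = 0.
Proof.
move=> w0; apply/eqP; rewrite -normr_eq0 -sqrf_eq0 eq_le sqr_ge0 andbT.
by rewrite -w0 normsq_ge.
Qed.

(* The zero is found by minimising the squared Euclidean norm of f on the ball:
   the sphere condition makes the minimiser interior, where the surjectivity
   of the differential forces f to vanish. *)
Lemma exists_zero n (f : 'rV[R]_n -> 'rV[R]_n) (r : R) : 0 < r ->
  (forall z, `|z| <= r -> differentiable f z) ->
  (forall z, `|z| < r -> forall w, exists u, 'D_u f z = w) ->
  (forall z, `|z| = r -> n.+1%:R * `|f 0| < `|f z|) ->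
  exists z, `|z| < r /\ f z = 0.
Proof.
move=> r0 df sf fr; pose A := closed_ball_ (fun x : 'rV[R]_n => `|x|) 0 r.
have AE z : A z <-> `|z| <= r by rewrite /A /closed_ball_/= sub0r normrN.
have cA : compact A.
  apply: bounded_closed_compact; last exact: closed_closed_ball_.
  exists r; split; first exact: num_real.
  by move=> x rx z /AE zr; exact: le_trans zr (ltW rx).
pose h z := normsq (f z).
have dfj z j : `|z| <= r -> differentiable (fun y => f y 0 j) z.
  move=> zr; apply: (@differentiable_comp _ _ _ _ f (fun w : 'rV[R]_n => w 0 j)).
    exact: df.
  exact: differentiable_coord.
have hE : h = \sum_(j < n) ((fun y => f y 0 j) ^+ 2).
  apply/funext => z; rewrite fct_sumE; apply: eq_bigr => j _.
  by rewrite exprfctE.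
have dh z : `|z| <= r -> differentiable h z.
  move=> zr; rewrite hE; apply: differentiable_sum => j.
  by apply: differentiableX; exact: dfj.
have [c] : exists2 c, c \in A & forall t, t \in A -> h c <= h t.
  apply: EVT_min_rV => //; first by exists 0; apply/AE; rewrite normr0 ltW.
  apply: continuous_in_subspaceT => z; rewrite inE => /AE zr.
  exact/differentiable_continuous/dh.
rewrite inE => /AE cr hmin.
have {}hmin t : `|t| <= r -> h c <= h t by move=> tr; apply: hmin; rewrite inE; apply/AE.
(* For a minimiser on the sphere, |f c|^2 <= [normsq (f c)] <= [normsq (f 0)] <= n |f 0|^2 <=
   (n+1)^2 |f 0|^2, against the sphere condition. The factor [n.+1] there pays for the change of
   norm. *)
have {}cr : `|c| < r.
  rewrite lt_neqAle cr andbT; apply/eqP => /fr; apply/negP; rewrite -leNgt.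
  rewrite -ler_sqr ?nnegrE// ?mulr_ge0//.
  apply: (le_trans (normsq_ge _)); apply: (le_trans (hmin 0 _)).
    by rewrite normr0 ltW.
  apply: (le_trans (normsq_le _)); rewrite exprMn ler_wpM2r ?sqr_ge0//.
  by rewrite -natrX ler_nat expnS expn1 (leq_trans (leqnSn n))// leq_pmulr.
exists c; split=> //.
(* Along a direction [u] with D_u f(c) = f(c), the function [h] has derivative [2 * normsq (f c)] at
   its interior minimum, so this number is 0. *)
have [u Du] := sf c cr (f c).
pose phi (t : R) := h (t *: u + c).
have [d d0 Hd] : exists2 d, 0 < d & forall t : R, `|t| < d -> `|t *: u + c| < r.
  have u1 : 0 < `|u| + 1 by rewrite ltr_wpDl.
  exists ((r - `|c|) / (`|u| + 1)); first by rewrite divr_gt0 ?subr_gt0.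
  move=> t; rewrite ltr_pdivlMr// mulrDr mulr1 => td.
  by rewrite (le_lt_trans (ler_normD _ _))// normrZ; have := normr_ge0 t; lra.
have dphi (t : R) : `|t| < d -> derivable phi t 1.
  move=> td; apply/derivable1_diffP; apply: differentiable_comp.
    by apply: differentiableD.
  by apply: dh; rewrite ltW// Hd.
have : is_derive (0 : R) 1 phi 0.
  apply: (@derive1_at_min _ phi (- d) d).
  - by rewrite ge0_cp// ltW.
  - by move=> t; rewrite in_itv/= -ltr_norml => td; exact: dphi.
  - by rewrite in_itv/= oppr_lt0 d0.
  - move=> t; rewrite in_itv/= -ltr_norml => /Hd td.
    by rewrite /phi scale0r add0r; apply: hmin; exact: ltW.
case=> _.
have -> : 'D_1 phi 0 = 'D_u h c.
  have A0 : (fun t : R => t *: u + c) 0 = c by rewrite scale0r add0r.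
  rewrite -[in RHS]A0; apply: derive_affine => t.
  by rewrite addr0 scale0r add0r [t%:A]mulr1.
rewrite hE derive_sum; last first.
  by move=> j; apply/diff_derivable/differentiableX/dfj; exact: ltW.
move=> D0; apply: normsq_eq0; move: D0.
have -> : \sum_(i < n) 'D_u ((fun y => f y 0 i) ^+ 2) c = 2 * normsq (f c).
  rewrite mulr_sumr; apply: eq_bigr => j _.
  rewrite deriveX; last by apply/diff_derivable/dfj; exact: ltW.
  have -> : 'D_u (fun y => f y 0 j) c = f c 0 j.
    rewrite -Du -[LHS]/('D_u (row_coord j \o f) c) derive_linear_comp//.
      exact: row_coord_continuous.
    by apply: df; exact: ltW.
  by rewrite [LHS]mulrC /= expr1 expr2; ring.
by move=> /eqP; rewrite mulf_eq0 pnatr_eq0/= => /eqP.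
Qed.

End Zeros.

(** * Bilinear forms and orthogonal projection along a kernel *)

Section BilinearForms.
Context {F : fieldType} {n m : nat}.
Local Notation V := 'rV[F]_n.

Lemma unitmx_inj k (A : 'M[F]_k) :
  (forall u : 'rV_k, u *m A = 0 -> u = 0) -> A \in unitmx.
Proof.
move=> HA; rewrite -row_free_unit -kermx_eq0; apply/eqP/row_matrixP => i.
rewrite row0; apply: HA; rewrite -row_mul mulmx_ker row0 //.
Qed.

Definition bilin (b : V -> V -> F) : Prop :=
  (forall a u v h, b (a *: u + v) h = a * b u h + b v h) /\
  (forall e a u v, b e (a *: u + v) = a * b e u + b e v).

Definition gram (b : V -> V -> F) : 'M[F]_n :=
  \matrix_(i, j) b (delta_mx 0 i) (delta_mx 0 j).

Variable b : V -> V -> F.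
Hypothesis bb : bilin b.

Lemma bilin0l h : b 0 h = 0.
Proof.
have := bb.1 (-1) 0 0 h; rewrite scaler0 addr0 mulN1r addrC subrr; exact.
Qed.

Lemma bilin0r e : b e 0 = 0.
Proof.
have := bb.2 e (-1) 0 0; rewrite scaler0 addr0 mulN1r addrC subrr; exact.
Qed.

Lemma bilinDl u v h : b (u + v) h = b u h + b v h.
Proof. by have := bb.1 1 u v h; rewrite scale1r mul1r. Qed.

Lemma bilinDr e u v : b e (u + v) = b e u + b e v.
Proof. by have := bb.2 e 1 u v; rewrite scale1r mul1r. Qed.

Lemma bilinZl a u h : b (a *: u) h = a * b u h.
Proof. by have := bb.1 a u 0 h; rewrite !addr0 bilin0l addr0. Qed.

Lemma bilinZr e a u : b e (a *: u) = a * b e u.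
Proof. by have := bb.2 e a u 0; rewrite !addr0 bilin0r addr0. Qed.

Lemma bilinBl u v h : b (u - v) h = b u h - b v h.
Proof. by rewrite bilinDl -scaleN1r bilinZl mulN1r. Qed.

Lemma bilinBr e u v : b e (u - v) = b e u - b e v.
Proof. by rewrite bilinDr -scaleN1r bilinZr mulN1r. Qed.

Lemma bilin_suml I (r : seq I) (f : I -> V) h :
  b (\sum_(i <- r) f i) h = \sum_(i <- r) b (f i) h.
Proof.
by elim/big_rec2: _ => [|i x y _ <-]; [exact: bilin0l|rewrite bilinDl].
Qed.

Lemma bilin_sumr I (r : seq I) (f : I -> V) e :
  b e (\sum_(i <- r) f i) = \sum_(i <- r) b e (f i).
Proof.
by elim/big_rec2: _ => [|i x y _ <-]; [exact: bilin0r|rewrite bilinDr].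
Qed.

Lemma bilin_gram e h : b e h = (e *m gram b *m h^T) 0 0.
Proof.
rewrite {1}(row_sum_delta h) bilin_sumr mxE; apply: eq_bigr => j _.
rewrite bilinZr !mxE mulrC; congr (_ * _).
rewrite {1}(row_sum_delta e) bilin_suml; apply: eq_bigr => i _.
by rewrite bilinZl mxE.
Qed.

Lemma gram_unit : (forall e, (forall h, b e h = 0) -> e = 0) ->
  gram b \in unitmx.
Proof.
move=> nd; apply: unitmx_inj => u uG; apply: nd => h.
by rewrite bilin_gram uG mul0mx mxE.
Qed.

Lemma bilin_repr (phi : V -> F) : (forall e, (forall h, b e h = 0) -> e = 0) ->
  (forall a u v, phi (a *: u + v) = a * phi u + phi v) ->
  exists c, forall h, b c h = phi h.
Proof.
move=> nd lphi; pose c := (\row_j phi (delta_mx 0 j)) *m invmx (gram b).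
have phi0 : phi 0 = 0.
  have := lphi (-1) 0 0; rewrite scaler0 addr0 mulN1r addrC subrr; exact.
have phiZ a u : phi (a *: u) = a * phi u.
  by have := lphi a u 0; rewrite !addr0 phi0 addr0.
have phiD u v : phi (u + v) = phi u + phi v.
  by have := lphi 1 u v; rewrite scale1r mul1r.
exists c => h; rewrite bilin_gram /c mulmxKV ?gram_unit//.
rewrite {2}(row_sum_delta h) (big_morph phi phiD phi0) mxE.
by apply: eq_bigr => j _; rewrite phiZ !mxE mulrC.
Qed.

End BilinearForms.

Section HorizontalProjection.
Context {F : fieldType} {n m : nat} (G : 'M[F]_n) (S : 'M[F]_(n, m)).

(* The projection onto the G-orthogonal of the kernel of S, along this kernel. *)
Definition hproj : 'M[F]_n :=
  S *m invmx (S^T *m invmx G *m S) *m S^T *m invmx G.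

Hypothesis uG : G \in unitmx.
Hypothesis surjS : forall c : 'rV_m, exists e, e *m S = c.
Hypothesis ndS : forall w : 'rV_n, w *m S = 0 ->
  (forall w' : 'rV_n, w' *m S = 0 -> (w *m G *m w'^T) 0 0 = 0) -> w = 0.

(** If c annihilates this matrix, w = c S^T G^-1 lies in ker S; and w G w'^T = c (w' S)^T = 0 for w'
    in ker S, so w = 0 by non-degeneracy on ker S. Then c S^T = 0, and surjectivity of S gives c =
    0. *)
Lemma hproj_unit : S^T *m invmx G *m S \in unitmx.
Proof.
apply: unitmx_inj => c cN; pose w := c *m S^T *m invmx G.
have w0 : w = 0.
  apply: ndS; first by rewrite /w -!mulmxA -[RHS]cN !mulmxA.
  move=> w' w'S; rewrite /w mulmxKV// -mulmxA -trmx_mul w'S trmx0 mulmx0 mxE //.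
have cS : c *m S^T = 0 by rewrite -(mulmxKV uG (c *m S^T)) -/w w0 mul0mx.
apply/rowP => j; rewrite mxE.
have [e eS] := surjS (delta_mx 0 j).
have : (c *m (e *m S)^T) 0 0 = 0 by rewrite trmx_mul mulmxA cS mul0mx mxE.
by rewrite eS trmx_delta -colE mxE.
Qed.

Lemma hprojS (e : 'rV_n) : e *m hproj *m S = e *m S.
Proof.
rewrite /hproj; set N := S^T *m _ *m S.
have -> : e *m (S *m invmx N *m S^T *m invmx G) *m S = e *m S *m (invmx N *m N).
  by rewrite {3}/N !mulmxA.
by rewrite mulVmx ?mulmx1// hproj_unit.
Qed.

Lemma hproj_ker (w : 'rV_n) : w *m S = 0 -> w *m hproj = 0.
Proof. by move=> wS; rewrite /hproj !mulmxA wS !mul0mx. Qed.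

Lemma hproj_orth (e w : 'rV_n) : w *m S = 0 -> (e *m hproj *m G *m w^T) 0 0 = 0.
Proof.
move=> wS; rewrite /hproj !mulmxA mulmxKV// -mulmxA -trmx_mul wS.
by rewrite trmx0 mulmx0 mxE.
Qed.

End HorizontalProjection.

Section Hessian.
Context {R : realType} {n : nat}.
Local Notation V := 'rV[R]_n.
Variables (O : set V) (F : V -> R).
Hypotheses (oO : open O) (sF : smooth_on O F).

Lemma smooth_derive_lin v a e h : O v ->
  'D_(a *: e + h) F v = a * 'D_e F v + 'D_h F v.
Proof.
move=> Ov; have dF := smooth_differentiable sF Ov.
by rewrite deriveDr// deriveZr.
Qed.

Lemma fundamental_form_bilin v : O v -> bilin (fundamental_form F v).
Proof.
move=> Ov; rewrite /fundamental_form; split.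
  move=> a u w h; have dF := smooth_differentiable (smooth_derive h sF) Ov.
  rewrite deriveDr// deriveZr// mulrDr; congr (_ + _).
  by rewrite mulrCA.
move=> e a u w.
have -> : 'D_e ('D_(a *: u + w) F) v = 'D_e (a \*: 'D_u F + 'D_w F) v.
  apply: (derive_eq_on oO) => // y Oy /=; rewrite smooth_derive_lin//.
have du : derivable ('D_u F) v e := diff_derivable (smooth_differentiable (smooth_derive u sF) Ov).
have dw : derivable ('D_w F) v e := diff_derivable (smooth_differentiable (smooth_derive w sF) Ov).
rewrite (deriveD (derivableZ (k := a) du) dw) (deriveZ a du) mulrDr; congr (_ + _).
by rewrite mulrCA.
Qed.

Lemma fundamental_form_sym v e h : O v ->
  fundamental_form F v e h = fundamental_form F v h e.
Proof. by move=> Ov; rewrite /fundamental_form (smooth_derive_comm _ _ oO). Qed.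

End Hessian.

Section VerticalProjection.
Context {R : realType} {n m : nat}.
Variables (b : 'rV[R]_n -> 'rV[R]_n -> R) (S : {linear 'rV[R]_n -> 'rV[R]_m}).
Hypotheses (bb : bilin b) (ndT : nondegenerate_on b setT).
Hypothesis ndS : nondegenerate_on b [set w | S w = 0].
Hypothesis surjS : forall c, exists e, S e = c.

Lemma nondegenerateT e : (forall h, b e h = 0) -> e = 0.
Proof. by move=> be; apply: ndT => // h _; exact: be. Qed.

Definition hproj_mx : 'M[R]_n := hproj (gram b) (lin1_mx S).

Let mulS u : u *m lin1_mx S = S u. Proof. exact: mul_rV_lin1. Qed.

Let uG : gram b \in unitmx.
Proof. by apply: gram_unit => //; exact: nondegenerateT. Qed.

Lemma hproj_mxP :
  [/\ forall e, S (e *m hproj_mx) = S e,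
      forall w, S w = 0 -> w *m hproj_mx = 0 &
      forall e w, S w = 0 -> b (e *m hproj_mx) w = 0].
Proof.
have surj (c : 'rV_m) : exists e, e *m lin1_mx S = c.
  by have [e <-] := surjS c; exists e.
split=> [e|w Sw|e w Sw].
- rewrite -!mulS hprojS// => w wS H; apply: ndS => [|h Sh]; first by rewrite /= -mulS.
  by rewrite (bilin_gram bb) H// mulS.
- by apply: hproj_ker; rewrite mulS.
- by rewrite (bilin_gram bb) hproj_orth// mulS.
Qed.

End VerticalProjection.

Section Fibre.
Context {R : realType} {n m : nat}.
Variables (O : set 'rV[R]_n) (F : 'rV[R]_n -> R).
Hypotheses (oO : open O) (sF : smooth_on O F).
Variable S : {linear 'rV[R]_n -> 'rV[R]_m}.
Hypothesis surjS : forall c, exists e, S e = c.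
Hypothesis ndT : forall v, O v -> nondegenerate_on (fundamental_form F v) setT.
Hypothesis ndS : forall v, O v ->
  nondegenerate_on (fundamental_form F v) [set w | S w = 0].

(** When [F] is the metric on one tangent space, Euler's relation 2 g_v(v,w) = D_w L(v) makes these
    the horizontal vectors. This form makes sense for any smooth [F]. *)
Definition critical v := forall w, S w = 0 -> 'D_w F v = 0.

(* With Q the projection along ker S, such that g_v(Q u,w) = 0 for w in ker S,
   k is the zero of k |-> g_v(Q k, .) + dL(te + k + v0)(P .)/2 where P = 1 - Q:
   the two summands live on complementary subspaces, so the first makes k
   vertical and the second makes te + k + v0 critical. *)
Lemma critical_curve v0 e : O v0 -> critical v0 ->
  (forall w, S w = 0 -> fundamental_form F v0 e w = 0) ->
  forall eta, 0 < eta -> \forall t \near 0^'+, exists k,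
  [/\ S k = 0, `|k| <= eta * t, O (t *: e + k + v0) & critical (t *: e + k + v0)].
Proof.
move=> Ov0 cv0 he eta eta0.
have [b bE] : exists b, b = fundamental_form F v0 by exists (fundamental_form F v0).
have bb : bilin b by rewrite bE; exact: (fundamental_form_bilin oO sF Ov0).
have bS u h : b u h = b h u by rewrite bE; exact: (fundamental_form_sym oO sF).
have bnd : nondegenerate_on b setT by rewrite bE; exact: ndT.
have bndS : nondegenerate_on b [set w | S w = 0] by rewrite bE; exact: ndS.
rewrite -bE in he.
have [QS Qker Qorth] := hproj_mxP bb bnd bndS surjS.
set Q := hproj_mx b S in QS Qker Qorth.
pose P := 1%:M - Q.
have PE u : u *m P = u - u *m Q by rewrite mulmxBr mulmx1.
have SP u : S (u *m P) = 0 by rewrite PE linearB/= QS subrr.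
have Pker w : S w = 0 -> w *m P = w by move=> Sw; rewrite PE Qker// subr0.
(* The projection Q is self-adjoint for [b]. Hence the two summands of the map to be solved have
   linear parts adding up to [b] itself, which is non-degenerate. *)
have bQP u h : b (u *m Q) h + b u (h *m P) = b u h.
  have uPQ (z : 'rV_n) : z = z *m P + z *m Q by rewrite PE subrK.
  have E1 : b u (h *m P) = b (u *m P) (h *m P).
    by rewrite {1}(uPQ u) (bilinDl bb) Qorth// addr0.
  have E2 : b (u *m P) h = b (u *m P) (h *m P).
    by rewrite {1}(uPQ h) (bilinDr bb) [b _ (h *m Q)]bS Qorth// addr0.
  by rewrite E1 -E2 addrC -(bilinDl bb) -uPQ.
pose psi w z := 2^-1 * 'D_(w *m P) F z.
have dpsi w z : O z -> differentiable (psi w) z.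
  move=> Oz; apply: (@differentiableZ _ _ _ ('D_(w *m P) F)).
  exact: smooth_differentiable (smooth_derive _ sF) Oz.
have Dpsi w z u : O z -> 'D_u (psi w) z = fundamental_form F z u (w *m P).
  move=> Oz; rewrite /psi deriveMl//; apply: diff_derivable.
  exact: smooth_differentiable (smooth_derive _ sF) Oz.
have psi0 w : psi w v0 = 0 by rewrite /psi cv0// mulr0.
pose C := gram b.
have uC : C \in unitmx by apply: gram_unit => // u Hu; apply: bnd => // h _.
have CE k j : (k *m C) 0 j = b k (row_basis j).
  by rewrite (bilin_gram bb) /row_basis trmx_delta -colE [RHS]mxE.
(* [c] is the inverse of a Lipschitz constant for multiplication by the inverse of the Gram
   matrix. *)
have [c c0 Hc] : exists2 c, 0 < c & forall k : 'rV[R]_n, c * `|k| <= `|k *m C|.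
  pose f : {linear 'rV[R]_n -> 'rV[R]_n} := mulmxr (invmx C).
  have cf : continuous f by exact: row_linear_continuous.
  have [K K0 HK] := linear_lipschitz cf.
  exists K^-1; first by rewrite invr_gt0.
  move=> kk; rewrite ler_pdivrMl//; have := HK (kk *m C).
  by rewrite /= mulmxK.
have e1 : 0 < (n.+2)%:R * `|e| + eta + 1.
  by rewrite -addrA ltr_wpDl ?mulr_ge0// addr_gt0.
(* On the sphere |k| = eta t, the linear part has norm at least c eta t. From this are to be paid
   (n+1) |f 0| <= (n+1) eps t |e| and the nonlinear error eps t (|e| + eta); the summand 1 of the
   denominator leaves eps t for the strict inequality. *)
pose eps := c * eta / ((n.+2)%:R * `|e| + eta + 1).
have eps0 : 0 < eps by rewrite divr_gt0// mulr_gt0.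
have A1 : \forall z \near (0 : 'rV[R]_n), O (z + v0).
  have : \forall z \near v0, O z by exact: open_nbhs_nbhs.
  by rewrite (near_shift 0 v0) subr0; apply: filterS.
have A2 (j : 'I_n) : \forall z \near (0 : 'rV[R]_n),
    `|psi (row_basis j) (z + v0) - b z (row_basis j *m P)| <= eps * `|z|.
  have := differentiable_eps (dpsi (row_basis j) v0 Ov0) eps0.
  apply: filterS => z; rewrite psi0 subr0 (diff_derive z (dpsi (row_basis j) v0 Ov0)).
  by rewrite Dpsi// -bE.
have {}A2 := filter_forall (nbhs_filter _) A2.
have [d d0 Hd] := (nbhs_ballP _ _).1 (filterI A1 A2).
have {}Hd z : `|z| < d -> O (z + v0) /\ forall j : 'I_n,
    `|psi (row_basis j) (z + v0) - b z (row_basis j *m P)| <= eps * `|z|.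
  by move=> zd; apply: Hd; rewrite -ball_normE/= sub0r normrN.
have e2 : 0 < `|e| + eta by rewrite ltr_wpDl.
near=> t; have t0 : 0 < t by [].
have td : t * (`|e| + eta) < d.
  by rewrite -ltr_pdivlMr//; near: t; apply: nbhs_right_lt; exact: divr_gt0.
have small k : `|k| <= eta * t ->
    `|t *: e + k| < d /\ `|t *: e + k| <= t * (`|e| + eta).
  move=> kt; suff H : `|t *: e + k| <= t * (`|e| + eta).
    by split=> //; exact: le_lt_trans H td.
  rewrite (le_trans (ler_normD _ _))// normrZ (gtr0_norm t0) mulrDr lerD2l.
  by rewrite mulrC.
pose f k : 'rV[R]_n :=
    \row_j (b (k *m Q) (row_basis j) + psi (row_basis j) (k + (t *: e + v0))).
have addE k : k + (t *: e + v0) = t *: e + k + v0 by rewrite addrCA addrA.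
have fE k j : f k 0 j = b (k *m Q) (row_basis j) + psi (row_basis j) (t *: e + k + v0).
  by rewrite mxE addE.
have df k : `|k| <= eta * t -> forall j, differentiable (fun y => f y 0 j) k /\
    forall u, 'D_u (fun y => f y 0 j) k =
      b (u *m Q) (row_basis j) + fundamental_form F (t *: e + k + v0) u (row_basis j *m P).
  move=> kt j; have [/Hd[Oz _] _] := small k kt; rewrite -addE in Oz.
  have lq : linear (fun y => b (y *m Q) (row_basis j)).
    by move=> a u v; rewrite mulmxDl -scalemxAl bb.1.
  pose Lq : {linear 'rV[R]_n -> R} :=
    HB.pack (fun y : 'rV[R]_n => b (y *m Q) (row_basis j)) (GRing.isLinear.Build _ _ _ _ _ lq).
  have cq : continuous Lq by exact: row_linear_continuous.
  pose psij y := psi (row_basis j) (y + (t *: e + v0)).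
  have dpsij : differentiable psij k.
    by apply: (@differentiable_comp _ _ _ _ (fun y => y + (t *: e + v0))) => //; exact: dpsi.
  have fE' : (fun y => f y 0 j) = (Lq : 'rV[R]_n -> R) + psij by apply/funext => y; rewrite mxE.
  have dLq : differentiable Lq k by exact: linear_differentiable.
  rewrite fE'; split; first exact: differentiableD.
  move=> u; rewrite deriveD; [|exact: diff_derivable|exact: diff_derivable].
  congr (_ + _); first by rewrite deriveE// diff_lin.
  rewrite -addE -(Dpsi _ _ u Oz).
  by apply: (derive_affine (A := fun y => y + (t *: e + v0))) => s; rewrite -addrA.
have dfv k : `|k| <= eta * t -> differentiable f k.
  move=> kt.
  have -> : f = \sum_(j < n) (fun y => f y 0 j *: (row_basis j : 'rV[R]_n)).
    by apply/funext => y; rewrite fct_sumE {1}(row_sum_delta (f y)).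
  apply: differentiable_sum => j; apply: differentiableZl.
  by have [] := df k kt j.
(* Testing on vertical w decouples the two summands: there b(Qk, w) = 0 and Pw = w, so psi' vanishes
   on ker S, and then b(Qk, .) = 0. This serves both for the injectivity of the differential and for
   reading off the zero. *)
have kerQ (psi' : 'rV[R]_n -> R) k : (forall a u v, psi' (a *: u + v) = a * psi' u + psi' v) ->
    (forall j, b (k *m Q) (row_basis j) + psi' (row_basis j *m P) = 0) ->
    k *m Q = 0 /\ forall w, S w = 0 -> psi' w = 0.
  move=> lpsi H.
  have psi'0 : psi' 0 = 0.
    have := lpsi (-1) 0 0; rewrite scaler0 addr0 mulN1r addrC subrr; exact.
  have psi'D u v : psi' (u + v) = psi' u + psi' v.
    by have := lpsi 1 u v; rewrite scale1r mul1r.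
  have psi'Z a u : psi' (a *: u) = a * psi' u.
    by have := lpsi a u 0; rewrite !addr0 psi'0 addr0.
  have {}H w : b (k *m Q) w + psi' (w *m P) = 0.
    rewrite (row_sum_delta w) (bilin_sumr bb) mulmx_suml (big_morph psi' psi'D psi'0).
    rewrite -big_split/= big1// => j _.
    by rewrite -scalemxAl psi'Z (bilinZr bb) -mulrDr H mulr0.
  have Pw w : S w = 0 -> psi' w = 0.
    by move=> Sw; have := H w; rewrite Qorth// add0r Pker.
  split=> //; apply: bnd => // h _.
  by have := H h; rewrite Pw// addr0.
have [k [kt fk]] : exists k, `|k| < eta * t /\ f k = 0.
  apply: exists_zero; first exact: mulr_gt0.
  - exact: dfv.
  - move=> k /ltW kt w.
    have [/Hd[Oz _] _] := small k kt.
    have Du u j : ('D_u f k) 0 j = b (u *m Q) (row_basis j) +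
        fundamental_form F (t *: e + k + v0) u (row_basis j *m P).
      have [_ <-] := df k kt j.
      rewrite -[RHS]/('D_u (row_coord j \o f) k) derive_linear_comp//.
        exact: row_coord_continuous.
      exact: dfv.
    have dfk := dfv k kt.
    have uD : lin1_mx ('d f k) \in unitmx.
      apply: unitmx_inj => u; rewrite mul_rV_lin1 (diff_derive _ dfk) => D0.
      have bF := fundamental_form_bilin oO sF Oz.
      have Du0 j : b (u *m Q) (row_basis j) +
          fundamental_form F (t *: e + k + v0) u (row_basis j *m P) = 0.
        by rewrite -Du D0 mxE.
      have [uQ uw] := kerQ (fundamental_form F (t *: e + k + v0) u) u
        (bF.2 u) Du0.
      apply: (ndS Oz) => //=; rewrite -QS uQ linear0 //.
    exists (w *m invmx (lin1_mx ('d f k))).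
    by rewrite -(diff_derive _ dfk) -mul_rV_lin1 mulmxKV.
  (* Up to eps |te + k|, the map is its linear part k C: the displacement te contributes nothing to
     the first order, since [e] is orthogonal to every vertical vector P w. *)
  - have key k : `|k| <= eta * t -> `|f k - k *m C| <= eps * `|t *: e + k|.
      move=> kt; have [/Hd[Oz H] _] := small k kt.
      apply: row_norm_le; first by rewrite mulr_ge0// ltW.
      move=> j.
      have -> : (f k - k *m C) 0 j = f k 0 j - (k *m C) 0 j.
        by rewrite mxE [X in _ + X]mxE.
      rewrite fE CE -(bQP k (row_basis j)) opprD addrACA subrr add0r.
      have -> : b k (row_basis j *m P) = b (t *: e + k) (row_basis j *m P).
        by rewrite (bilinDl bb) (bilinZl bb) [b e _]he// mulr0 add0r.
      exact: H.
    move=> k kt.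
    have key1 := key k; rewrite kt in key1; have {}key1 := key1 (lexx _).
    have key0 := key 0; rewrite normr0 mul0mx subr0 addr0 normrZ in key0.
    have {}key0 := key0 (ltW (mulr_gt0 eta0 t0)); rewrite (gtr0_norm t0) in key0.
    have [_ kt'] : `|t *: e + k| < d /\ `|t *: e + k| <= t * (`|e| + eta).
      by apply: small; rewrite kt.
    have H1 : c * (eta * t) <= `|f k| + eps * (t * (`|e| + eta)).
      rewrite -kt; apply: (le_trans (Hc k)).
      have -> : k *m C = f k - (f k - k *m C) by rewrite opprB addrC subrK.
      apply: (le_trans (ler_normB _ _)); rewrite lerD2l.
      by apply: (le_trans key1); rewrite ler_pM2l.
    have H2 : n.+1%:R * `|f 0| <= n.+1%:R * (eps * (t * `|e|)).
      by rewrite ler_wpM2l.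
    apply: (le_lt_trans H2).
    have E : c * eta = eps * (n.+2%:R * `|e| + eta + 1).
      by rewrite /eps divfK// gt_eqF.
    have E' : c * (eta * t) = n.+1%:R * (eps * (t * `|e|)) + eps * t
        + eps * (t * (`|e| + eta)).
      by rewrite mulrA E -[n.+2%:R]natr1; ring.
    rewrite E' lerD2r in H1; apply: lt_le_trans H1.
    by rewrite ltrDl mulr_gt0.
have ktle := ltW kt; exists k.
have [/Hd[Oz _] _] := small k ktle.
set z := t *: e + k + v0 in Oz *.
have lF (a : R) u v : 2^-1 * 'D_(a *: u + v) F z =
    a * (2^-1 * 'D_u F z) + 2^-1 * 'D_v F z.
  by rewrite (smooth_derive_lin sF _ _ _ Oz) mulrDr mulrCA.
have f0 j : b (k *m Q) (row_basis j) + 2^-1 * 'D_(row_basis j *m P) F z = 0.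
  by rewrite -[LHS]fE fk mxE.
have [kQ kw] := kerQ _ k lF f0.
split=> //; first by rewrite -QS kQ linear0.
move=> w /kw /eqP; rewrite mulf_eq0 invr_eq0 pnatr_eq0/= => /eqP.
Unshelve. all: by end_near. Qed.

(** Along critical vectors v0 + te + k with k vertical and |k| <= eta t, phi takes the value of phi'
    at S v0 + t S e. Comparing the two first-order expansions and dividing by t bounds the
    difference of the derivatives by a multiple of eta. *)
Lemma critical_transfer v0 e (phi : 'rV[R]_n -> R) (phi' : 'rV[R]_m -> R) :
  O v0 -> critical v0 ->
  (forall w, S w = 0 -> fundamental_form F v0 e w = 0) ->
  differentiable phi v0 -> differentiable phi' (S v0) ->
  (forall v, O v -> critical v -> phi v = phi' (S v)) ->
  'D_e phi v0 = 'D_(S e) phi' (S v0).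
Proof.
move=> Ov0 cv0 he dphi dphi' phiE.
have cd : continuous ('d phi v0) by exact: diff_continuous.
have [K K0 HK] := linear_lipschitz cd.
(* The three errors, divided by eta t: K for d phi(k), |e| + 1 for the remainder of phi (using eta
   <= 1), and |S e| for the remainder of phi'. *)
pose C := K + `|e| + 1 + `|S e|.
have C0 : 0 < C by rewrite /C -!addrA ltr_wpDr// !addr_ge0.
apply/eqP; rewrite -subr_eq0 -normr_le0; apply/ler_addgt0Pr => eps eps0.
rewrite add0r; pose eta := Num.min 1 (eps / C).
have eta0 : 0 < eta by rewrite lt_min ltr01 divr_gt0.
have eta1 : eta <= 1 by rewrite ge_min lexx.
have etaC : eta * C <= eps by rewrite -ler_pdivlMr// ge_min lexx orbT.
have [d d0 Hd] := (nbhs_ballP _ _).1 (differentiable_eps dphi eta0).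
have [d' d'0 Hd'] := (nbhs_ballP _ _).1 (differentiable_eps dphi' eta0).
have {}Hd z : `|z| < d -> `|phi (z + v0) - phi v0 - 'd phi v0 z| <= eta * `|z|.
  by move=> zd; apply: Hd; rewrite -ball_normE/= sub0r normrN.
have {}Hd' z : `|z| < d' ->
    `|phi' (z + S v0) - phi' (S v0) - 'd phi' (S v0) z| <= eta * `|z|.
  by move=> zd; apply: Hd'; rewrite -ball_normE/= sub0r normrN.
have e2 : 0 < `|e| + eta by rewrite ltr_wpDl.
have e3 : 0 < `|S e| + 1 by rewrite ltr_wpDl.
have [t [/= [[[k [Sk kt Oz cz]] td] td'] t0]] := filter_ex (filterI (filterI (filterI
  (critical_curve Ov0 cv0 he eta0) (nbhs_right_lt (divr_gt0 d0 e2)))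
  (nbhs_right_lt (divr_gt0 d'0 e3))) (nbhs_right_gt 0)).
move: td td'; rewrite /= !ltr_pdivlMr// => td td'.
have kt' : `|t *: e + k| <= t * (`|e| + eta).
  rewrite (le_trans (ler_normD _ _))// normrZ (gtr0_norm t0) mulrDr lerD2l.
  by rewrite mulrC.
have H1 := Hd _ (le_lt_trans kt' td).
have Sz : S (t *: e + k + v0) = t *: S e + S v0 by rewrite !linearD linearZ/= Sk addr0.
have tSe : `|t *: S e| < d'.
  by rewrite normrZ (gtr0_norm t0); apply: le_lt_trans td'; rewrite ler_pM2l// lerDl.
have H2 := Hd' _ tSe; rewrite -Sz -phiE// -phiE// in H2.
have H3 : `|'d phi v0 k| <= K * (eta * t).
  by apply: (le_trans (HK k)); rewrite ler_pM2l.
rewrite !deriveE//; set A := 'd phi v0 e; set B := 'd phi' (S v0) (S e).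
have E1 : 'd phi v0 (t *: e + k) = t * A + 'd phi v0 k by rewrite linearD linearZ.
have E2 : 'd phi' (S v0) (t *: S e) = t * B by rewrite linearZ.
rewrite E1 in H1; rewrite E2 in H2; move: H1 H2 H3.
set X := phi _ - phi _; set y := 'd phi v0 k => H1 H2 H3.
rewrite -(ler_pM2l t0) -{1}(gtr0_norm t0) -normrM.
have -> : t * (A - B) = (X - t * B) - (X - (t * A + y)) - y by ring.
apply: (le_trans (ler_normB _ _)).
apply: (le_trans (lerD (ler_normB _ _) (lexx _))).
apply: (le_trans (lerD (lerD H2 H1) H3)).
rewrite normrZ (gtr0_norm t0).
have H4 : eta * `|t *: e + k| <= eta * (t * (`|e| + 1)).
  rewrite ler_pM2l//; apply: (le_trans kt').
  by rewrite ler_pM2l// lerD2l.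
apply: (le_trans (lerD (lerD (lexx _) H4) (lexx _))).
apply: (@le_trans _ _ (t * (eta * C))); last by rewrite ler_pM2l.
by rewrite le_eqVlt; apply/orP; left; apply/eqP; rewrite /C; ring.
Qed.

Variables (O' : set 'rV[R]_m) (F' : 'rV[R]_m -> R).
Hypotheses (oO' : open O') (sF' : smooth_on O' F').
Hypothesis FF' : forall v, O v -> critical v -> O' (S v) /\ F v = F' (S v).

(** [e] is the sum of its projection, to which the transfer applies, and of a vertical vector, along
    which [F] has zero derivative at a critical point. *)
Lemma derive_critical v e : O v -> critical v -> 'D_e F v = 'D_(S e) F' (S v).
Proof.
move=> Ov cv; have [OSv _] := FF' Ov cv.
have dF := smooth_differentiable sF Ov.
have dF' := smooth_differentiable sF' OSv.
have [QS Qker Qorth] := hproj_mxP (fundamental_form_bilin oO sF Ov)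
  (ndT Ov) (ndS Ov) surjS.
set Q := hproj_mx _ _ in QS Qker Qorth.
have hQ w : S w = 0 -> fundamental_form F v (e *m Q) w = 0 by exact: Qorth.
have FE u : O u -> critical u -> F u = F' (S u) by move=> Ou /(FF' Ou)[].
have T := critical_transfer Ov cv hQ dF dF' FE; rewrite QS in T.
have Sv : S (e - e *m Q) = 0 by rewrite linearB/= QS subrr.
by rewrite -T -[in LHS](subrK (e *m Q) e) (deriveDr _ _ dF) (cv _ Sv) add0r.
Qed.

(** The transfer is applied to D_h F and D_(S h) F': by [derive_critical] they correspond at all
    critical vectors, for any [h], so they can be differentiated along the horizontal [e]. *)
Lemma fundamental_form_critical v e h : O v -> critical v ->
  (forall w, S w = 0 -> fundamental_form F v e w = 0) ->
  fundamental_form F v e h = fundamental_form F' (S v) (S e) (S h).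
Proof.
move=> Ov cv he; have [OSv _] := FF' Ov cv.
have dh := smooth_differentiable (smooth_derive h sF) Ov.
have dh' := smooth_differentiable (smooth_derive (S h) sF') OSv.
have T := critical_transfer Ov cv he dh dh' (fun u Ou cu => derive_critical h Ou cu).
by rewrite /fundamental_form T.
Qed.

End Fibre.

(** * Local surjectivity of submersions *)

Section OpenMapping.
Context {R : realType} {n m : nat}.
Variables (U : set 'rV[R]_n) (s : 'rV[R]_n -> 'rV[R]_m).
Hypotheses (oU : open U) (ss : smooth_on U s).

(** Restricted to the affine slice x0 + zT, where T is a right inverse of the differential, the map
    has the identity as differential at z = 0, and [exists_zero] solves g z = y for y close to s
    x0. *)
Lemma smooth_surjective_near x0 (U' : set 'rV[R]_n) : U x0 -> nbhs x0 U' ->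
  (forall c, exists e, 'D_e s x0 = c) ->
  \forall y \near s x0, exists x, U' x /\ s x = y.
Proof.
move=> Ux0 U'x0 surj.
have [e eE] := choice (fun j : 'I_m => surj (row_basis j)).
pose T : 'M[R]_(m, n) := \matrix_(j < m) e j.
pose J x : 'M[R]_(n, m) := \matrix_(i < n) 'D_(row_basis i) s x.
have JE x u : U x -> 'D_u s x = u *m J x.
  move=> Ux; have ds := smooth_differentiable ss Ux.
  rewrite (derive_coordinates _ (coordinates_row n) ds) mulmx_sum_row.
  by apply: eq_bigr => i _; rewrite rowK.
have TJ : T *m J x0 = 1%:M.
  by apply/row_matrixP => j; rewrite row_mul rowK -JE// eE row1.
have sN : smooth_mx U (fun x => T *m J x).
  apply: smooth_mx_mul => // i j; first exact: smooth_cst.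
  apply: (smooth_eq oU) ((smooth_rowP oU _).1 (smooth_derive (row_basis i) ss) j).
  by move=> x _; rewrite !mxE.
have dN := smooth_differentiable (smooth_mx_det oU sN) Ux0.
have A1 : \forall x \near x0, U x by exact: open_nbhs_nbhs.
have N0 : \det (T *m J x0) != 0 by rewrite TJ det1 oner_neq0.
have A2 : \forall x \near x0, \det (T *m J x) != 0.
  exact: (cvgr_neq0 _ (differentiable_continuous dN) N0).
have near0 := filterI A1 (filterI U'x0 A2).
have [L [LD dL L0]] : exists L : 'rV[R]_m -> 'rV[R]_n,
    [/\ forall z u (t : R), L (t *: u + z) = t *: (u *m T) + L z,
        forall z, differentiable L z & L 0 = x0].
  exists (fun z => z *m T + x0); split.
  - by move=> z u t; rewrite mulmxDl scalemxAl addrA.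
  - move=> z; apply: differentiableD => //.
    apply: (@linear_differentiable _ _ _ (mulmxr T)).
    exact: row_linear_continuous.
  - by rewrite mul0mx add0r.
pose g z := s (L z).
have dg z : U (L z) -> differentiable g z.
  by move=> Uz; apply: differentiable_comp => //; exact: smooth_differentiable ss Uz.
have Dg z u : U (L z) -> 'D_u g z = u *m (T *m J (L z)).
  move=> Uz; have E := JE (L z) (u *m T) Uz; rewrite -mulmxA in E; rewrite -E.
  exact: (derive_affine s (LD z u)).
have nearL : \forall x \near L 0, U x /\ U' x /\ \det (T *m J x) != 0.
  by rewrite L0; exact: near0.
have near1 : nbhs (0 : 'rV[R]_m) [set z | U (L z) /\ U' (L z) /\ \det (T *m J (L z)) != 0].
  have H := differentiable_continuous (dL 0) nearL.
  by rewrite -[nbhs _ _]/(\forall y \near (L @ (0 : 'rV[R]_m)),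
    U y /\ U' y /\ \det (T *m J y) != 0) near_map in H.
have UL0 : U (L 0) by rewrite L0.
have h2 : (0 : R) < 2^-1 by rewrite invr_gt0.
have near2 := differentiable_eps (dg 0 UL0) h2.
have [d d0 Hd] := (nbhs_ballP _ _).1 (filterI near1 near2).
have {}Hd z : `|z| < d -> [/\ U (L z), U' (L z) & \det (T *m J (L z)) != 0] /\
    `|g z - s x0 - z| <= 2^-1 * `|z|.
  move=> zd; have [|[? [? ?]]] := Hd z; first by rewrite -ball_normE/= sub0r normrN.
  rewrite /= addr0 (diff_derive _ (dg 0 UL0)) Dg// L0 TJ mulmx1 /g L0.
  by split.
pose r := d / 2.
have r0 : 0 < r by rewrite divr_gt0.
have rd : r < d by rewrite /r ltr_pdivrMr// ltr_pMr// ltr1n.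
(* On the sphere |z| = r, |g z - y| >= r/2 - |s x0 - y|, since g is within |z|/2 of a translation.
   If (m+2) |s x0 - y| < r/2, this exceeds (m+1) |s x0 - y|, as [exists_zero] requires. *)
pose del := r / (2 * m.+2%:R).
have del0 : 0 < del by rewrite divr_gt0// mulr_gt0.
have : \forall y \near s x0, `|s x0 - y| < del.
  by apply/nbhs_ballP; exists del => // y; rewrite -ball_normE.
apply: filterS => y yd.
have [z [zr gz]] : exists z, `|z| < r /\ g z - y = 0.
  apply: (@exists_zero _ _ (fun z => g z - y)) => //.
  - move=> z zr; have [[Uz _ _] _] := Hd z (le_lt_trans zr rd).
    by apply: differentiableB => //; exact: dg.
  - move=> z zr w; have [[Uz _ dz] _] := Hd z (lt_trans zr rd).
    have uN : T *m J (L z) \in unitmx by rewrite unitmxE unitfE.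
    exists (w *m invmx (T *m J (L z))).
    have dgz : derivable g z (w *m invmx (T *m J (L z))) := diff_derivable (dg z Uz).
    rewrite (deriveB dgz (derivable_cst _ _ _)) derive_cst subr0 Dg//.
    by rewrite mulmxKV.
  - move=> z zr; have [_ Hz] : [/\ U (L z), U' (L z) & \det (T *m J (L z)) != 0] /\
        `|g z - s x0 - z| <= 2^-1 * `|z| by apply: Hd; rewrite zr.
    have -> : g 0 - y = s x0 - y by rewrite /g L0.
    have H : r <= `|g z - y| + 2^-1 * r + `|s x0 - y|.
      rewrite -{1}zr.
      have Ez : `|z| = `|(g z - y) - (g z - s x0 - z) - (s x0 - y)|.
        by congr (`|_|); apply/rowP => i; rewrite !mxE; ring.
      rewrite {1}Ez.
      apply: (le_trans (ler_normB _ _)); rewrite lerD2r.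
      apply: (le_trans (ler_normB _ _)); rewrite lerD2l.
      by rewrite -zr.
    have H2 : m.+2%:R * `|s x0 - y| < r / 2.
      rewrite mulrC -ltr_pdivlMr//; apply: lt_le_trans yd _.
      by rewrite /del invfM mulrA.
    move: H2; rewrite -[m.+2%:R]natr1 mulrDl mul1r => H2.
    have := ltr_leD H2 H; lra.
exists (L z); have [[_ U'z _] _] := Hd z (lt_trans zr rd).
by split=> //; apply/eqP; rewrite -subr_eq0; apply/eqP.
Qed.
End OpenMapping.

(** * Manifolds and anisotropic connections in charts *)

Section Charts.
Context {R : realType} {n : nat} {M : manifold R n}.
Local Notation V := 'rV[R]_n.
Implicit Types (p q a b c : M) (U : set M).

Definition chart_image p U : set V := coord p @` (dom p `&` U).

Lemma coord_dom p q : dom p q -> (coord p @` dom p) (coord p q).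
Proof. by exists q. Qed.

Lemma coordVK p x : (coord p @` dom p) x ->
  dom p (coordV p x) /\ coord p (coordV p x) = x.
Proof. by move=> [q pq <-]; rewrite coordK. Qed.

Lemma chart_imageP p U x :
  chart_image p U x <-> (coord p @` dom p) x /\ U (coordV p x).
Proof.
split=> [[q [pq Uq] <-]|[px Ux]].
  by rewrite coordK//; split=> //; exists q.
by have [dx <-] := coordVK px; exists (coordV p x).
Qed.

Lemma chart_image_coord p U q : dom p q -> U q -> chart_image p U (coord p q).
Proof. by move=> pq Uq; exists q. Qed.

Lemma coordV_cont p x : (coord p @` dom p) x -> {for x, continuous (@coordV R n M p)}.
Proof.
move=> px; have := @coordV_continuous R n M p.
by rewrite continuous_open_subspace; [move/(_ x); rewrite inE; exact|exact: coord_open].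
Qed.

Lemma coord_cont p q : dom p q -> {for q, continuous (coord p)}.
Proof.
move=> pq; have := @coord_continuous R n M p.
by rewrite continuous_open_subspace; [move/(_ q); rewrite inE; exact|exact: dom_open].
Qed.

Lemma open_chart_image p U : open U -> open (chart_image p U).
Proof.
move=> oU; rewrite openE => x /chart_imageP[px Ux].
have H1 : \forall y \near x, (coord p @` dom p) y.
  by apply: open_nbhs_nbhs; split=> //; exact: coord_open.
have H2 : \forall q \near coordV p x, U q by exact: open_nbhs_nbhs.
have H3 : nbhs x (coordV p @^-1` U) by exact: (coordV_cont px).
apply: filterS (filterI H1 H3) => y [py Uy].
by apply/chart_imageP.
Qed.

Lemma chart_image_subset p U U' : U `<=` U' -> chart_image p U `<=` chart_image p U'.
Proof. by move=> UU' x /chart_imageP[px /UU' U'x]; apply/chart_imageP. Qed.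

Lemma nbhs_coord p q (P : set V) : dom p q -> nbhs (coord p q) P ->
  nbhs q (fun r => P (coord p r)).
Proof. by move=> pq H; exact: (coord_cont pq). Qed.

Lemma nbhs_coordV p q (P : set M) : dom p q -> nbhs q P ->
  nbhs (coord p q) (fun x => P (coordV p x)).
Proof.
move=> pq H; apply: (coordV_cont (coord_dom pq)).
by rewrite coordK.
Qed.

Lemma change_smooth a b :
  smooth_on (chart_image a (dom b)) (coord b \o @coordV R n M a).
Proof. exact: coord_change_smooth. Qed.

Lemma change_differentiable a b q : dom a q -> dom b q ->
  differentiable (coord b \o @coordV R n M a) (coord a q).
Proof.
move=> aq bq.
exact: (smooth_differentiable (@change_smooth a b) (chart_image_coord aq bq)).
Qed.

Lemma comp_changeE a b q v : dom a q -> dom b q ->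
  comp_change a b q v = 'D_v (coord b \o @coordV R n M a) (coord a q).
Proof. by move=> aq bq; rewrite /comp_change diff_derive//; exact: change_differentiable. Qed.

Lemma comp_change_linear a b q : linear (comp_change a b q).
Proof. by move=> k u v; rewrite /comp_change linearP. Qed.

HB.instance Definition _ a b q :=
  GRing.isLinear.Build R V V _ (comp_change a b q) (comp_change_linear a b q).

Lemma near_dom p q : dom p q -> \forall r \near q, dom p r.
Proof. by move=> pq; apply: open_nbhs_nbhs; split=> //; exact: dom_open. Qed.

Lemma comp_change_trans a b c q v : dom a q -> dom b q -> dom c q ->
  comp_change b c q (comp_change a b q v) = comp_change a c q v.
Proof.
move=> aq bq cq; rewrite !comp_changeE//.
have Eb : (coord b \o @coordV R n M a) (coord a q) = coord b q by rewrite /= coordK.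
rewrite -[in LHS]Eb -derive_comp; last 2 first.
- exact: change_differentiable.
- by rewrite Eb; exact: change_differentiable.
apply: near_eq_derive.
have := nbhs_coordV aq (near_dom bq).
by apply: filterS => x bx /=; rewrite coordK.
Qed.

Lemma comp_change_refl a q v : dom a q -> comp_change a a q v = v.
Proof.
move=> aq; rewrite comp_changeE// -[RHS](derive_id (coord a q) v).
apply: near_eq_derive.
have H : \forall x \near coord a q, (coord a @` dom a) x.
  by apply: open_nbhs_nbhs; split; [exact: coord_open|exact: coord_dom].
by apply: filterS H => x ax /=; have [_ ->] := coordVK ax.
Qed.

Lemma comp_changeK a b q v : dom a q -> dom b q ->
  comp_change b a q (comp_change a b q v) = v.
Proof. by move=> aq bq; rewrite comp_change_trans// comp_change_refl. Qed.

Lemma const_ext_linear p q : linear (fun e => const_ext p e q).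
Proof. by move=> k u v; rewrite /const_ext linearP. Qed.

Lemma const_ext_center p e : const_ext p e p = e.
Proof. by rewrite /const_ext comp_change_refl//; exact: dom_center. Qed.

Lemma vf_in_chart_const p e x : (coord p @` dom p) x ->
  vf_in_chart p (const_ext p e) x = e.
Proof.
move=> px; have [dx _] := coordVK px.
by rewrite /vf_in_chart /const_ext comp_changeK//; exact: dom_center.
Qed.

Lemma vf_in_chart_center p (X : M -> V) : vf_in_chart p X (coord p p) = X p.
Proof. by rewrite /vf_in_chart coordK ?comp_change_refl//; exact: dom_center. Qed.

Lemma const_ext_vf p (X : M -> V) q : dom p q ->
  const_ext p (vf_in_chart p X (coord p q)) q = X q.
Proof.
move=> pq; rewrite /vf_in_chart /const_ext coordK// comp_changeK//.
exact: dom_center.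
Qed.

(** Components in another chart are the given ones, composed with the change of coordinates and
    multiplied by its Jacobian; both factors are smooth, so one chart is enough. *)
Lemma smooth_vf_chart p U (X : M -> V) : open U -> U `<=` dom p ->
  smooth_on (chart_image p U) (vf_in_chart p X) -> smooth_vf U X.
Proof.
move=> oU Up sX a.
pose W := chart_image a U.
have oW : open W by exact: open_chart_image.
have sth : smooth_on W (coord p \o @coordV R n M a).
  by apply: smooth_subset (@change_smooth a p); exact: chart_image_subset.
have thW x : W x -> chart_image p U (coord p (coordV a x)).
  by move=> /chart_imageP[ax Ux]; apply: chart_image_coord => //; exact: Up.
have spa i j : smooth_on W (fun x =>
   'D_(row_basis i) (coord a \o @coordV R n M p) (coord p (coordV a x)) 0 j).
  apply: (@smooth_comp _ _ _ oW _ _ _ _ (chart_image p (U `&` dom a))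
    (fun y => 'D_(row_basis i) (coord a \o @coordV R n M p) y 0 j) _ (coordinates_row n)) => //.
    move=> x Wx; have /chart_imageP[ax Ux] := Wx.
    have [dx _] := coordVK ax.
    by apply: chart_image_coord => //; exact: Up.
  apply: (smooth_rowP _ _).1.
    by apply: open_chart_image; apply: openI => //; exact: dom_open.
  apply: smooth_derive; apply: smooth_subset (@change_smooth p a).
  by apply: chart_image_subset => x [].
have sXi i : smooth_on W (fun x => vf_in_chart p X (coord p (coordV a x)) 0 i).
  apply: (@smooth_comp _ _ _ oW _ _ _ _ (chart_image p U)
    (fun y => vf_in_chart p X y 0 i) _ (coordinates_row n)) => //.
  by apply: (smooth_rowP _ _).1 => //; exact: open_chart_image.
apply/(smooth_rowP oW) => j.
apply: (smooth_eq oW) (smooth_sum oW (index_enum 'I_n)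
  (fun i => smooth_mul oW (sXi i) (spa i j))).
move=> x Wx; have /chart_imageP[ax Ux] := Wx; have [dx Ex] := coordVK ax.
have px := Up _ Ux.
rewrite /vf_in_chart coordK// -/(vf_in_chart p X _).
have -> : comp_change (coordV a x) a (coordV a x) (X (coordV a x)) =
   comp_change p a (coordV a x) (comp_change (coordV a x) p (coordV a x) (X (coordV a x))).
  by rewrite comp_change_trans//; exact: dom_center.
rewrite [RHS](congr1 (fun w : V => w 0 j) (comp_changeE _ px dx)).
rewrite (derive_coordinates _ (coordinates_row n) (change_differentiable px dx)).
by rewrite summxE; apply: eq_bigr => i _; rewrite mxE.
Qed.

Lemma smooth_fun_chart p U (f : M -> R) : open U -> U `<=` dom p ->
  smooth_on (chart_image p U) (f \o @coordV R n M p) -> smooth_fun U f.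
Proof.
move=> oU Up sf a; pose W := chart_image a U.
have oW : open W by exact: open_chart_image.
have sth : smooth_on W (coord p \o @coordV R n M a).
  by apply: smooth_subset (@change_smooth a p); exact: chart_image_subset.
have thW x : W x -> chart_image p U (coord p (coordV a x)).
  by move=> /chart_imageP[ax Ux]; apply: chart_image_coord => //; exact: Up.
apply: (smooth_eq oW) (smooth_comp oW (coordinates_row n) thW sth sf) => x.
by move=> /chart_imageP[ax Ux] /=; rewrite coordK//; exact: Up.
Qed.

Lemma const_ext_smooth p e : smooth_vf (dom p) (const_ext p e).
Proof.
apply: (@smooth_vf_chart p) => //; first exact: dom_open.
apply: (smooth_eq _ _ (smooth_cst _ e)); try exact/open_chart_image/dom_open.
by move=> x /chart_imageP[px _]; rewrite vf_in_chart_const.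
Qed.

Lemma smooth_vf_subset U U' (X : M -> V) : U' `<=` U -> smooth_vf U X -> smooth_vf U' X.
Proof.
move=> UU' sX p; apply: smooth_subset (sX p); exact: chart_image_subset.
Qed.

End Charts.

Arguments const_ext_smooth {R n M} p e.
Arguments change_smooth {R n M} a b.

Section SmoothFields.
Context {R : realType} {n : nat} {M : manifold R n}.
Local Notation V := 'rV[R]_n.
Implicit Types (p : M) (U : set M).

Lemma smooth_vf_eq U (X Y : M -> V) : open U -> (forall q, U q -> X q = Y q) ->
  smooth_vf U X -> smooth_vf U Y.
Proof.
move=> oU XY sX p; apply: (smooth_eq (open_chart_image oU)) (sX p) => x.
by move=> /chart_imageP[px Ux]; rewrite /vf_in_chart XY.
Qed.

Lemma smooth_vf_add U (X Y : M -> V) : open U -> smooth_vf U X -> smooth_vf U Y ->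
  smooth_vf U (fun q => X q + Y q).
Proof.
move=> oU sX sY p; have oW := open_chart_image (p := p) oU.
apply: (smooth_eq oW) (smooth_add oW (sX p) (sY p)) => x _.
by rewrite /vf_in_chart linearD.
Qed.

Lemma smooth_vf_scale U (f : M -> R) (X : M -> V) : open U -> smooth_fun U f ->
  smooth_vf U X -> smooth_vf U (fun q => f q *: X q).
Proof.
move=> oU sf sX p; have oW := open_chart_image (p := p) oU.
apply/(smooth_rowP oW) => j.
apply: (smooth_eq oW) (smooth_mul oW (sf p) ((smooth_rowP oW _).1 (sX p) j)).
by move=> x _; rewrite /vf_in_chart linearZ mxE.
Qed.

Lemma smooth_vf0 U : open U -> smooth_vf U (fun=> 0 : V).
Proof.
move=> oU p; have oW := open_chart_image (p := p) oU.
by apply: (smooth_eq oW) (smooth_cst oW 0) => x _; rewrite /vf_in_chart linear0.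
Qed.

Lemma smooth_vf_sum U (I : Type) (r : seq I) (X : I -> M -> V) : open U ->
  (forall i, smooth_vf U (X i)) -> smooth_vf U (fun q => \sum_(i <- r) X i q).
Proof.
move=> oU sX; elim: r => [|i r IH].
  by apply: (smooth_vf_eq oU) (smooth_vf0 oU) => q _; rewrite big_nil.
by apply: (smooth_vf_eq oU) (smooth_vf_add oU (sX i) IH) => q _; rewrite big_cons.
Qed.

(** A cut-off for fields on [U]: as only values on [U] matter for smoothness there, a bump function
    can be replaced by this possibly discontinuous function. *)
Definition indic U q : R := if asbool (U q) then 1 else 0.

Lemma indic1 U q : U q -> indic U q = 1.
Proof. by move=> Uq; rewrite /indic asboolT. Qed.

Lemma smooth_indic U : open U -> smooth_fun U (indic U).
Proof.
move=> oU p; have oW := open_chart_image (p := p) oU.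
apply: (smooth_eq oW) (smooth_cst oW (1 : R)) => x /chart_imageP[_ Ux].
by rewrite /= indic1.
Qed.

Lemma dfun_eq (f g : M -> R) p e : (\forall q \near p, f q = g q) ->
  dfun f p e = dfun g p e.
Proof.
move=> fg; apply: near_eq_derive.
by have := nbhs_coordV (dom_center p) fg; apply: filterS.
Qed.

Lemma dfun_indic U p e : open U -> U p -> dfun (indic U) p e = 0.
Proof.
move=> oU Up; rewrite (@dfun_eq _ (cst 1)).
  exact: (derive_cst (1 : R) (coord p p) e).
have : \forall q \near p, U q by exact: open_nbhs_nbhs.
by apply: filterS => q Uq; rewrite indic1.
Qed.

End SmoothFields.

Section ConnectionInChart.
Context {R : realType} {n : nat} {M : manifold R n} {L : pseudo_finsler M}.
Local Notation V := 'rV[R]_n.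
Variable nabla : (M -> V) -> (M -> V) -> (M -> V -> V).
Hypothesis cn : anisotropic_connection L nabla.
Variables (p : M) (v : V).
Hypothesis av : adm L p v.

Lemma conn0 U (E : M -> V) : open U -> U p -> smooth_vf U E ->
  nabla E (fun=> 0) p v = 0.
Proof.
move=> oU Up sE; have s0 : smooth_vf U (fun=> 0 : V) by exact: smooth_vf0.
have := conn_additive cn oU sE s0 s0 Up av.
have -> : (fun q : M => 0 + 0) = (fun=> 0) :> (M -> V).
  by apply/funext => q; rewrite addr0.
by move=> /eqP; rewrite addrC -subr_eq subrr eq_sym => /eqP.
Qed.

Lemma conn_sum U (I : Type) (r : seq I) (E : M -> V) (f : I -> M -> R)
    (H : I -> M -> V) : open U -> U p -> smooth_vf U E ->
  (forall i, smooth_fun U (f i)) -> (forall i, smooth_vf U (H i)) ->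
  nabla E (fun q => \sum_(i <- r) f i q *: H i q) p v =
  \sum_(i <- r) (dfun (f i) p (E p) *: H i p + f i p *: nabla E (H i) p v).
Proof.
move=> oU Up sE sf sH; elim: r => [|i r IH].
  rewrite big_nil -[RHS](conn0 oU Up sE); congr (nabla E _ p v).
  by apply/funext => q; rewrite big_nil.
have sfH j : smooth_vf U (fun q => f j q *: H j q) by exact: smooth_vf_scale.
have -> : (fun q => \sum_(j <- i :: r) f j q *: H j q) =
    (fun q => f i q *: H i q + \sum_(j <- r) f j q *: H j q).
  by apply/funext => q; rewrite big_cons.
rewrite (conn_additive cn oU sE (sfH i) _ Up av); last exact: smooth_vf_sum.
by rewrite IH big_cons (conn_leibniz cn oU (sf i) sE (sH i) Up av).
Qed.

(** Multiplied by [indic U], the two fields agree everywhere. By the Leibniz rule the multiplication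
    does not affect the derivative at [p], where the cut-off has value 1 and derivative 0. *)
Lemma conn_local U (E H H' : M -> V) : open U -> U p -> smooth_vf U E ->
  smooth_vf U H -> smooth_vf U H' -> (forall q, U q -> H q = H' q) ->
  nabla E H p v = nabla E H' p v.
Proof.
move=> oU Up sE sH sH' HH'.
have ind K : smooth_vf U K -> nabla E (fun q => indic U q *: K q) p v = nabla E K p v.
  move=> sK; rewrite (conn_leibniz cn oU (smooth_indic oU) sE sK Up av).
  by rewrite dfun_indic// scale0r add0r indic1// scale1r.
rewrite -ind// -(ind H')//; congr (nabla E _ p v).
apply/funext => q; rewrite /indic; case: asboolP => [Uq|_].
  by rewrite HH'.
by rewrite !scale0r.
Qed.

Definition christoffel (e h : V) : V := nabla_at nabla p v e (const_ext p h).

(** Near [p] the field is the combination of the constant fields of the chart with its components as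
    coefficients; locality and the Leibniz rule then give the coordinate expression. *)
Lemma nabla_at_sum U (H : M -> V) e : open U -> U p -> smooth_vf U H ->
  nabla_at nabla p v e H = 'D_e (vf_in_chart p H) (coord p p) +
    \sum_i H p 0 i *: christoffel e (row_basis i).
Proof.
move=> oU Up sH; pose U1 := U `&` dom p.
have oU1 : open U1 by apply: openI => //; exact: dom_open.
have U1p : U1 p by split=> //; exact: dom_center.
have sE h : smooth_vf U1 (const_ext p h).
  by apply: smooth_vf_subset (const_ext_smooth p h) => q [].
have sH1 : smooth_vf U1 H by apply: smooth_vf_subset sH => q [].
pose f i q := vf_in_chart p H (coord p q) 0 i.
have oW := open_chart_image (p := p) oU1.
have sfc i : smooth_on (chart_image p U1) (fun x => vf_in_chart p H x 0 i).
  exact: (smooth_rowP oW _).1 (sH1 p) i.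
have sf i : smooth_fun U1 (f i).
  apply: (@smooth_fun_chart _ _ _ p) => //; first by move=> q [].
  apply: (smooth_eq oW) (sfc i) => x /chart_imageP[px _] /=.
  by rewrite /f; have [_ ->] := coordVK px.
have Wp : chart_image p U1 (coord p p).
  by apply: chart_image_coord => //; exact: dom_center.
have dH : differentiable (vf_in_chart p H) (coord p p).
  exact: smooth_differentiable (sH1 p) Wp.
pose K q := \sum_i f i q *: const_ext p (row_basis i) q.
have HK q : U1 q -> H q = K q.
  move=> [_ pq]; rewrite -[LHS](const_ext_vf H pq).
  rewrite {1}(proj2 (coordinates_row n) (vf_in_chart p H (coord p q))).
  rewrite /K /const_ext linear_sum.
  by apply: eq_bigr => i _; rewrite linearZ.
have sK : smooth_vf U1 K.
  by apply: smooth_vf_sum => // i; exact: smooth_vf_scale.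
rewrite /nabla_at (conn_local oU1 U1p (sE e) sH1 sK HK).
rewrite (conn_sum _ oU1 U1p (sE e) sf (fun i => sE (row_basis i))) big_split/=.
congr (_ + _).
  rewrite {1}(proj2 (coordinates_row n) ('D_e (vf_in_chart p H) (coord p p))).
  apply: eq_bigr => i _; rewrite !const_ext_center; congr (_ *: _).
  rewrite -derive_linear_comp//; last exact: row_coord_continuous.
  apply: (derive_eq_on oW) => // x /chart_imageP[px _] /=.
  by rewrite /f; have [_ ->] := coordVK px.
by apply: eq_bigr => i _; rewrite /f vf_in_chart_center.
Qed.

Lemma derive_vf_const e h : 'D_e (vf_in_chart p (const_ext p h)) (coord p p) = 0.
Proof.
rewrite (@derive_eq_on _ _ _ (@coord_open R n M p) _ _ (cst h)).
- by rewrite derive_cst.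
- by move=> x px; rewrite vf_in_chart_const.
- exact/coord_dom/dom_center.
Qed.

Lemma christoffel_sum e h : christoffel e h = \sum_i h 0 i *: christoffel e (row_basis i).
Proof.
rewrite {1}/christoffel (nabla_at_sum _ (@dom_open R n M p) (dom_center p)).
  by rewrite derive_vf_const add0r const_ext_center.
exact: const_ext_smooth.
Qed.

Lemma nabla_atE U (H : M -> V) e : open U -> U p -> smooth_vf U H ->
  nabla_at nabla p v e H =
  'D_e (vf_in_chart p H) (coord p p) + christoffel e (H p).
Proof. by move=> oU Up sH; rewrite (nabla_at_sum _ oU Up sH) -christoffel_sum. Qed.

Lemma christoffel_linear e : linear (christoffel e).
Proof.
move=> a h k; rewrite (christoffel_sum _ (_ + _)) (christoffel_sum _ h).
rewrite (christoffel_sum _ k) scaler_sumr -big_split/=; apply: eq_bigr => i _.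
by rewrite !mxE scalerDl scalerA.
Qed.

End ConnectionInChart.

Section TorsionFree.
Context {R : realType} {n : nat} {M : manifold R n} {L : pseudo_finsler M}.
Local Notation V := 'rV[R]_n.
Variable nabla : (M -> V) -> (M -> V) -> (M -> V -> V).
Hypothesis lc : levi_civita_chern L nabla.
Variables (p : M) (v : V).
Hypothesis av : adm L p v.
Local Notation Gam := (christoffel nabla p v).

(** Fields that are constant in the same chart commute. *)
Lemma christoffel_sym e h : Gam e h = Gam h e.
Proof.
apply/eqP; rewrite -subr_eq0; apply/eqP.
rewrite (chern_torsion_free lc (@dom_open R n M p) (const_ext_smooth p e)
  (const_ext_smooth p h) (dom_center p) av).
by rewrite /bracket !derive_vf_const subrr.
Qed.

Lemma christoffelDr e h k : Gam e (h + k) = Gam e h + Gam e k.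
Proof.
have := christoffel_linear (chern_connection lc) av e 1 h k.
by rewrite !scale1r.
Qed.

Lemma christoffelDl e h k : Gam (h + k) e = Gam h e + Gam k e.
Proof. by rewrite christoffel_sym christoffelDr !(christoffel_sym e). Qed.

End TorsionFree.

(** * Euler's relation for homogeneous functions *)

Section Homogeneity.
Context {R : realType} {n : nat}.
Local Notation V := 'rV[R]_n.
Variables (O : set V) (g : V -> R).
Hypothesis oO : open O.

(** Differentiate g(l u) = c g(u) in u, with [l] fixed. The case c = l^2 concerns the metric and c =
    l its first derivatives, so that the fundamental tensor has degree 0. *)
Lemma derive_homogeneous (c l : R) w h : 0 < l -> O w -> O (l *: w) ->
  differentiable g w -> differentiable g (l *: w) ->
  (forall u, O u -> g (l *: u) = c * g u) ->
  'D_h g (l *: w) = c / l * 'D_h g w.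
Proof.
move=> l0 Ow Olw dg dgl hg; have ln0 : l != 0 by rewrite gt_eqF.
have E : 'D_h (fun u => g (l *: u)) w = 'D_(l *: h) g (l *: w).
  apply: (@derive_affine _ _ _ _ (fun u => l *: u)) => t.
  by rewrite scalerDr !scalerA mulrC.
have E2 : 'D_h (fun u => g (l *: u)) w = c * 'D_h g w.
  rewrite (derive_eq_on oO h hg Ow).
  by rewrite -[RHS](deriveMl c (diff_derivable dg)).
have {}E : c * 'D_h g w = l * 'D_h g (l *: w) by rewrite -E2 E deriveZr.
by rewrite mulrAC E mulrAC mulfV// mul1r.
Qed.

(** On the ray, g(tv + v) = (t+1)^k g(v) as long as t > -1, which holds near t = 0. *)
Lemma derive_radial k v : (forall l : R, 0 < l -> g (l *: v) = l ^+ k * g v) ->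
  'D_v g v = k%:R * g v.
Proof.
move=> hg.
have E : 'D_1 (fun t : R => g (t *: v + v)) 0 = 'D_v g v.
  rewrite -[in RHS](add0r v) -[in RHS](scale0r v).
  apply: (@derive_affine _ _ _ _ (fun t : R => t *: v + v)) => t.
  by rewrite addr0 scale0r add0r [t%:A]mulr1.
rewrite -E (@near_eq_derive _ _ _ _ (g v \*o (fun t : R => (t + 1) ^+ k))); last first.
  have : \forall t \near (0 : R), - 1 < t by apply: lt_nbhsr; rewrite ltrN10.
  apply: filterS => t t1; have t10 : 0 < t + 1 by rewrite -ltrBlDr sub0r.
  have -> : t *: v + v = (t + 1) *: v by rewrite scalerDl scale1r.
  by rewrite hg//; exact: mulrC.
have dt : derivable (fun t : R => t + 1) 0 1 by exact: derivableD.
have Dt : 'D_1 (fun t : R => t + 1) 0 = 1.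
  have d1 : derivable (id : R -> R) 0 1 by exact: derivable_id.
  have d2 : derivable (cst 1 : R -> R) 0 1 by exact: derivable_cst.
  have := deriveD d1 d2.
  by rewrite derive_id derive_cst addr0.
have -> : (fun t : R => (t + 1) ^+ k) = (fun t : R => t + 1) ^+ k.
  by apply/funext => t; rewrite exprfctE.
rewrite (deriveMl (g v) (derivableX (n := k) dt)) (deriveX k dt) Dt add0r expr1n mulr1.
by rewrite [_ *: _]mulr1 mulrC.
Qed.

End Homogeneity.

Section PairSmooth.
Context {R : realType} {W : normedModType R} {n m : nat}.

Lemma pairl_linear : linear (fun a : 'rV[R]_n => (a, 0 : 'rV[R]_m)).
Proof.
by move=> k u v; congr pair; rewrite /= ?scaler0 ?addr0.
Qed.

Lemma pairr_linear : linear (fun a : 'rV[R]_m => (0 : 'rV[R]_n, a)).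
Proof.
by move=> k u v; congr pair; rewrite /= ?scaler0 ?addr0.
Qed.

Lemma smooth_pair (U : set W) (f : W -> 'rV[R]_n) (g : W -> 'rV[R]_m) :
  open U -> smooth_on U f -> smooth_on U g -> smooth_on U (fun x => (f x, g x)).
Proof.
move=> oU sf sg.
pose l : {linear 'rV[R]_n -> ('rV[R]_n * 'rV[R]_m)%type} :=
  HB.pack (fun a : 'rV[R]_n => (a, 0 : 'rV[R]_m)) (GRing.isLinear.Build _ _ _ _ _ pairl_linear).
pose r : {linear 'rV[R]_m -> ('rV[R]_n * 'rV[R]_m)%type} :=
  HB.pack (fun a : 'rV[R]_m => (0 : 'rV[R]_n, a)) (GRing.isLinear.Build _ _ _ _ _ pairr_linear).
have cl : continuous l by exact: row_linear_continuous.
have cr : continuous r by exact: row_linear_continuous.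
apply: (smooth_eq oU) (smooth_add oU (smooth_linear oU cl sf) (smooth_linear oU cr sg)).
by move=> x _; congr pair; rewrite /= ?addr0 ?add0r.
Qed.

Lemma smooth_id (U : set W) : open U -> smooth_on U (fun x => x).
Proof.
move=> oU; apply/smooth_onP; elim=> [|k IH]; split=> //.
move=> u; apply: (smooth_upto_eq oU) (smooth_upto_cst oU k u) => x _.
by rewrite -[RHS]/('D_u id x) derive_id.
Qed.

End PairSmooth.

(** * Pseudo-Finsler metrics *)

Section Finsler.
Context {R : realType} {n : nat} {M : manifold R n} (L : pseudo_finsler M).
Local Notation V := 'rV[R]_n.
Implicit Types (p q : M).

Definition lag_in_chart p (z : V * V) : R := L (coordV p z.1) (tvec p z).

Lemma tvec_center q v : tvec q (coord q q, v) = v.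
Proof. by rewrite /tvec/= coordK ?const_ext_center//; exact: dom_center. Qed.

Lemma adm_slice q v : tset_in_chart q (adm L) (coord q q, v) <-> adm L q v.
Proof.
have qq := dom_center q.
rewrite /tset_in_chart/= tvec_center coordK//; split=> [[]//|av].
by split=> //; exact: coord_dom.
Qed.

Lemma open_adm q : open (adm L q).
Proof.
have cp : continuous (fun v : V => (coord q q, v)).
  move=> v; apply: differentiable_continuous.
  have sp := smooth_pair openT (smooth_cst openT (coord q q)) (@smooth_id _ V _ openT).
  exact: (smooth_differentiable sp).
have -> : adm L q = (fun v : V => (coord q q, v)) @^-1` tset_in_chart q (adm L).
  by apply/seteqP; split=> v /=; rewrite -(adm_slice q v).
by move/continuousP: cp; apply; exact: adm_open.
Qed.

Lemma smooth_lag q : smooth_on (adm L q) (L q).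
Proof.
have oO := open_adm (q := q).
have sp : smooth_on (adm L q) (fun v : V => (coord q q, v)).
  by apply: smooth_pair => //; [exact: smooth_cst|exact: smooth_id].
apply: (smooth_eq oO) (smooth_comp oO (coordinates_pair n n) _ sp (@lag_smooth _ _ _ L q)).
  by move=> v _ /=; rewrite tvec_center coordK//; exact: dom_center.
by move=> v /adm_slice.
Qed.

Lemma fund_bilin p v : adm L p v -> bilin (fund L p v).
Proof.
by move=> av;
  exact: (fundamental_form_bilin (open_adm (q := p)) (smooth_lag (q := p)) av).
Qed.

Lemma fund_sym p v e h : adm L p v -> fund L p v e h = fund L p v h e.
Proof.
by move=> av;
  exact: (fundamental_form_sym (open_adm (q := p)) (smooth_lag (q := p)) _ _ av).
Qed.

Lemma fund_nd p v e : adm L p v -> (forall h, fund L p v e h = 0) -> e = 0.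
Proof. by move=> av H; apply: (lag_nondegenerate av) => // h _; exact: H. Qed.

Lemma smooth_fund p e h : smooth_on (adm L p) (fun v => fund L p v e h).
Proof.
apply: smooth_mul; [exact: open_adm|exact/smooth_cst/open_adm|].
exact/smooth_derive/smooth_derive/smooth_lag.
Qed.

Lemma cartanE p v b e h : adm L p v ->
  cartan L p v b e h = 2^-1 * 'D_b (fun w => fund L p w e h) v.
Proof.
move=> av; have sd := smooth_derive e (smooth_derive h (smooth_lag (q := p))).
rewrite /fund /fundamental_form.
rewrite (deriveMl 2^-1 (diff_derivable (smooth_differentiable sd av))) mulrA.
by rewrite -invfM -natrM.
Qed.

Lemma cartan_swap23 p v b e h : adm L p v -> cartan L p v b e h = cartan L p v b h e.
Proof.
move=> av; rewrite (cartanE b e h av) (cartanE b h e av).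
have E : 'D_b (fun w => fund L p w e h) v = 'D_b (fun w => fund L p w h e) v.
  by apply: (derive_eq_on (open_adm (q := p))) av => w aw; exact: fund_sym.
exact: (congr1 (fun z => 2^-1 * z) E).
Qed.

Lemma cartan_swap12 p v b e h : adm L p v -> cartan L p v b e h = cartan L p v e b h.
Proof.
move=> av; have sd := smooth_derive h (smooth_lag (q := p)).
exact: (congr1 (fun z => 4^-1 * z) (smooth_derive_comm b e (open_adm (q := p)) sd av)).
Qed.

Lemma cartan_linear1 p v e h a b c : adm L p v ->
  cartan L p v (a *: b + c) e h = a * cartan L p v b e h + cartan L p v c e h.
Proof.
move=> av; rewrite (cartanE _ e h av) (cartanE b e h av) (cartanE c e h av).
have df := smooth_differentiable (@smooth_fund p e h) av.
by rewrite (deriveDr _ _ df) (deriveZr _ _ df) mulrDr mulrCA.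
Qed.

Lemma lag_derive_homogeneous p v h (l : R) : adm L p v -> 0 < l ->
  'D_h (L p) (l *: v) = l * 'D_h (L p) v.
Proof.
move=> av l0; have alv := adm_conic av l0.
have ln0 : l != 0 by rewrite gt_eqF.
have d1 := smooth_differentiable (smooth_lag (q := p)) av.
have d2 := smooth_differentiable (smooth_lag (q := p)) alv.
rewrite (derive_homogeneous (open_adm (q := p)) h l0 av alv d1 d2
  (fun u au => lag_homogeneous au l0)).
by rewrite expr2 mulfK.
Qed.

Lemma fund_homogeneous p v e h (l : R) : adm L p v -> 0 < l ->
  fund L p (l *: v) e h = fund L p v e h.
Proof.
move=> av l0; have alv := adm_conic av l0.
have ln0 : l != 0 by rewrite gt_eqF.
have sd := smooth_derive h (smooth_lag (q := p)).
have d1 := smooth_differentiable sd av; have d2 := smooth_differentiable sd alv.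
have E := derive_homogeneous (open_adm (q := p)) e l0 av alv d1 d2
  (fun u au => lag_derive_homogeneous h au l0).
by rewrite /fund /fundamental_form E mulfV// mul1r.
Qed.

Lemma fund_self p v h : adm L p v -> fund L p v v h = 2^-1 * 'D_h (L p) v.
Proof.
move=> av; rewrite /fund /fundamental_form (@derive_radial _ _ _ 1 v) ?mul1r//.
by move=> l l0; rewrite expr1; exact: lag_derive_homogeneous.
Qed.

(** The fundamental tensor has degree 0, so its derivative along the ray of [v] vanishes. Together
    with the symmetry of C, this removes the Cartan terms that have [v] among their arguments. *)
Lemma cartan_self p v e h : adm L p v -> cartan L p v v e h = 0.
Proof.
move=> av; rewrite (cartanE v e h av) (@derive_radial _ _ _ 0 v) ?mul0r ?mulr0//.
by move=> l l0; rewrite expr0 mul1r; exact: fund_homogeneous.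
Qed.

Lemma cartan_sharpP p v e h : adm L p v ->
  forall b, fund L p v b (cartan_sharp L p v e h) = cartan L p v b e h.
Proof.
move=> av.
have [c Hc] := bilin_repr (fund_bilin av) (fun e => fund_nd (e := e) av)
  (fun a b c => cartan_linear1 e h a b c av).
apply: (@xgetPex _ 0 [set c | forall b, fund L p v b c = cartan L p v b e h]).
by exists c => b; rewrite fund_sym.
Qed.

End Finsler.

Section FundInChart.
Context {R : realType} {n : nat} {M : manifold R n} (L : pseudo_finsler M).
Local Notation V := 'rV[R]_n.
Implicit Types (p q : M).

Lemma derive_slice (f : V * V -> R) x e u :
  'D_(0, e) f (x, u) = 'D_e (fun w => f (x, w)) u.
Proof.
rewrite -(@derive_affine _ _ _ _ (fun w : V => (x, w)) f u e (0, e))// => t.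
by congr pair; rewrite /= ?scaler0 ?add0r.
Qed.

(** Changing components at a fixed [q] is linear, so the Hessian along the fibre can be computed in
    the chart at [p] for all [q] near it; its dependence on [q] then becomes visible. *)
Lemma fund_in_chart p q u e h : dom p q ->
  fund L q (const_ext p u q) (const_ext p e q) (const_ext p h q) =
  2^-1 * 'D_(0, e) ('D_(0, h) (lag_in_chart L p)) (coord p q, u).
Proof.
move=> pq; apply: (congr1 (fun z : R => 2^-1 * z)).
have aff (W : normedModType R) (f : V -> W) k w :
    'D_(const_ext p k q) f (const_ext p w q) = 'D_k (fun z => f (const_ext p z q)) w.
  rewrite -(@derive_affine _ _ _ _ (fun z => const_ext p z q) f w k)// => t.
  by rewrite const_ext_linear.
rewrite aff derive_slice; apply: (congr1 (fun f : V -> R => 'D_e f u)); apply/funext => w.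
rewrite aff derive_slice; apply: (congr1 (fun f : V -> R => 'D_h f w)); apply/funext => z.
by rewrite /lag_in_chart /tvec/= coordK.
Qed.

Lemma smooth_lag_in_chart p : smooth_on (tset_in_chart p (adm L)) (lag_in_chart L p).
Proof. exact: lag_smooth. Qed.

Definition gram_in_chart p (z : V * V) : 'M[R]_n :=
  \matrix_(i, j) (2^-1 * 'D_(0, row_basis i) ('D_(0, row_basis j) (lag_in_chart L p)) z).

Lemma smooth_gram p : smooth_mx (tset_in_chart p (adm L)) (gram_in_chart p).
Proof.
have oT := @adm_open _ _ _ L p => i j.
have sD := smooth_derive (0, row_basis i) (smooth_derive (0, row_basis j) (@smooth_lag_in_chart p)).
apply: (smooth_eq oT) (smooth_mul oT (smooth_cst oT (2^-1 : R)) sD).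
by move=> z _; rewrite mxE.
Qed.

Lemma tset_const_ext p q u : dom p q ->
  tset_in_chart p (adm L) (coord p q, u) <-> adm L q (const_ext p u q).
Proof.
move=> pq; rewrite /tset_in_chart/= /tvec/= coordK//; split=> [[]//|au].
by split=> //; exact: coord_dom.
Qed.

Lemma fund_gram p q u e h : dom p q -> adm L q (const_ext p u q) ->
  fund L q (const_ext p u q) (const_ext p e q) (const_ext p h q) =
  (e *m gram_in_chart p (coord p q, u) *m h^T) 0 0.
Proof.
move=> pq au.
have [b bE] : exists b, forall e h,
    b e h = fund L q (const_ext p u q) (const_ext p e q) (const_ext p h q).
  by exists (fun e h => fund L q (const_ext p u q) (const_ext p e q) (const_ext p h q)).
have bL := fund_bilin au.
have bb : bilin b.
  split=> [a k l w|w a k l]; rewrite !bE (const_ext_linear p q).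
    exact: bL.1.
  exact: bL.2.
have gE : gram b = gram_in_chart p (coord p q, u).
  by apply/matrixP => i j; rewrite !mxE bE fund_in_chart.
by rewrite -bE (bilin_gram bb) gE.
Qed.

Lemma smooth_fund_fields U (Z H K : M -> V) : open U -> smooth_vf U Z ->
  smooth_vf U H -> smooth_vf U K -> (forall q, U q -> adm L q (Z q)) ->
  smooth_fun U (fun q => fund L q (Z q) (H q) (K q)).
Proof.
move=> oU sZ sH sK aZ p; have oW := open_chart_image (p := p) oU.
have sz : smooth_on (chart_image p U) (fun x => (x, vf_in_chart p Z x)).
  exact: (smooth_pair oW (smooth_id oW) (sZ p)).
have oT := @adm_open _ _ _ L p.
have zT x : chart_image p U x -> tset_in_chart p (adm L) (x, vf_in_chart p Z x).
  move=> /chart_imageP[px Ux]; have [dx Ex] := coordVK px.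
  have cE := const_ext_vf Z dx; have := (tset_const_ext (vf_in_chart p Z x) dx).2.
  by rewrite Ex in cE *; rewrite cE; apply; exact: aZ.
have sg i j := smooth_comp oW (coordinates_pair n n) zT sz (smooth_gram (p := p) i j).
have sHi := (smooth_rowP oW _).1 (sH p); have sKi := (smooth_rowP oW _).1 (sK p).
have := smooth_sum oW (index_enum 'I_n) (fun j => smooth_mul oW (smooth_sum oW (index_enum 'I_n)
   (fun i => smooth_mul oW (sHi i) (sg i j))) (sKi j)).
apply: (smooth_eq oW) => x Wx; have /chart_imageP[px Ux] := Wx.
have [dx Ex] := coordVK px.
have cE (X : M -> V) : X (coordV p x) = const_ext p (vf_in_chart p X x) (coordV p x).
  by have := const_ext_vf X dx; rewrite Ex.
rewrite /= (cE Z) (cE H) (cE K) fund_gram//; last by rewrite -cE; exact: aZ.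
rewrite Ex mxE; apply: eq_bigr => j _; rewrite !mxE; congr (_ * _).
Qed.

End FundInChart.

(** * Pseudo-Finsler submersions *)

Section SubmersionInChart.
Context {R : realType} {n m : nat} {M : manifold R n} {B : manifold R m}.
Variable sigma : M -> B.
Hypothesis ssig : smooth_map sigma.
Implicit Types (p q : M).

Fact dmap_is_linear p : linear (dmap sigma p).
Proof. by move=> k u v; rewrite /dmap linearP. Qed.

HB.instance Definition _ p :=
  GRing.isLinear.Build R 'rV[R]_n 'rV[R]_m _ (dmap sigma p) (dmap_is_linear p).

Definition map_in_chart p (b : B) : 'rV[R]_n -> 'rV[R]_m :=
  coord b \o sigma \o @coordV R n M p.

Lemma smooth_map_in_chart p b :
  smooth_on (chart_image p (sigma @^-1` dom b)) (map_in_chart p b).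
Proof. exact: ssig.2. Qed.

Lemma map_in_chart_differentiable p b q : dom p q -> dom b (sigma q) ->
  differentiable (map_in_chart p b) (coord p q).
Proof.
move=> pq bq.
exact: (smooth_differentiable (@smooth_map_in_chart p b) (chart_image_coord pq bq)).
Qed.

Lemma open_preimage_dom b : open (sigma @^-1` dom b).
Proof. by move/continuousP: ssig.1; apply; exact: dom_open. Qed.

(** [dmap] at [q] refers to the charts centred at [q] and [sigma q], which vary with [q]. Rewriting
    it in one fixed pair of charts allows differentiation in [q]. *)
Lemma dmap_const_ext p q b u : dom p q -> dom b (sigma q) ->
  dmap sigma q (const_ext p u q) =
  const_ext b ('D_u (map_in_chart p b) (coord p q)) (sigma q).
Proof.
move=> pq bq; have qq := dom_center q; have sq := dom_center (sigma q).
rewrite /const_ext comp_changeE// comp_changeE//.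
rewrite /dmap diff_derive; last exact: (map_in_chart_differentiable qq sq).
have Eq : (coord q \o @coordV R n M p) (coord p q) = coord q q by rewrite /= coordK.
have Es : map_in_chart p b (coord p q) = coord b (sigma q) by rewrite /map_in_chart/= coordK.
rewrite -[in LHS]Eq -[in RHS]Es.
rewrite -derive_comp; last 2 first.
- exact: change_differentiable.
- by rewrite Eq; exact: (map_in_chart_differentiable qq sq).
rewrite -derive_comp; last 2 first.
- exact: map_in_chart_differentiable.
- by rewrite Es; exact: change_differentiable.
apply: near_eq_derive.
have n1 := nbhs_coordV pq (near_dom qq).
have n2 : \forall r \near q, dom b (sigma r).
  by apply: open_nbhs_nbhs; split=> //; exact: open_preimage_dom.
move: n1 (nbhs_coordV pq n2); apply: filterS2 => x qx bx.
by rewrite /map_in_chart /= !coordK.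
Qed.

Lemma dmapE p u : dmap sigma p u = 'D_u (map_in_chart p (sigma p)) (coord p p).
Proof.
have := dmap_const_ext u (dom_center p) (dom_center (sigma p)).
by rewrite !const_ext_center.
Qed.

Definition dmap_mx p b x : 'M[R]_(n, m) := \matrix_i 'D_(row_basis i) (map_in_chart p b) x.

Lemma dmap_mxE p b x u : chart_image p (sigma @^-1` dom b) x ->
  u *m dmap_mx p b x = 'D_u (map_in_chart p b) x.
Proof.
move=> Wx; have ds := smooth_differentiable (@smooth_map_in_chart p b) Wx.
rewrite (derive_coordinates _ (coordinates_row n) ds) mulmx_sum_row.
by apply: eq_bigr => i _; rewrite rowK.
Qed.

Lemma smooth_dmap_mx p b : smooth_mx (chart_image p (sigma @^-1` dom b)) (dmap_mx p b).
Proof.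
move=> i j; have oW := open_chart_image (p := p) (@open_preimage_dom b).
apply: (smooth_eq oW) ((smooth_rowP oW _).1
  (smooth_derive (row_basis i) (@smooth_map_in_chart p b)) j).
by move=> x _; rewrite !mxE.
Qed.

End SubmersionInChart.

Section VerticalPart.
Context {R : realType} {n m : nat} {M : manifold R n} {B : manifold R m}.
Variables (L : pseudo_finsler M) (sigma : M -> B).
Hypothesis hsub : submersion sigma.
Hypothesis hvert : forall (p : M) (v : 'rV[R]_n), adm L p v ->
  nondegenerate_on (fund L p v) (vertical sigma p).
Implicit Types (p q : M).
Local Notation V := 'rV[R]_n.

Lemma dmap_surj p w : exists v, dmap sigma p v = w.
Proof. by case: hsub => _ _; exact. Qed.

Lemma vertical0 p : vertical sigma p 0.
Proof. by rewrite /vertical/= linear0. Qed.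

Lemma verticalD p u w : vertical sigma p u -> vertical sigma p w ->
  vertical sigma p (u + w).
Proof. by rewrite /vertical/= => vu vw; rewrite linearD/= vu vw addr0. Qed.

Lemma verticalZ p a u : vertical sigma p u -> vertical sigma p (a *: u).
Proof. by rewrite /vertical/= => vu; rewrite linearZ/= vu scaler0. Qed.

Lemma verticalB p u w : vertical sigma p u -> vertical sigma p w ->
  vertical sigma p (u - w).
Proof. by rewrite /vertical/= => vu vw; rewrite linearB/= vu vw subrr. Qed.

Lemma vpartP q v e : adm L q v ->
  vertical sigma q (vpart sigma L q v e) /\
  ghorizontal sigma L q v (e - vpart sigma L q v e).
Proof.
move=> av; have bb := fund_bilin av.
have [QS Qker Qorth] := @hproj_mxP _ _ _ _ (dmap sigma q : {linear _ -> _}) bb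
  (lag_nondegenerate av) (hvert av) (dmap_surj q).
set Q := hproj_mx _ _ in QS Qker Qorth.
apply: (@xgetPex _ 0 [set w | vertical sigma q w /\ ghorizontal sigma L q v (e - w)]).
exists (e - e *m Q); split; first by rewrite /vertical/= linearB/= QS subrr.
by rewrite opprB addrC subrK => w Sw; exact: Qorth.
Qed.

Lemma vpart_vertical q v e : adm L q v -> vertical sigma q (vpart sigma L q v e).
Proof. by move=> /(vpartP e)[]. Qed.

Lemma hpart_horizontal q v e : adm L q v ->
  ghorizontal sigma L q v (e - vpart sigma L q v e).
Proof. by move=> /(vpartP e)[]. Qed.

(** Two candidates differ by a vector that is both vertical and g_v-horizontal, hence 0. *)
Lemma vpart_unique q v e w : adm L q v -> vertical sigma q w ->
  ghorizontal sigma L q v (e - w) -> vpart sigma L q v e = w.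
Proof.
move=> av vw hw; have [vu hu] := vpartP e av; have bb := fund_bilin av.
apply/eqP; rewrite -subr_eq0; apply/eqP; apply: (hvert av).
  exact: verticalB.
move=> h vh.
have -> : vpart sigma L q v e - w = (e - w) - (e - vpart sigma L q v e).
  by rewrite opprB [RHS]addrC addrA subrK.
by rewrite (bilinBl bb) hw// hu// subrr.
Qed.

Lemma ghorizontalD q v x y : adm L q v -> ghorizontal sigma L q v x ->
  ghorizontal sigma L q v y -> ghorizontal sigma L q v (x + y).
Proof. by move=> av hx hy w vw; rewrite (bilinDl (fund_bilin av)) hx// hy// addr0. Qed.

Lemma ghorizontalZ q v a x : adm L q v -> ghorizontal sigma L q v x ->
  ghorizontal sigma L q v (a *: x).
Proof. by move=> av hx w vw; rewrite (bilinZl (fund_bilin av)) hx// mulr0. Qed.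

Lemma ghorizontal0 q v : adm L q v -> ghorizontal sigma L q v 0.
Proof. by move=> av w _; rewrite (bilin0l (fund_bilin av)). Qed.

Lemma vpartD q v x y : adm L q v ->
  vpart sigma L q v (x + y) = vpart sigma L q v x + vpart sigma L q v y.
Proof.
move=> av; apply: vpart_unique => //; first by apply: verticalD; exact: vpart_vertical.
by rewrite opprD addrACA; apply: ghorizontalD => //; exact: hpart_horizontal.
Qed.

Lemma vpartZ q v a x : adm L q v ->
  vpart sigma L q v (a *: x) = a *: vpart sigma L q v x.
Proof.
move=> av; apply: vpart_unique => //; first by apply: verticalZ; exact: vpart_vertical.
by rewrite -scalerBr; apply: ghorizontalZ => //; exact: hpart_horizontal.
Qed.

Lemma vpart_id q v w : adm L q v -> vertical sigma q w -> vpart sigma L q v w = w.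
Proof. by move=> av vw; apply: vpart_unique => //; rewrite subrr; exact: ghorizontal0. Qed.

Lemma vpart_eq0 q v x : adm L q v -> ghorizontal sigma L q v x ->
  vpart sigma L q v x = 0.
Proof.
move=> av hx; have hx0 : ghorizontal sigma L q v (x - 0) by rewrite subr0.
exact: (vpart_unique av (vertical0 q) hx0).
Qed.

Lemma vpartN q v x : adm L q v -> vpart sigma L q v (- x) = - vpart sigma L q v x.
Proof. by move=> av; rewrite -scaleN1r vpartZ// scaleN1r. Qed.

Lemma vpartB q v x y : adm L q v ->
  vpart sigma L q v (x - y) = vpart sigma L q v x - vpart sigma L q v y.
Proof. by move=> av; rewrite vpartD// vpartN. Qed.

Lemma fund_vpart q v e w : adm L q v -> vertical sigma q w ->
  fund L q v (vpart sigma L q v e) w = fund L q v e w.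
Proof.
move=> av vw; apply/eqP; rewrite eq_sym -subr_eq0 -(bilinBl (fund_bilin av)).
by rewrite hpart_horizontal.
Qed.

Lemma vertical_eq q v u w : adm L q v -> vertical sigma q u -> vertical sigma q w ->
  (forall k, vertical sigma q k -> fund L q v u k = fund L q v w k) -> u = w.
Proof.
move=> av vu vw H; apply/eqP; rewrite -subr_eq0; apply/eqP; apply: (hvert av).
  exact: verticalB.
by move=> k vk; rewrite (bilinBl (fund_bilin av)) H// subrr.
Qed.

Let ssig : smooth_map sigma. Proof. by case: hsub. Qed.

Definition tset_submersion p : set (V * V) :=
  tset_in_chart p (adm L) `&`
  [set z | chart_image p (sigma @^-1` dom (sigma p)) z.1].

Lemma open_tset_submersion p : open (tset_submersion p).
Proof.
apply: openI; first exact: adm_open.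
have oW := open_chart_image (p := p) (open_preimage_dom ssig (sigma p)).
by apply: open_comp oW => z _; exact: cvg_fst.
Qed.

(** The vertical projection in components of the chart at [p], for position and direction [z]. As a
    rational expression in the Gram and Jacobian matrices, it depends smoothly on [z]. *)
Definition vpart_mx p (z : V * V) : 'M[R]_n :=
  1%:M - hproj (gram_in_chart L p z) (dmap_mx sigma p (sigma p) z.1).

Lemma const_ext_onto p q w : dom p q -> exists w0, w = const_ext p w0 q.
Proof.
move=> pq; exists (comp_change q p q w).
by rewrite /const_ext comp_changeK//; exact: dom_center.
Qed.

Lemma const_ext_inj k (N : manifold R k) (p q : N) e : dom p q ->
  const_ext p e q = 0 -> e = 0.
Proof.
move=> pq; rewrite /const_ext => H.
by rewrite -(comp_changeK e pq (dom_center q)) H linear0.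
Qed.

Section At.
Variables (p q : M) (u : V).
Hypotheses (pq : dom p q) (sq : dom (sigma p) (sigma q)).
Hypothesis au : adm L q (const_ext p u q).
Let z := (coord p q, u).
Let G := gram_in_chart L p z.
Let S := dmap_mx sigma p (sigma p) (coord p q).

Lemma dmap_mx_const_ext e :
  dmap sigma q (const_ext p e q) = const_ext (sigma p) (e *m S) (sigma q).
Proof.
rewrite /S (dmap_const_ext ssig e pq sq) dmap_mxE//.
exact: chart_image_coord.
Qed.

Lemma vertical_const_ext e : vertical sigma q (const_ext p e q) <-> e *m S = 0.
Proof.
rewrite /vertical/= dmap_mx_const_ext; split; first exact: const_ext_inj.
by move=> ->; rewrite /const_ext linear0.
Qed.

Lemma gram_in_chart_unit : G \in unitmx.
Proof.
apply: unitmx_inj => e eG; apply: (const_ext_inj pq); apply: (fund_nd au) => h.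
have [h0 ->] := const_ext_onto h pq.
by rewrite fund_gram// -/z -/G eG mul0mx mxE.
Qed.

Lemma dmap_mx_surj (c : 'rV[R]_m) : exists e : V, e *m S = c.
Proof.
have [e He] := dmap_surj q (const_ext (sigma p) c (sigma q)).
have [e0 E0] := const_ext_onto e pq; exists e0; apply/eqP; rewrite -subr_eq0.
apply/eqP; apply: (const_ext_inj sq); move: He.
rewrite E0 dmap_mx_const_ext => He.
have := const_ext_linear (sigma p) (sigma q) (-1) c (e0 *m S).
by rewrite He !scaleN1r !addNr addrC.
Qed.

Lemma gram_in_chart_nd (w : V) : w *m S = 0 ->
  (forall w' : V, w' *m S = 0 -> (w *m G *m w'^T) 0 0 = 0) -> w = 0.
Proof.
move=> wS H; apply: (const_ext_inj pq); apply: (hvert au).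
  by apply/vertical_const_ext.
move=> h; have [h0 ->] := const_ext_onto h pq => /vertical_const_ext hS.
by rewrite fund_gram//; exact: H.
Qed.

Lemma vpart_in_chart e :
  vpart sigma L q (const_ext p u q) (const_ext p e q) = const_ext p (e *m vpart_mx p z) q.
Proof.
have E : e *m vpart_mx p z = e - e *m hproj G S by rewrite mulmxBr mulmx1.
have ND := gram_in_chart_nd; have SU := dmap_mx_surj; have UG := gram_in_chart_unit.
apply: vpart_unique => //.
  by apply/vertical_const_ext; rewrite E mulmxBl hprojS// subrr.
move=> w; have [w0 ->] := const_ext_onto w pq => /vertical_const_ext wS.
have -> : const_ext p e q - const_ext p (e *m vpart_mx p z) q =
    const_ext p (e *m hproj G S) q.
  rewrite E; have := const_ext_linear p q (-1) (e - e *m hproj G S) e.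
  by rewrite !scaleN1r opprB subrK [in RHS]addrC.
by rewrite fund_gram//; exact: hproj_orth.
Qed.

End At.

Lemma smooth_vpart_mx p : smooth_mx (tset_submersion p) (vpart_mx p).
Proof.
have oO := @open_tset_submersion p.
have sG : smooth_mx (tset_submersion p) (gram_in_chart L p).
  by move=> i j; apply: smooth_subset (smooth_gram (p := p) i j) => z [].
have sfst : smooth_on (tset_submersion p) (fun z : V * V => z.1).
  have cf : continuous (fst : {linear (V * V)%type -> V}) by move=> z; exact: cvg_fst.
  exact: (smooth_linear oO cf (smooth_id oO)).
have sS : smooth_mx (tset_submersion p) (fun z => dmap_mx sigma p (sigma p) z.1).
  move=> i j.
  apply: (smooth_comp oO (coordinates_row n) _ sfst
    (smooth_dmap_mx ssig (p := p) (b := sigma p) i j)).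
  by move=> z [].
have zP z : tset_submersion p z -> exists q,
    [/\ dom p q, dom (sigma p) (sigma q), z = (coord p q, z.2) & adm L q (const_ext p z.2 q)].
  case: z => x u [[/= px au] /chart_imageP[_ sx]]; have [dx Ex] := coordVK px.
  by exists (coordV p x); rewrite Ex; split.
have sGi : smooth_mx (tset_submersion p) (fun z => invmx (gram_in_chart L p z)).
  apply: smooth_mx_inv => // z /zP[q [pq sq -> au]].
  exact: gram_in_chart_unit.
have sSt := smooth_mx_tr oO sS.
have sN := smooth_mx_mul oO (smooth_mx_mul oO sSt sGi) sS.
have sNi : smooth_mx (tset_submersion p) (fun z =>
    invmx ((dmap_mx sigma p (sigma p) z.1)^T *m invmx (gram_in_chart L p z)
      *m dmap_mx sigma p (sigma p) z.1)).
  apply: smooth_mx_inv => // z /zP[q [pq sq -> au]].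
  apply: hproj_unit; [exact: gram_in_chart_unit|exact: dmap_mx_surj|].
  exact: gram_in_chart_nd.
have sQ := smooth_mx_mul oO (smooth_mx_mul oO (smooth_mx_mul oO sS sNi) sSt) sGi.
move=> i j; apply: (smooth_eq oO) (smooth_sub oO (smooth_cst oO ((1%:M : 'M[R]_n) i j)) (sQ i j)).
by move=> z _; rewrite /vpart_mx [RHS]mxE [X in _ = _ + X]mxE.
Qed.

End VerticalPart.

(** * The horizontal isometry property *)

Section SubmersionIsometry.
Context {R : realType} {n m : nat} {M : manifold R n} {B : manifold R m}.
Variables (L : pseudo_finsler M) (L' : pseudo_finsler B) (sigma : M -> B).
Hypothesis hsigma : pseudo_finsler_submersion sigma L L'.
Hypothesis hvert : forall (p : M) (v : 'rV[R]_n), adm L p v ->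
  nondegenerate_on (fund L p v) (vertical sigma p).

(** The result on critical vectors, applied in the single tangent space at [q]; Euler's relation
    [fund_self] translates between critical and horizontal. *)
Lemma fund_submersion q v e h : adm L q v -> ghorizontal sigma L q v v ->
  ghorizontal sigma L q v e ->
  fund L q v e h =
  fund L' (sigma q) (dmap sigma q v) (dmap sigma q e) (dmap sigma q h).
Proof.
case: hsigma => hsub _ hL av hv he.
have crit w : adm L q w -> critical (L q) (dmap sigma q : {linear _ -> _}) w ->
    ghorizontal sigma L q w w.
  by move=> aw cw k vk; rewrite fund_self// cw ?mulr0.
have := @fundamental_form_critical _ _ _ (adm L q) (L q) (@open_adm _ _ _ L q)
  (@smooth_lag _ _ _ L q) (dmap sigma q : {linear _ -> _}) (dmap_surj hsub q)
  (fun w aw => lag_nondegenerate aw) (fun w aw => hvert aw)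
  (adm L' (sigma q)) (L' (sigma q)) (@smooth_lag _ _ _ L' (sigma q))
  (fun w aw cw => hL q w aw (crit w aw cw)) v e h av.
apply => // w vw; have := hv w vw; rewrite fund_self// => /eqP.
by rewrite mulf_eq0 invr_eq0 pnatr_eq0/= => /eqP.
Qed.

End SubmersionIsometry.

(** * Product rules for vector and matrix valued maps *)

Section MatrixDerivatives.
Context {R : realType} {W : normedModType R}.

Lemma derive_pair (W1 W2 : normedModType R) (f : W -> W1) (g : W -> W2) x h :
  differentiable f x -> differentiable g x ->
  'D_h (fun y => (f y, g y)) x = ('D_h f x, 'D_h g x).
Proof.
move=> df dg; rewrite (deriveE _ (differentiable_pair df dg)) diff_pair//.
by rewrite !deriveE.
Qed.

Lemma derive_rowE n (f : W -> 'rV[R]_n) x h j : differentiable f x ->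
  'D_h f x 0 j = 'D_h (fun y => f y 0 j) x.
Proof.
move=> df.
by have := @derive_linear_comp _ _ _ _ (row_coord j) f x h (@row_coord_continuous R n j) df.
Qed.

Lemma differentiable_rowP n (f : W -> 'rV[R]_n) x :
  (forall j, differentiable (fun y => f y 0 j) x) -> differentiable f x.
Proof.
move=> df; have -> : f = \sum_(j < n) (fun y => f y 0 j *: (row_basis j : 'rV[R]_n)).
  by apply/funext => y; rewrite fct_sumE {1}(row_sum_delta (f y)).
by apply: differentiable_sum => j; exact: differentiableZl.
Qed.

Lemma derive_row_mulmx a b (f : W -> 'rV[R]_a) (A : W -> 'M[R]_(a, b)) x h :
  differentiable f x -> (forall i j, differentiable (fun y => A y i j) x) ->
  differentiable (fun y => f y *m A y) x /\
  'D_h (fun y => f y *m A y) x =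
  'D_h f x *m A x + f x *m (\matrix_(i, j) 'D_h (fun y => A y i j) x).
Proof.
move=> df dA.
have dfi i : differentiable (fun y => f y 0 i) x.
  exact: (differentiable_comp df (differentiable_coord _ _ _)).
have fE j : (fun y => (f y *m A y) 0 j) =
    \sum_(i < a) ((fun y => f y 0 i) * (fun y => A y i j)).
  by apply/funext => y; rewrite fct_sumE mxE.
have dfA i j : differentiable ((fun y => f y 0 i) * (fun y => A y i j)) x.
  exact: differentiableM.
have d : differentiable (fun y => f y *m A y) x.
  by apply: differentiable_rowP => j; rewrite fE; exact: differentiable_sum.
split=> //; apply/rowP => j; rewrite (derive_rowE h j d) fE derive_sum; last first.
  by move=> i; exact: diff_derivable.
rewrite !mxE -big_split/=; apply: eq_bigr => i _.
rewrite (deriveM (diff_derivable (dfi i)) (diff_derivable (dA i j))).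
have sc (r1 r2 r3 r4 : R) : r1 *: r2 + r3 *: r4 = r4 * r3 + r1 * r2.
  by rewrite addrC [r4 * r3]mulrC.
by rewrite (derive_rowE h i df) [X in _ = _ + _ * X]mxE; exact: sc.
Qed.

Lemma derive_bilinear_sum n (b : W -> 'rV[R]_n -> R) (f : W -> 'rV[R]_n) x h :
  (\forall y \near x, b y (f y) = \sum_i f y 0 i * b y (row_basis i)) ->
  differentiable f x -> (forall i, differentiable (fun y => b y (row_basis i)) x) ->
  'D_h (fun y => b y (f y)) x =
  \sum_i (f x 0 i * 'D_h (fun y => b y (row_basis i)) x + b x (row_basis i) * 'D_h f x 0 i).
Proof.
move=> bE df db.
have dfi i : differentiable (fun y => f y 0 i) x.
  exact: (differentiable_comp df (differentiable_coord _ _ _)).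
have -> : 'D_h (fun y => b y (f y)) x =
    'D_h (\sum_(i < n) ((fun y => f y 0 i) * (fun y => b y (row_basis i)))) x.
  by apply: near_eq_derive; apply: filterS bE => y ->; rewrite fct_sumE.
rewrite derive_sum; last by move=> i; exact/diff_derivable/differentiableM.
apply: eq_bigr => i _.
rewrite (deriveM (diff_derivable (dfi i)) (diff_derivable (db i))).
by rewrite (derive_rowE h i df).
Qed.

End MatrixDerivatives.

(** * The O'Neill tensors *)

Section ONeillFormula.
Context {R : realType} {n m : nat} {M : manifold R n} {B : manifold R m}.
Variables (L : pseudo_finsler M) (sigma : M -> B).
Hypothesis hsub : submersion sigma.
Hypothesis hvert : forall (p : M) (v : 'rV[R]_n), adm L p v ->
  nondegenerate_on (fund L p v) (vertical sigma p).
Local Notation V := 'rV[R]_n.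
Variables (p : M) (v : V).
Hypothesis av : adm L p v.

Let ssig : smooth_map sigma. Proof. by case: hsub. Qed.
Let x0 := coord p p.
Let Phi := vpart_mx L sigma p.
Let O := tset_submersion L sigma p.

Let oO : open O. Proof. exact: open_tset_submersion. Qed.

Lemma tset_submersionP q u : dom p q ->
  tset_submersion L sigma p (coord p q, u) <->
  dom (sigma p) (sigma q) /\ adm L q (const_ext p u q).
Proof.
move=> pq; split=> [[/(tset_const_ext L u pq) au /chart_imageP[_]]|[sq au]].
  by rewrite /= coordK.
by split; [exact/(tset_const_ext L u pq)|exact: chart_image_coord].
Qed.

Let Oz0 u : adm L p u -> O (x0, u).
Proof.
move=> au; apply/(tset_submersionP _ (dom_center p)); split; first exact: dom_center.
by rewrite const_ext_center.
Qed.

Let dPhi u i j : adm L p u -> differentiable (fun z => Phi z i j) (x0, u).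
Proof.
move=> au.
exact: (smooth_differentiable (smooth_vpart_mx hsub hvert (p := p) i j) (Oz0 au)).
Qed.

Lemma vpart_center u e : adm L p u -> vpart sigma L p u e = e *m Phi (x0, u).
Proof.
move=> au.
have := vpart_in_chart hsub hvert (u := u) (dom_center p) (dom_center (sigma p)).
by rewrite const_ext_center => /(_ au e); rewrite !const_ext_center.
Qed.

Let DPhi (k : V * V) : 'M[R]_n := \matrix_(i, j) 'D_k (fun z => Phi z i j) (x0, v).

Let phi_derive (e : V) (k : V * V) : differentiable (fun z => e *m Phi z) (x0, v) /\
  'D_k (fun z => e *m Phi z) (x0, v) = e *m DPhi k.
Proof.
have [d ->] := derive_row_mulmx k (differentiable_cst e (x0, v)) (fun i j => dPhi i j av).
by rewrite derive_cst mul0mx add0r.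
Qed.

Lemma vpart_derive_slice e k :
  differentiable (fun w => vpart sigma L p w e) v /\
  'D_k (fun w => vpart sigma L p w e) v = 'D_(0, k) (fun z => e *m Phi z) (x0, v).
Proof.
have E : \forall w \near v, e *m Phi (x0, w) = vpart sigma L p w e.
  have : \forall w \near v, adm L p w by apply: open_nbhs_nbhs; split=> //; exact: open_adm.
  by apply: filterS => w aw; rewrite vpart_center.
have ds : differentiable (fun w : V => (x0, w)) v.
  have sp := smooth_pair openT (smooth_cst openT x0) (@smooth_id _ V _ openT).
  exact: (smooth_differentiable sp).
have d : differentiable (fun w => e *m Phi (x0, w)) v.
  exact: (differentiable_comp ds (phi_derive e 0).1).
split; first exact: (near_eq_diff E d).1.
rewrite -(near_eq_derive _ E).
rewrite -(@derive_affine _ _ _ _ (fun w : V => (x0, w)) (fun z => e *m Phi z) v k (0, k))// => t.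
by congr pair; rewrite /= scaler0 add0r.
Qed.

(** Differentiate g_u(e^top_u, w) = g_u(e, w) at u = v, for vertical w. Since e^top_v = 0, the left
    side gives g_v(D, w) with D the derivative sought, and the right side gives 2 C_v(k, e, w). D is
    vertical because all e^top_u are. *)
Lemma vpart_derive e k : ghorizontal sigma L p v e ->
  'D_k (fun w => vpart sigma L p w e) v =
  vpart sigma L p v (2 *: cartan_sharp L p v k e).
Proof.
move=> he; have [d _] := vpart_derive_slice e k.
have [D DE] : exists D, D = 'D_k (fun w => vpart sigma L p w e) v by eexists.
rewrite -DE; have oA := @open_adm _ _ _ L p; have bb := fund_bilin av.
have vD : vertical sigma p D.
  have cs : continuous (dmap sigma p : {linear _ -> _}) by exact: row_linear_continuous.
  have E := derive_linear_comp k cs d; rewrite -DE in E; apply: (etrans (esym E)).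
  rewrite -[RHS](derive_cst (0 : 'rV[R]_m) v k).
  by apply: (derive_eq_on oA) av => w aw; exact: (vpart_vertical hsub hvert e aw).
have main : ghorizontal sigma L p v (2 *: cartan_sharp L p v k e - D).
  move=> w vw; rewrite (bilinBl bb) (bilinZl bb) (fund_sym _ _ av).
  rewrite (cartan_sharpP _ _ av).
  have E1 : 'D_k (fun u => fund L p u (vpart sigma L p u e) w) v =
      'D_k (fun u => fund L p u e w) v.
    by apply: (derive_eq_on oA) av => u au; exact: (fund_vpart hsub hvert e au vw).
  have H1 : \forall u \near v, fund L p u (vpart sigma L p u e) w =
      \sum_i vpart sigma L p u e 0 i * fund L p u (row_basis i) w.
    apply: (near_on oA) av => u au.
    rewrite {1}(row_sum_delta (vpart sigma L p u e)) (bilin_suml (fund_bilin au)).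
    by apply: eq_bigr => i _; rewrite (bilinZl (fund_bilin au)).
  have H2 i := smooth_differentiable (@smooth_fund _ _ _ L p (row_basis i) w) av.
  have E2 : 'D_k (fun u => fund L p u (vpart sigma L p u e) w) v = fund L p v D w.
    apply: (etrans (@derive_bilinear_sum _ _ _ (fun u h => fund L p u h w)
      (fun u => vpart sigma L p u e) v k H1 d H2)).
    rewrite -DE {2}(row_sum_delta D) (bilin_suml bb); apply: eq_bigr => i _.
    by rewrite (vpart_eq0 hsub hvert av he) mxE mul0r add0r (bilinZl bb) mulrC.
  have C1 : cartan L p v w k e = cartan L p v k e w.
    exact: (etrans (cartan_swap12 w k e av) (cartan_swap23 k w e av)).
  have C2 : cartan L p v k e w = 2^-1 * fund L p v D w.
    exact: (etrans (cartanE k e w av) (congr1 (fun r => 2^-1 * r) (etrans (esym E1) E2))).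
  have half (r : R) : 2 * (2^-1 * r) - r = 0 by field.
  rewrite (etrans C1 C2); exact: half.
exact: (esym (vpart_unique hsub hvert av vD main)).
Qed.

Variable nabla : (M -> V) -> (M -> V) -> (M -> V -> V).
Hypothesis lc : levi_civita_chern L nabla.
Variables (U : set M) (Z H : M -> V).
Hypotheses (oU : open U) (Up : U p) (sZ : smooth_vf U Z) (sH : smooth_vf U H).
Hypotheses (Zp : Z p = v) (aZ : forall q, U q -> adm L q (Z q)).
Hypothesis hH : forall q, U q -> ghorizontal sigma L q (Z q) (H q).
Let e := H p.
Local Notation Gam := (christoffel nabla p v).
Local Notation vp := (vpart sigma L p v).

Let he : ghorizontal sigma L p v e. Proof. by rewrite -Zp; exact: hH. Qed.

Let cn := chern_connection lc.

(** Horizontality of [H] along [Z] reads H(x) Phi(x, Z(x)) = 0 in the chart; this is its derivative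
    by the product and chain rules. *)
Lemma vpart_horizontal_derive h :
  vp ('D_h (vf_in_chart p H) x0) +
  'D_(h, 'D_h (vf_in_chart p Z) x0) (fun z => e *m Phi z) (x0, v) = 0.
Proof.
pose U2 := U `&` (dom p `&` sigma @^-1` dom (sigma p)).
have oU2 : open U2.
  by do 2?[apply: openI => //]; [exact: dom_open|exact: open_preimage_dom].
have oW := open_chart_image (p := p) oU2.
have W0 : chart_image p U2 x0.
  by apply: chart_image_coord; [exact: dom_center|split=> //; split; exact: dom_center].
have U2U : U2 `<=` U by move=> q [].
have dH := smooth_differentiable (smooth_vf_subset U2U sH (p := p)) W0.
have dZ := smooth_differentiable (smooth_vf_subset U2U sZ (p := p)) W0.
pose zeta x := (x, vf_in_chart p Z x).
have zeta0 : zeta x0 = (x0, v) by rewrite /zeta vf_in_chart_center Zp.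
have did : differentiable (fun x : V => x) x0 by [].
have dz : differentiable zeta x0 by exact: (differentiable_pair did dZ).
have Dz : 'D_h zeta x0 = (h, 'D_h (vf_in_chart p Z) x0).
  by rewrite (derive_pair h did dZ) derive_id.
have dPz i j : differentiable (fun x => Phi (zeta x) i j) x0.
  have dP := dPhi i j av; rewrite -zeta0 in dP; exact: (differentiable_comp dz dP).
have [_ E] := derive_row_mulmx h dH dPz.
have E0 : 'D_h (fun x => vf_in_chart p H x *m Phi (zeta x)) x0 = 0.
  rewrite -[RHS](derive_cst (0 : V) x0 h); apply: (derive_eq_on oW) W0.
  move=> x /chart_imageP[px [Ux [dx sx]]]; have [_ Ex] := coordVK px.
  apply: (const_ext_inj dx).
  have := vpart_in_chart hsub hvert (u := vf_in_chart p Z x) dx sx.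
  have cE (X : M -> V) : const_ext p (vf_in_chart p X x) (coordV p x) = X (coordV p x).
    by have := const_ext_vf X dx; rewrite Ex.
  rewrite (cE Z) => /(_ (aZ Ux) (vf_in_chart p H x)); rewrite (cE H) Ex => <-.
  exact: (vpart_eq0 hsub hvert (aZ Ux) (hH Ux)).
have PD := (phi_derive e (h, 'D_h (vf_in_chart p Z) x0)).2.
have ME : (\matrix_(i, j) 'D_h (fun x => Phi (zeta x) i j) x0) =
    DPhi (h, 'D_h (vf_in_chart p Z) x0) :> 'M[R]_n.
  apply/matrixP => i j; rewrite [LHS]mxE [RHS]mxE -Dz.
  have dP := dPhi i j av; rewrite -zeta0 in dP.
  by have := derive_comp h dz dP; rewrite zeta0.
rewrite E0 zeta0 -(vpart_center _ av) vf_in_chart_center ME in E.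
exact: (etrans (congr1 (fun w => vp ('D_h (vf_in_chart p H) x0) + w) PD) (esym E)).
Qed.

(** Replaces the constant extensions in the definition of chi by the given [Z] and the horizontal
    [H]. The correction by C^sharp arises because the vertical projection depends on the direction,
    which moves with [Z]. *)
Lemma oneill_chiE h :
  oneill_chi sigma L nabla p v h e =
  vp (nabla_at nabla p v h H)
  + vp (2 *: cartan_sharp L p v (nabla_at nabla p v h Z) e).
Proof.
pose E := const_ext p e; pose C := const_ext p v.
have Cp : C p = v by exact: const_ext_center.
have Ep : E p = e by exact: const_ext_center.
pose K q := vpart sigma L q (C q) (E q).
pose U1 := dom p `&` (fun q => O (coord p q, v)).
have U1P q : U1 q -> [/\ dom p q, dom (sigma p) (sigma q) & adm L q (C q)].
  by move=> [pq /(tset_submersionP _ pq)[]].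
have U1p : U1 p by split; [exact: dom_center|exact: Oz0].
have oU1 : open U1.
  rewrite openE => q [pq Oq].
  have sp := smooth_pair openT (@smooth_id _ V _ openT) (smooth_cst openT v).
  have cp := differentiable_continuous (smooth_differentiable sp (I : setT (coord p q))).
  have N1 : nbhs (coord p q, v) O by exact: open_nbhs_nbhs.
  have N2 : nbhs (coord p q) (fun x => O (x, v)) by exact: (cp _ N1).
  by move: (near_dom pq) (nbhs_coord pq N2); apply: filterS2 => r pr Or; split.
have oW := open_chart_image (p := p) oU1.
have W0 : chart_image p U1 x0 by apply: chart_image_coord => //; exact: dom_center.
have KE x : chart_image p U1 x -> vf_in_chart p K x = e *m Phi (x, v).
  move=> /chart_imageP[px U1x]; have [dx sx ax] := U1P _ U1x.
  have [_ Ex] := coordVK px.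
  have := vpart_in_chart hsub hvert dx sx ax e; rewrite Ex => KE.
  have KE' : K (coordV p x) = const_ext p (e *m Phi (x, v)) (coordV p x) by exact: KE.
  have H1 := const_ext_vf K dx; rewrite Ex KE' in H1.
  apply/eqP; rewrite -subr_eq0; apply/eqP; apply: (const_ext_inj dx).
  have := const_ext_linear p (coordV p x) (-1) (e *m Phi (x, v)) (vf_in_chart p K x).
  by rewrite H1 !scaleN1r addNr addrC.
have sK : smooth_vf U1 K.
  apply: (smooth_vf_chart (p := p)) => //; first by move=> q [].
  apply: (smooth_eq oW (f := fun x => e *m Phi (x, v))).
    by move=> x Wx; rewrite KE.
  have sz : smooth_on (chart_image p U1) (fun x => (x, v)).
    by apply: (smooth_pair oW (smooth_id oW)); exact: smooth_cst.
  have zO x : chart_image p U1 x -> O (x, v).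
    by move=> /chart_imageP[px [_]]; have [_ ->] := coordVK px.
  have sPz i j := smooth_comp oW (coordinates_pair n n) zO sz
    (smooth_vpart_mx hsub hvert (p := p) i j).
  have sM := smooth_mx_mul oW (fun i j => smooth_cst oW (e i j)) sPz.
  apply/(smooth_rowP oW) => j.
  exact: (smooth_eq oW _ (sM 0 j)).
have sE : smooth_vf U1 E.
  by apply: smooth_vf_subset (const_ext_smooth p e) => q [].
have [a aD] : exists a, a = 'D_(h, 0) (fun z => e *m Phi z) (x0, v) by eexists.
have DK : 'D_h (vf_in_chart p K) x0 = a.
  rewrite (derive_eq_on oW h KE W0).
  have A (t : R) : (t *: h + x0, v) = t *: (h, 0) + (x0, v).
    by congr pair; rewrite /= scaler0 add0r.
  rewrite aD; exact: (@derive_affine _ _ _ _ (fun x : V => (x, v))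
    (fun z => e *m Phi z) x0 h (h, 0) A).
have Gam0 : Gam h 0 = 0.
  by have := christoffelDr lc av h 0 0; rewrite addr0 => /eqP;
    rewrite -subr_eq subrr eq_sym => /eqP.
have Kp : K p = 0 by rewrite /K Cp Ep; exact: vpart_eq0.
have nK : nabla_at nabla p v h K = a.
  by rewrite (nabla_atE cn av h oU1 U1p sK) DK Kp Gam0 addr0.
have sNK : smooth_vf U1 (fun q => - K q).
  move=> q; have oWq := open_chart_image (p := q) oU1.
  by apply: (smooth_eq oWq) (smooth_opp oWq (sK q)) => x _; rewrite /vf_in_chart linearN.
have sEK := smooth_vf_add oU1 sE sNK.
have dKc := smooth_differentiable (sK p) W0.
have DEK : 'D_h (vf_in_chart p (fun q => E q - K q)) x0 = - a.
  rewrite -DK -[RHS]add0r -[X in _ = X - _](derive_cst e x0 h).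
  rewrite -(deriveB (derivable_cst e x0 h) (diff_derivable dKc)).
  apply: (derive_eq_on oW) W0 => x /chart_imageP[px _].
  by rewrite {1}/vf_in_chart linearB/= -/(vf_in_chart p E x) vf_in_chart_const.
have nEK : nabla_at nabla p v h (fun q => E q - K q) = Gam h e - a.
  by rewrite (nabla_atE cn av h oU1 U1p sEK) DEK Kp Ep subr0 addrC.
have [db _] := vpart_derive_slice e 0.
have [b bdef] : exists b, forall k, 'D_k (fun w => vpart sigma L p w e) v = b k.
  by exists (fun k => 'D_k (fun w => vpart sigma L p w e) v).
have bE k : b k = vp (2 *: cartan_sharp L p v k e) by rewrite -bdef; exact: vpart_derive.
have vb k : vp (b k) = b k.
  by rewrite bE; apply: (vpart_id hsub hvert av); exact: (vpart_vertical hsub hvert _ av).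
have bD k l : b (k + l) = b k + b l by rewrite -!bdef; exact: deriveDr.
have Nb k : 'D_k (fun w => e - vpart sigma L p w e) v = - b k.
  have := deriveB (derivable_cst e v k) (diff_derivable (v := k) db).
  by rewrite derive_cst add0r bdef.
(* The second summand is the horizontal part of a - b(Gam h v), which is vertical, so it will
   vanish. The sign before [b] changes in the first one because e^bot = e - e^top. *)
have chiE : oneill_chi sigma L nabla p v h e =
    vp (nabla_at nabla p v h (fun q => E q - K q) -
        'D_(Gam h v) (fun w => e - vpart sigma L p w e) v) +
    (nabla_at nabla p v h K - b (Gam h v) -
      vp (nabla_at nabla p v h K - b (Gam h v))).
  by rewrite -bdef /oneill_chi /nabla_avf -/E -/C Cp Ep.
pose DH := 'D_h (vf_in_chart p H) x0; pose DZ := 'D_h (vf_in_chart p Z) x0.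
(* [a] is the position part of the derivative of e^top and [b] its direction part. Horizontality of
   [H] ties them to the derivatives of [H] and [Z], which eliminates the constant extensions. *)
have aE : a = - vp DH - b DZ.
  have := vpart_horizontal_derive h; rewrite -/DH -/DZ.
  have -> : (h, DZ) = (h, 0) + (0, DZ) :> (V * V)%type.
    by congr pair; rewrite /= ?addr0 ?add0r.
  rewrite (deriveDr _ _ (phi_derive e 0).1) -aD -(vpart_derive_slice e DZ).2 bdef.
  by move=> /eqP; rewrite addrCA addr_eq0 opprD => /eqP.
have vv : vp (vp DH) = vp DH.
  exact: (vpart_id hsub hvert av (vpart_vertical hsub hvert DH av)).
have va : vp a = a.
  by rewrite aE (vpartB hsub hvert _ _ av) (vpartN hsub hvert _ av) vb vv.
rewrite chiE nEK nK Nb opprK.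
have -> : nabla_at nabla p v h H = DH + Gam h e by exact: (nabla_atE cn av h oU Up sH).
have -> : nabla_at nabla p v h Z = DZ + Gam h v.
  by have := nabla_atE cn av h oU Up sZ; rewrite Zp.
rewrite -bE bD !(vpartD hsub hvert _ _ av) !(vpartN hsub hvert _ av) va !vb subrr addr0.
rewrite aE opprD !opprK.
move: (vp DH) (vp (Gam h e)) (b DZ) (b (Gam h v)) => r1 r2 r3 r4.
by rewrite addrA addrA [r2 + r1]addrC.
Qed.

End ONeillFormula.

Lemma smooth_derive_comm_row (R : realType) (W : normedModType R) n (U : set W)
    (f : W -> 'rV[R]_n) e h x : open U -> smooth_on U f -> U x ->
  'D_e ('D_h f) x = 'D_h ('D_e f) x.
Proof.
move=> oU sf Ux; apply/rowP => j.
have sfj := (smooth_rowP oU _).1 sf j.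
have E k y : U y -> 'D_k f y 0 j = 'D_k (fun z => f z 0 j) y.
  by move=> Uy; apply: derive_rowE; exact: smooth_differentiable sf Uy.
have D k l : 'D_k ('D_l f) x 0 j = 'D_k ('D_l (fun z => f z 0 j)) x.
  rewrite derive_rowE; last exact: smooth_differentiable (smooth_derive l sf) Ux.
  by apply: (derive_eq_on oU) Ux => y Uy; exact: E.
exact: (etrans (D e h) (etrans (smooth_derive_comm e h oU sfj Ux) (esym (D h e)))).
Qed.

Lemma pairwise_sum_eq0 (R : realDomainType) (r1 r2 r3 : R) :
  r2 + r1 = 0 -> r3 + r1 = 0 -> r2 + r3 = 0 -> r1 = 0.
Proof. move=> *; lra. Qed.

Lemma difference_split (R : nzRingType) (W : lmodType R)
    (u1 u2 a b c d ac b' d' : W) : u1 = a + b -> u2 = c + d -> ac = a - c ->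
  b = 2 *: b' -> d = 2 *: d' -> u1 - u2 = ac + 2 *: b' - 2 *: d'.
Proof. by move=> -> -> -> -> ->; rewrite opprD addrACA addrA. Qed.

Lemma half_sum (R : numFieldType) (W : lmodType R) (u1 u2 s b c d : W) :
  u1 + u2 = 2 *: s -> u1 - u2 = b + 2 *: c - 2 *: d ->
  u1 = 2^-1 *: b + s + c - d.
Proof.
move=> Hs Hd; have n2 : (2 : R) != 0 by rewrite pnatr_eq0.
have E : 2 *: u1 = 2 *: s + (b + 2 *: c - 2 *: d).
  by rewrite -Hs -Hd addrACA subrr addr0 scaler_nat mulr2n.
rewrite -[LHS](scalerK n2) E !scalerDr scalerN !scalerA mulVf// !scale1r.
by rewrite !addrA [s + _]addrC.
Qed.

(** * The second fundamental form of the submersion *)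

Section SecondForm.
Context {R : realType} {n m : nat} {M : manifold R n} {B : manifold R m}.
Variables (L : pseudo_finsler M) (L' : pseudo_finsler B) (sigma : M -> B).
Variable nabla : (M -> 'rV[R]_n) -> (M -> 'rV[R]_n) -> (M -> 'rV[R]_n -> 'rV[R]_n).
Variable nabla' : (B -> 'rV[R]_m) -> (B -> 'rV[R]_m) -> (B -> 'rV[R]_m -> 'rV[R]_m).
Hypotheses (lc : levi_civita_chern L nabla) (lc' : levi_civita_chern L' nabla').
Hypothesis hsigma : pseudo_finsler_submersion sigma L L'.
Hypothesis hvert : forall (p : M) (v : 'rV[R]_n), adm L p v ->
  nondegenerate_on (fund L p v) (vertical sigma p).
Local Notation V := 'rV[R]_n.
Variables (p : M) (U : set M) (Z : M -> V) (Z' : B -> 'rV[R]_m).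
Hypotheses (oU : open U) (Up : U p) (sZ : smooth_vf U Z).
Hypothesis aZ : forall q, U q -> adm L q (Z q).
Hypothesis hZ : forall q, U q -> ghorizontal sigma L q (Z q) (Z q).
Hypothesis pZ : projects_to sigma U Z Z'.
Hypothesis parZ : forall e,
  nabla_at nabla' (sigma p) (dmap sigma p (Z p)) e Z' = 0.

Let hsub : submersion sigma. Proof. by case: hsigma. Qed.
Let ssig : smooth_map sigma. Proof. by case: hsub. Qed.
Let b0 := sigma p.
Let x0 := coord p p.
Let y0 := coord b0 b0.
Let sc := map_in_chart sigma p b0.
Let v := Z p.
Let v' := dmap sigma p v.
Let W := chart_image p (U `&` sigma @^-1` dom b0).

Let oUs : open (U `&` sigma @^-1` dom b0).
Proof. by apply: openI => //; exact: open_preimage_dom. Qed.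

Let oW : open W. Proof. exact: open_chart_image. Qed.

Let Wx0 : W x0.
Proof.
by apply: chart_image_coord; [exact: dom_center|split=> //; exact: dom_center].
Qed.

Let ssc : smooth_on W sc.
Proof.
apply: smooth_subset (@smooth_map_in_chart _ _ _ _ _ _ ssig p b0).
by apply: chart_image_subset => q [].
Qed.

Let scx0 : sc x0 = y0.
Proof. by rewrite /sc /map_in_chart /= coordK//; exact: dom_center. Qed.

(** The projected field is controlled only on the image of [U], whereas the rules for the connection
    of the base need an open set around sigma p. *)
Lemma nbhs_image_submersion : nbhs b0 (sigma @` U).
Proof.
have surj c : exists e, 'D_e sc x0 = c.
  by have [e <-] := dmap_surj hsub p c; exists e; rewrite dmapE.
have N0 : nbhs x0 W by exact: open_nbhs_nbhs.
have N1 := smooth_surjective_near oW ssc Wx0 N0 surj; rewrite scx0 in N1.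
move: (near_dom (dom_center b0)) (nbhs_coord (dom_center b0) N1).
apply: filterS2 => b bb [x [/chart_imageP[px [Ux sx]] Ex]].
exists (coordV p x) => //.
by rewrite -(coordK sx) -[coord b0 _]/(sc x) Ex coordK.
Qed.

Let U' := (sigma @` U)^° `&` dom b0.

Let oU' : open U'.
Proof. by apply: openI; [exact: open_interior|exact: dom_open]. Qed.

Let U'b0 : U' b0.
Proof. by split; [exact: nbhs_image_submersion|exact: dom_center]. Qed.

Let sZ' : smooth_vf U' Z'.
Proof.
by case: pZ => s _; apply: smooth_vf_subset s => b [/interior_subset].
Qed.

Let pZE q : U q -> Z' (sigma q) = dmap sigma q (Z q).
Proof. by case: pZ => _ H /H ->. Qed.

Lemma adm_submersion q u : adm L q u -> ghorizontal sigma L q u u ->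
  adm L' (sigma q) (dmap sigma q u).
Proof. by case: hsigma => _ _ H au hu; case: (H q u au hu). Qed.

Let aZ' b : U' b -> adm L' b (Z' b).
Proof.
move=> [/interior_subset[q Uq <-] _]; rewrite pZE//.
exact: adm_submersion (aZ Uq) (hZ Uq).
Qed.

Let av : adm L p v. Proof. exact: aZ. Qed.
Let Z'b0 : Z' b0 = v'. Proof. exact: pZE. Qed.
Let av' : adm L' b0 v'. Proof. by rewrite -Z'b0; exact: aZ'. Qed.

Local Notation Gam := (christoffel nabla p v).
Local Notation Gam' := (christoffel nabla' b0 v').
Local Notation S := (dmap sigma p).
Local Notation G := (fund L p v).
Local Notation G' := (fund L' b0 v').

Definition second_form (c e : V) : 'rV[R]_m :=
  'D_c ('D_e sc) x0 + Gam' (S c) (S e) - S (Gam c e).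

Lemma second_form_sym c e : second_form c e = second_form e c.
Proof.
rewrite /second_form (smooth_derive_comm_row c e oW ssc Wx0).
by rewrite (christoffel_sym lc' av' (S c)) (christoffel_sym lc av c).
Qed.

Lemma cartan0r b e : cartan L' b0 v' b e 0 = 0.
Proof.
rewrite (cartan_swap23 _ _ _ av') (cartan_swap12 _ _ _ av').
have := cartan_linear1 b e (-1) 0 0 av'.
by rewrite scaler0 addr0 mulN1r addNr.
Qed.

Let metric' i j b :=
  fund L' b (Z' b) (const_ext b0 (row_basis i) b) (const_ext b0 (row_basis j) b).

Let sE' e : smooth_vf U' (const_ext b0 e).
Proof. by apply: smooth_vf_subset (const_ext_smooth b0 e) => b []. Qed.

(** The hypothesis on the projected field removes the Cartan term at sigma p, so the base metric
    along [Z'] differentiates there as a Riemannian one. *)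
Lemma dfun_metric' i j c :
  dfun (metric' i j) b0 c =
    G' (Gam' c (row_basis i)) (row_basis j) + G' (row_basis i) (Gam' c (row_basis j)).
Proof.
have := chern_almost_metric lc' oU' sZ' aZ' (sE' (row_basis i)) (sE' (row_basis j)) c U'b0.
by rewrite !const_ext_center Z'b0 parZ cartan0r mulr0 addr0.
Qed.

Let kmx x : 'M[R]_m := \matrix_(i, j) metric' i j (coordV b0 (sc x)).

Let k_derive i j c : differentiable (fun x => kmx x i j) x0 /\
  'D_c (fun x => kmx x i j) x0 =
  G' (Gam' (S c) (row_basis i)) (row_basis j) + G' (row_basis i) (Gam' (S c) (row_basis j)).
Proof.
have sm : smooth_fun U' (metric' i j) by exact: smooth_fund_fields.
have W'y0 : chart_image b0 U' y0 by apply: chart_image_coord => //; exact: dom_center.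
have dm := smooth_differentiable (sm b0) W'y0.
have dsc := smooth_differentiable ssc Wx0; rewrite -scx0 in dm.
have kE : (fun x => kmx x i j) = (metric' i j \o coordV b0) \o sc.
  by apply/funext => x; rewrite /= mxE.
rewrite kE; split; first exact: differentiable_comp.
rewrite derive_comp// scx0 -dmapE//; exact: dfun_metric'.
Qed.

Section AlongField.
Variable H : M -> V.
Hypothesis sH : smooth_vf U H.
Hypothesis hH : forall q, U q -> ghorizontal sigma L q (Z q) (H q).
Let Hc := vf_in_chart p H.

Let dHc : differentiable Hc x0.
Proof.
apply: (smooth_differentiable (sH (p := p))).
by apply: chart_image_coord => //; exact: dom_center.
Qed.

Let D2E c e : 'D_c ('D_e sc) x0 =
  e *m (\matrix_(i, j) 'D_c (fun x => dmap_mx sigma p b0 x i j) x0).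
Proof.
have dm i j : differentiable (fun x => dmap_mx sigma p b0 x i j) x0.
  apply: (smooth_differentiable (smooth_dmap_mx ssig (p := p) (b := b0) i j)).
  by apply: chart_image_coord; exact: dom_center.
have [_ E] := derive_row_mulmx c (differentiable_cst e x0) dm.
rewrite derive_cst mul0mx add0r in E; rewrite -E.
apply: (derive_eq_on oW) Wx0 => x Wx; rewrite dmap_mxE//.
by apply: chart_image_subset Wx => q [].
Qed.

Lemma derive_dmap_field c :
  differentiable (fun x => 'D_(Hc x) sc x) x0 /\
  'D_c (fun x => 'D_(Hc x) sc x) x0 = S ('D_c Hc x0) + 'D_c ('D_(H p) sc) x0.
Proof.
have dm i j : differentiable (fun x => dmap_mx sigma p b0 x i j) x0.
  apply: (smooth_differentiable (smooth_dmap_mx ssig (p := p) (b := b0) i j)).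
  by apply: chart_image_coord; exact: dom_center.
have Ws0 : chart_image p (sigma @^-1` dom b0) x0.
  by apply: chart_image_coord; exact: dom_center.
have [d E] := derive_row_mulmx c dHc dm.
have EW x : W x -> Hc x *m dmap_mx sigma p b0 x = 'D_(Hc x) sc x.
  by move=> Wx; rewrite dmap_mxE//; apply: chart_image_subset Wx => q [].
split; first exact: (differentiable_eq_on oW EW Wx0 d).
rewrite -(derive_eq_on oW c EW Wx0) E (dmap_mxE ssig _ Ws0) -dmapE//.
by rewrite D2E /Hc vf_in_chart_center.
Qed.

Lemma submersion_field q : dom p q -> dom b0 (sigma q) ->
  dmap sigma q (H q) = const_ext b0 ('D_(Hc (coord p q)) sc (coord p q)) (sigma q).
Proof.
by move=> pq sq; rewrite -(const_ext_vf H pq) (dmap_const_ext ssig _ pq sq).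
Qed.

(** Differentiates g_Z(H, h) = g'_Z'(SH, Sh) along [c], with [h] extended as a constant field of the
    chart. On the left the metric rule of the total space applies, on the right the product rule for
    a row, the matrix of g' along [Z'], and a column. *)
Lemma second_form_metric c h :
  G (nabla_at nabla p v c H) h + 2 * cartan L p v (H p) h (nabla_at nabla p v c Z) =
  G' (second_form c (H p) + S (nabla_at nabla p v c H)) (S h) + G' (S (H p)) (second_form c h).
Proof.
pose U1 := U `&` dom p.
have oU1 : open U1 by apply: openI => //; exact: dom_open.
have U1p : U1 p by split=> //; exact: dom_center.
have U1U : U1 `<=` U by move=> q [].
have sh : smooth_vf U1 (const_ext p h).
  by apply: smooth_vf_subset (const_ext_smooth p h) => q [].
have := chern_almost_metric lc oU1 (smooth_vf_subset U1U sZ) (fun q U1q => aZ (U1U q U1q))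
  (smooth_vf_subset U1U sH) sh c U1p.
rewrite const_ext_center -/v.
set f := (fun q => fund L q _ _ _) => E1.
pose a x := 'D_(Hc x) sc x.
pose be x := 'D_h sc x.
have fE x : W x -> f (coordV p x) = (a x *m kmx x *m (be x)^T) 0 0.
  move=> /chart_imageP[px [Ux sx]]; have [dx Ex] := coordVK px.
  set q := coordV p x in Ux sx dx Ex *.
  have scx : coordV b0 (sc x) = sigma q by rewrite /sc /map_in_chart /= coordK.
  rewrite /f (fund_submersion hsigma hvert _ (aZ Ux) (hZ Ux) (hH Ux)).
  have bL := fund_bilin (adm_submersion (aZ Ux) (hZ Ux)); rewrite -(pZE Ux) in bL.
  have [bq bqE] : exists bq, forall e l, bq e l =
      fund L' (sigma q) (Z' (sigma q)) (const_ext b0 e (sigma q)) (const_ext b0 l (sigma q)).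
    by eexists.
  have bb : bilin bq.
    by split=> [r e l u|u r e l]; rewrite !bqE (const_ext_linear b0 (sigma q));
      [exact: bL.1|exact: bL.2].
  have kE : gram bq = kmx x.
    by apply/matrixP => i j; rewrite [LHS]mxE [RHS]mxE bqE scx.
  rewrite (submersion_field dx sx) (dmap_const_ext ssig h dx sx) -(pZE Ux) Ex.
  by rewrite -bqE (bilin_gram bb) kE.
have [da Da] : differentiable a x0 /\ 'D_c a x0 = S ('D_c Hc x0) + 'D_c ('D_(H p) sc) x0.
  exact: derive_dmap_field.
have dbe : differentiable be x0 by exact: (smooth_differentiable (smooth_derive h ssc) Wx0).
have [dak Dak] := derive_row_mulmx c da (fun i j => (k_derive i j c).1).
have dbeT i j : differentiable (fun x => (be x)^T i j) x0.
  have -> : (fun x => (be x)^T i j) = (fun x => be x 0 i).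
    by apply/funext => x; rewrite mxE (ord1 j).
  exact: (differentiable_comp dbe (differentiable_coord _ _ _)).
have [dabk Dabk] := derive_row_mulmx c dak dbeT.
have DbeT : (\matrix_(i, j) 'D_c (fun x => (be x)^T i j) x0) = ('D_c be x0)^T.
  apply/matrixP => i j; rewrite [LHS]mxE [RHS]mxE (ord1 j) (derive_rowE c i dbe).
  by congr ('D_c _ x0); apply/funext => x; rewrite mxE.
have [g gE] : exists g, g = G' by eexists.
have bg : bilin g by rewrite gE; exact: fund_bilin.
have [b2 b2E] : exists b2, forall u w, b2 u w = g (Gam' (S c) u) w + g u (Gam' (S c) w).
  by eexists.
have lG' := christoffel_linear (chern_connection lc') av' (S c).
have bb2 : bilin b2.
  split=> [r u w z|z r u w]; rewrite !b2E lG'.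
    by rewrite !bg.1; ring.
  by rewrite !bg.2; ring.
have k0 : kmx x0 = gram g.
  apply/matrixP => i j; rewrite [LHS]mxE [RHS]mxE scx0 /y0 coordK; last exact: dom_center.
  by rewrite /metric' Z'b0 !const_ext_center gE.
have Dk : (\matrix_(i, j) 'D_c (fun x => kmx x i j) x0) = gram b2.
  by apply/matrixP => i j; rewrite [LHS]mxE [RHS]mxE b2E gE (k_derive i j c).2.
have a0 : a x0 = S (H p) by rewrite /a /Hc vf_in_chart_center dmapE.
have be0 : be x0 = S h by rewrite /be dmapE.
have E2 : dfun f p c = g (S ('D_c Hc x0) + 'D_c ('D_(H p) sc) x0) (S h)
    + b2 (S (H p)) (S h) + g (S (H p)) ('D_c ('D_h sc) x0).
  have -> : dfun f p c = 'D_c (fun x => (a x *m kmx x *m (be x)^T) 0 0) x0.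
    by apply: (derive_eq_on oW) Wx0 => x Wx; exact: fE.
  rewrite -(derive_rowE c 0 dabk) Dabk DbeT Dak Da Dk k0 a0 be0.
  rewrite mulmxDl [LHS]mxE [X in X + _]mxE.
  by rewrite -!(bilin_gram bg) -(bilin_gram bb2).
have nH : nabla_at nabla p v c H = 'D_c Hc x0 + Gam c (H p).
  exact: (nabla_atE (chern_connection lc) av c oU Up sH).
(* The metric rule leaves the term g(H, Gam(c,h)); as [H] is horizontal, it can be moved to the
   base, where it supplies the part -S Gam(c,h) of Q(c,h). *)
have SGam : G (H p) (Gam c h) = g (S (H p)) (S (Gam c h)).
  by rewrite gE; exact: (fund_submersion hsigma hvert (Gam c h) av (hZ Up) (hH Up)).
rewrite E2 b2E -[nabla_at nabla p v c (const_ext p h)]/(Gam c h) SGam in E1.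
rewrite -gE /second_form nH linearD !(bilinBr bg, bilinDr bg, bilinBl bg, bilinDl bg).
rewrite !(bilinDl bg) in E1; rewrite nH in E1.
move: E1; move: (g (S ('D_c Hc x0)) (S h)) (g ('D_c ('D_(H p) sc) x0) (S h))
  (g (Gam' (S c) (S (H p))) (S h)) (g (S (Gam c (H p))) (S h))
  (g (S (H p)) ('D_c ('D_h sc) x0)) (g (S (H p)) (Gam' (S c) (S h)))
  (g (S (H p)) (S (Gam c h))) => g1 g2 g3 g4 g5 g6 g7.
move: (G _ _) (cartan _ _ _ _ _ _) => r1 r2 E1.
lra.
Qed.

End AlongField.

(** Differentiating S Z = Z' o sigma along [c] gives D^2 sigma(c,v) + S D_c Z = D_(Sc) Z', and the
    hypothesis identifies the right side with -Gam'(Sc, Sv). *)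
Lemma second_form_parallel c : second_form c v + S (nabla_at nabla p v c Z) = 0.
Proof.
have [da Da] := derive_dmap_field sZ c.
have W'y0 : chart_image b0 U' y0 by apply: chart_image_coord => //; exact: dom_center.
have dZ' := smooth_differentiable (sZ' (p := b0)) W'y0; rewrite -scx0 in dZ'.
have dsc := smooth_differentiable ssc Wx0.
have E : 'D_c (fun x => 'D_(vf_in_chart p Z x) sc x) x0 =
    'D_(S c) (vf_in_chart b0 Z') y0.
  have -> : 'D_(S c) (vf_in_chart b0 Z') y0 = 'D_c (vf_in_chart b0 Z' \o sc) x0.
    by rewrite (derive_comp c dsc dZ') scx0 -(dmapE ssig).
  apply: (derive_eq_on oW) Wx0 => x /chart_imageP[px [Ux sx]].
  have [dx Ex] := coordVK px; apply/eqP; rewrite -subr_eq0; apply/eqP.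
  apply: (const_ext_inj sx).
  have := submersion_field Z dx sx; rewrite Ex -(pZE Ux) => H1.
  have scx : sc x = coord b0 (sigma (coordV p x)) by [].
  have H2 := const_ext_vf Z' sx; rewrite -scx in H2.
  have := const_ext_linear b0 (sigma (coordV p x)) (-1)
    (vf_in_chart b0 Z' (sc x)) ('D_(vf_in_chart p Z x) sc x).
  by rewrite !scaleN1r H2 -H1 addNr addrC.
have P := nabla_atE (chern_connection lc') av' (S c) oU' U'b0 sZ'.
rewrite parZ Z'b0 -E Da in P.
have nZ : nabla_at nabla p v c Z = 'D_c (vf_in_chart p Z) x0 + Gam c v.
  exact: (nabla_atE (chern_connection lc) av c oU Up sZ).
have SnZ : S (nabla_at nabla p v c Z) = S ('D_c (vf_in_chart p Z) x0) + S (Gam c v).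
  by rewrite nZ linearD.
apply: etrans (esym P); rewrite SnZ /second_form -/v'.
by rewrite [S _ + S _]addrC addrA subrK addrC addrA.
Qed.

Let N c := nabla_at nabla p v c Z.

Lemma nabla_extD c d : N (c + d) = N c + N d.
Proof.
have nZ k : N k = 'D_k (vf_in_chart p Z) x0 + Gam k v.
  exact: (nabla_atE (chern_connection lc) av k oU Up sZ).
have dZ : differentiable (vf_in_chart p Z) x0.
  apply: (smooth_differentiable (sZ (p := p))).
  by apply: chart_image_coord => //; exact: dom_center.
by rewrite !nZ (deriveDr _ _ dZ) (christoffelDl lc av) addrACA.
Qed.

Let hv : ghorizontal sigma L p v v. Proof. exact: hZ. Qed.
Let bG : bilin G. Proof. exact: fund_bilin. Qed.
Let bG' : bilin G'. Proof. exact: fund_bilin. Qed.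

Let fundS e h : ghorizontal sigma L p v e -> G e h = G' (S e) (S h).
Proof. exact: (fund_submersion hsigma hvert h av hv). Qed.

Lemma fund_nabla_ext c h : G (N c) h = G' (second_form c h) (S v).
Proof.
have Mt := second_form_metric sZ hZ c h.
have C0 : cartan L p v v h (N c) = 0 by exact: cartan_self.
have B0 : G' (second_form c v + S (N c)) (S h) = 0.
  by rewrite second_form_parallel (bilin0l bG').
have F : G' (S v) (second_form c h) = G' (second_form c h) (S v) by exact: fund_sym.
move: Mt; rewrite -/v -/(N c) B0 C0 F mulr0 addr0 add0r; exact.
Qed.

Lemma fund_nabla_ext_sym c h : G (N c) h = G (N h) c.
Proof. by rewrite !fund_nabla_ext second_form_sym. Qed.

(** For horizontal [h], also g(nabla_c H, h) passes to the base and cancels against the same term on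
    the other side of [second_form_metric]. *)
Lemma second_form_horizontal (H : M -> V) c h : smooth_vf U H ->
  (forall q, U q -> ghorizontal sigma L q (Z q) (H q)) ->
  ghorizontal sigma L p v h ->
  G' (second_form c (H p)) (S h) + G' (second_form c h) (S (H p)) =
  2 * cartan L p v (H p) h (N c).
Proof.
move=> sH hH hh; have Mt := second_form_metric sH hH c h.
have e1 : G (nabla_at nabla p v c H) h = G' (S (nabla_at nabla p v c H)) (S h).
  exact: (etrans (fund_sym _ _ av) (etrans (fundS _ hh) (fund_sym _ _ av'))).
have e2 : G' (S (H p)) (second_form c h) = G' (second_form c h) (S (H p)).
  exact: fund_sym.
rewrite e1 e2 (bilinDl bG') -/(N c) in Mt; move: Mt.
move: (G' (S (nabla_at nabla p v c H)) (S h)) (cartan _ _ _ _ _ _).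
move: (G' (second_form c (H p)) (S h)) (G' (second_form c h) (S (H p))).
by move=> r1 r2 r3 r4 Mt; apply: (addrI r3); rewrite Mt addrCA addrA.
Qed.

(** By symmetry of Q, g(N v, h) = g'(Q(h,v), Sv); twice this number is 2 C(v, v, N h) = 0, by the
    preceding relation with H = Z and v as the horizontal vector. *)
Lemma nabla_ext_self : N v = 0.
Proof.
apply: (fund_nd av) => h; rewrite fund_nabla_ext second_form_sym.
have Mt := second_form_horizontal h sZ hZ hv.
have C0 : cartan L p v v v (N h) = 0 by exact: cartan_self.
rewrite -/v C0 mulr0 in Mt; move: Mt; move: (G' _ _) => r /eqP.
by rewrite -mulr2n mulrn_eq0/= => /eqP.
Qed.

(** The horizontal part of [u] is orthogonal to vertical vectors by construction and to horizontal
    ones by assumption, hence 0. *)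
Lemma orthogonal_horizontal_vertical u :
  (forall k, ghorizontal sigma L p v k -> G u k = 0) -> vertical sigma p u.
Proof.
move=> H; suff d0 : u - vpart sigma L p v u = 0.
  have -> : u = vpart sigma L p v u by apply/eqP; rewrite -subr_eq0 d0.
  exact: (vpart_vertical hsub hvert u av).
have hd := hpart_horizontal hsub hvert u av.
have vu := vpart_vertical hsub hvert u av.
apply: (fund_nd av) => k.
have hk := hpart_horizontal hsub hvert k av.
have vk := vpart_vertical hsub hvert k av.
have kE : k = (k - vpart sigma L p v k) + vpart sigma L p v k by rewrite subrK.
rewrite {1}kE (bilinDr bG) (hd _ vk) addr0 (bilinBl bG) (H _ hk).
by rewrite (fund_sym _ _ av) (hk _ vu) subrr.
Qed.

(** * The tensor A on horizontal fields *)

Section Pair.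
Variables X Y : M -> V.
Hypotheses (sX : smooth_vf U X) (sY : smooth_vf U Y).
Hypothesis hX : forall q, U q -> ghorizontal sigma L q (Z q) (X q).
Hypothesis hY : forall q, U q -> ghorizontal sigma L q (Z q) (Y q).
Let x := X p.
Let y := Y p.
Let hx : ghorizontal sigma L p v x. Proof. exact: hX. Qed.
Let hy : ghorizontal sigma L p v y. Proof. exact: hY. Qed.
Local Notation vp := (vpart sigma L p v).
Local Notation Cs := (cartan_sharp L p v).
Local Notation A := (oneillA sigma L nabla p v).

(** For horizontal k, the numbers g'(Q(x,k), Sv), g'(Q(v,x), Sk) and g'(Q(v,k), Sx) have zero
    pairwise sums: two of these are Cartan terms containing [v], the third is 2 C(x, k, N v) with N
    v = 0. So all three vanish, and the first is g(N x, k). *)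
Lemma nabla_ext_vertical : vertical sigma p (N x).
Proof.
apply: orthogonal_horizontal_vertical => k hk.
have E1 := second_form_horizontal x sZ hZ hk.
have E2 := second_form_horizontal k sZ hZ hx.
have E3 := second_form_horizontal v sX hX hk.
have C1 : cartan L p v v k (N x) = 0 by exact: cartan_self.
have C2 : cartan L p v v x (N k) = 0 by exact: cartan_self.
have C0 : cartan L p v x k 0 = 0.
  have C3 := cartan_linear1 x k (-1) 0 0 av.
  rewrite scaler0 addr0 mulN1r addNr in C3.
  exact: (etrans (cartan_swap23 x k 0 av) (etrans (cartan_swap12 x 0 k av) C3)).
rewrite -/v C1 mulr0 (second_form_sym x v) in E1.
rewrite -/v C2 mulr0 (second_form_sym k x) (second_form_sym k v) in E2.
rewrite -/x nabla_ext_self C0 mulr0 in E3.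
rewrite fund_nabla_ext.
move: E1 E2 E3.
move: (G' (second_form x k) (S v)) (G' (second_form v x) (S k)) (G' (second_form v k) (S x)).
by move=> r1 r2 r3; exact: pairwise_sum_eq0.
Qed.

Lemma hpart_x : hpart sigma L p v x = x.
Proof. by rewrite /hpart (vpart_eq0 hsub hvert av hx) subr0. Qed.

Lemma oneillAE : A x y = vp (nabla_at nabla p v x Y) + vp (2 *: Cs (N x) y).
Proof.
rewrite /oneillA hpart_x.
exact: (oneill_chiE hsub hvert av lc oU Up sZ sY (erefl v) aZ hY).
Qed.

Lemma oneillA_vertical : vertical sigma p (A x y).
Proof.
by rewrite oneillAE; apply: verticalD; exact: (vpart_vertical hsub hvert _ av).
Qed.

(** In [second_form_metric] with c = x and H = Y, vertical [w] has S w = 0, so only g'(Sy, Q(x,w))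
    remains on the right. The Cartan term on the left is exactly the pairing of [w] with the
    correction 2 C^sharp(N x, y) of [oneillAE]. *)
Lemma fund_oneillA w : vertical sigma p w ->
  G (A x y) w = G' (second_form x w) (S y).
Proof.
move=> vw.
have e1 : G (vp (nabla_at nabla p v x Y)) w = G (nabla_at nabla p v x Y) w.
  exact: (fund_vpart hsub hvert _ av vw).
have e2 : G (vp (2 *: Cs (N x) y)) w = G (2 *: Cs (N x) y) w.
  exact: (fund_vpart hsub hvert _ av vw).
have e3 : G (2 *: Cs (N x) y) w = 2 * G (Cs (N x) y) w by exact: bilinZl.
have e4 : G (Cs (N x) y) w = G w (Cs (N x) y) by exact: fund_sym.
have e5 : G w (Cs (N x) y) = cartan L p v w (N x) y by exact: cartan_sharpP.
have e6 : cartan L p v w (N x) y = cartan L p v y w (N x).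
  exact: (etrans (cartan_swap23 w (N x) y av) (cartan_swap12 w y (N x) av)).
have e7 := etrans e2 (etrans e3 (congr1 (fun r => 2 * r) (etrans e4 (etrans e5 e6)))).
have Sw : S w = 0 by exact: vw.
have Mt := second_form_metric sY hY x w.
rewrite Sw (bilin0r bG') add0r in Mt.
rewrite oneillAE; apply: etrans (bilinDl bG _ _ _) _.
apply: etrans (congr2 (fun r s => r + s) e1 e7) _.
exact: (etrans Mt (fund_sym _ _ av')).
Qed.

End Pair.

Local Notation vp := (vpart sigma L p v).
Local Notation Cs := (cartan_sharp L p v).
Local Notation A := (oneillA sigma L nabla p v).

Lemma cartan_sharp_eq e h c : (forall b, cartan L p v b e h = G b c) -> Cs e h = c.
Proof.
move=> H; apply/eqP; rewrite -subr_eq0; apply/eqP; apply: (fund_nd av) => b.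
have E : G b (Cs e h) = G b c by exact: (etrans (cartan_sharpP e h av b) (H b)).
apply: etrans (fund_sym _ _ av) _; apply: etrans (bilinBr bG _ _ _) _.
by rewrite E subrr.
Qed.

Lemma cartan_sharp_sym e h : Cs e h = Cs h e.
Proof.
apply: cartan_sharp_eq => b.
exact: (etrans (cartan_swap23 b e h av) (esym (cartan_sharpP h e av b))).
Qed.

Lemma cartan_sharp_self e : Cs e v = 0.
Proof.
apply: cartan_sharp_eq => b; rewrite (bilin0r bG).
apply: etrans (cartan_swap23 b e v av) _.
exact: (etrans (cartan_swap12 b v e av) (cartan_self b e av)).
Qed.

Lemma cartan_sharp0 e : Cs 0 e = 0.
Proof.
apply: cartan_sharp_eq => b; rewrite (bilin0r bG).
have C3 := cartan_linear1 b e (-1) 0 0 av.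
rewrite scaler0 addr0 mulN1r addNr in C3.
exact: (etrans (cartan_swap12 b 0 e av) C3).
Qed.

Lemma vpart0 : vp 0 = 0.
Proof. exact: (vpart_id hsub hvert av (vertical0 sigma p)). Qed.

Lemma oneill_chi_ext c : oneill_chi sigma L nabla p v c v = vp (N c).
Proof.
have := oneill_chiE hsub hvert av lc oU Up sZ sZ (erefl v) aZ hZ c.
by rewrite -/v cartan_sharp_self scaler0 vpart0 addr0.
Qed.

(** T and A evaluate chi on the two parts of [c], and chi_c v is additive in [c]. This covers c =
    C^sharp(x,y), which need be neither vertical nor horizontal. *)
Lemma oneillTA_ext c : oneillT sigma L nabla p v c v + A c v = vp (N c).
Proof.
rewrite /oneillT /oneillA !oneill_chi_ext -(vpartD hsub hvert _ _ av) -nabla_extD.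
by rewrite /hpart addrC subrK.
Qed.

(** * Symmetric and antisymmetric parts of A *)

Section Conclusion.
Variables X Y : M -> V.
Hypotheses (sX : smooth_vf U X) (sY : smooth_vf U Y).
Hypothesis hX : forall q, U q -> ghorizontal sigma L q (Z q) (X q).
Hypothesis hY : forall q, U q -> ghorizontal sigma L q (Z q) (Y q).
Let x := X p.
Let y := Y p.

Lemma oneillA_ext : A x v = N x.
Proof.
rewrite (oneillAE sZ hX hZ) -/v cartan_sharp_self scaler0 vpart0 addr0.
exact: (vpart_id hsub hvert av (nabla_ext_vertical sX hX)).
Qed.

(** Tested on vertical w, the left side is g'(Q(w,x), Sy) + g'(Q(w,y), Sx) = 2 C(x, y, N w) = 2 g(N
    w, C^sharp(x,y)). The self-adjointness of N moves it onto C^sharp(x,y). *)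
Lemma oneillA_sum : A x y + A y x = 2 *: vp (N (Cs x y)).
Proof.
have vA1 := oneillA_vertical sY hX hY; have vA2 := oneillA_vertical sX hY hX.
apply: (vertical_eq hvert av (verticalD vA1 vA2)).
  exact: (verticalZ 2 (vpart_vertical hsub hvert _ av)).
move=> w vw; apply: etrans (bilinDl bG _ _ _) _.
have e1 := fund_oneillA sY hX hY vw; have e2 := fund_oneillA sX hY hX vw.
apply: etrans (congr2 (fun r s => r + s) e1 e2) _.
rewrite (second_form_sym (X p) w) (second_form_sym (Y p) w).
apply: etrans (second_form_horizontal w sX hX (hY Up)) _.
have e3 : G (2 *: vp (N (Cs x y))) w = 2 * G (vp (N (Cs x y))) w by exact: bilinZl.
have e4 : G (vp (N (Cs x y))) w = G (N (Cs x y)) w.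
  exact: (fund_vpart hsub hvert _ av vw).
have e5 : G (N w) (Cs x y) = cartan L p v (N w) x y by exact: cartan_sharpP.
have e6 : cartan L p v x y (N w) = cartan L p v (N w) x y.
  exact: (etrans (cartan_swap23 x y (N w) av) (cartan_swap12 x (N w) y av)).
apply/esym/(etrans e3); apply: (congr1 (fun r => 2 * r)).
exact: (etrans e4 (etrans (fund_nabla_ext_sym _ _) (etrans e5 (esym e6)))).
Qed.

Lemma bracket_nabla : nabla_at nabla p v x Y - nabla_at nabla p v y X = bracket X Y p.
Proof.
have nY := nabla_atE (chern_connection lc) av x oU Up sY.
have nX := nabla_atE (chern_connection lc) av y oU Up sX.
have sy : Gam x y = Gam y x := christoffel_sym lc av x y.
rewrite nY nX sy opprD addrACA subrr addr0.
by [].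
Qed.

(** Subtracting the two instances of [oneillAE], torsion-freeness produces the bracket, while N x =
    A_x v and N y = A_y v rewrite the Cartan corrections. *)
Lemma oneillA_diff : A x y - A y x =
  vp (bracket X Y p) + 2 *: vp (Cs (A x v) y) - 2 *: vp (Cs x (A y v)).
Proof.
have Ayv : N y = A y v.
  apply/esym/(etrans (oneillAE sZ hY hZ)).
  rewrite cartan_sharp_self scaler0 vpart0 addr0.
  exact: (vpart_id hsub hvert av (nabla_ext_vertical sY hY)).
have e1 := vpartB hsub hvert (nabla_at nabla p v x Y) (nabla_at nabla p v y X) av.
rewrite bracket_nabla in e1.
have e2 : vp (2 *: Cs (N x) y) = 2 *: vp (Cs (A x v) y).
  apply: etrans (vpartZ hsub hvert 2 _ av) _.
  exact: (congr1 (fun k => 2 *: vp (Cs k y)) (esym oneillA_ext)).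
have e3 : vp (2 *: Cs (N y) x) = 2 *: vp (Cs x (A y v)).
  apply: etrans (vpartZ hsub hvert 2 _ av) _.
  apply: (congr1 (fun k => 2 *: vp k)).
  exact: (etrans (cartan_sharp_sym (N y) x) (congr1 (fun k => Cs x k) Ayv)).
exact: (difference_split (oneillAE sY hX hY) (oneillAE sX hY hX) e1 e2 e3).
Qed.

Lemma oneillA_formula : A x y = 2^-1 *: vp (bracket X Y p) + vp (N (Cs x y))
  + vp (Cs (A x v) y) - vp (Cs x (A y v)).
Proof.
exact: (half_sum oneillA_sum oneillA_diff).
Qed.

End Conclusion.

(** The general formula with Y = V: the terms in C^sharp with [v] as an argument vanish, and the
    last one does because A_v v = N v = 0. *)
Lemma oneillA_ext_bracket (X : M -> V) : smooth_vf U X ->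
  (forall q, U q -> ghorizontal sigma L q (Z q) (X q)) ->
  A (X p) v = 2^-1 *: vp (bracket X Z p).
Proof.
move=> sX hX; have N0 : N 0 = 0.
  by have /eqP := nabla_extD 0 0; rewrite addr0 -subr_eq subrr eq_sym => /eqP.
have Avv : A v v = 0 by rewrite (oneillA_ext sZ hZ) nabla_ext_self.
rewrite (oneillA_formula sX sZ hX hZ) -/v Avv !cartan_sharp_self.
by rewrite (cartan_sharp_sym _ 0) cartan_sharp0 N0 vpart0 subr0 !addr0.
Qed.

End SecondForm.

Theorem proposition5 (R : realType) (n m : nat)
    (M : manifold R n) (B : manifold R m)
    (L : pseudo_finsler M) (L' : pseudo_finsler B) (sigma : M -> B)
    (nabla : (M -> 'rV[R]_n) -> (M -> 'rV[R]_n) -> (M -> 'rV[R]_n -> 'rV[R]_n))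
    (nabla' : (B -> 'rV[R]_m) -> (B -> 'rV[R]_m) -> (B -> 'rV[R]_m -> 'rV[R]_m))
    (hnabla : levi_civita_chern L nabla)
    (hnabla' : levi_civita_chern L' nabla')
    (hsigma : pseudo_finsler_submersion sigma L L')
    (hvert : forall (p : M) (v : 'rV[R]_n), adm L p v ->
       nondegenerate_on (fund L p v) (vertical sigma p))
    (p : M) (v x y : 'rV[R]_n)
    (U : set M) (V X Y : M -> 'rV[R]_n) (V' : B -> 'rV[R]_m)
    (hU : open U) (hp : U p)
    (hV : smooth_vf U V) (hX : smooth_vf U X) (hY : smooth_vf U Y)
    (hVadm : forall q : M, U q -> adm L q (V q))
    (hVhor : forall q : M, U q -> ghorizontal sigma L q (V q) (V q))
    (hVproj : projects_to sigma U V V')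
    (hXhor : forall q : M, U q -> ghorizontal sigma L q (V q) (X q))
    (hYhor : forall q : M, U q -> ghorizontal sigma L q (V q) (Y q))
    (hv : V p = v) (hx : X p = x) (hy : Y p = y)
    (hpar : forall e : 'rV[R]_m,
       nabla_at nabla' (sigma p) (dmap sigma p v) e V' = 0) :
  let A := oneillA sigma L nabla p v in
  let TA := fun b e : 'rV[R]_n => oneillT sigma L nabla p v b e + A b e in
  let top := vpart sigma L p v in
  let Csharp := cartan_sharp L p v in
  [/\ A x y = 2^-1 *: top (bracket X Y p) + TA (Csharp x y) v
              + top (Csharp (A x v) y) - top (Csharp x (A y v)),
      A x v = 2^-1 *: top (bracket X V p)
    & A x y + A y x = 2 *: TA (Csharp x y) v].
Proof.
move=> A TA top Csharp; subst v x y.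
have TAE c : TA c (V p) = top (nabla_at nabla p (V p) c V).
  exact: (oneillTA_ext hnabla hsigma hvert hU hp hV hVadm hVhor c).
split.
- rewrite TAE.
  exact: (oneillA_formula hnabla hnabla' hsigma hvert hU hp hV hVadm hVhor hVproj hpar
    hX hY hXhor hYhor).
- exact: (oneillA_ext_bracket hnabla hnabla' hsigma hvert hU hp hV hVadm hVhor hVproj
    hpar hX hXhor).
- rewrite TAE.
  exact: (oneillA_sum hnabla hnabla' hsigma hvert hU hp hV hVadm hVhor hVproj hpar
    hX hY hXhor hYhor).
Qed.
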